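(* Let $f$ and $g$ be nonlinearizable germs (of the form $e^{2\pi i\alpha}z+O(z^2)$ with irrational rotation number) having a common hedgehog $K$. Then $f\circ g = g\circ f$. In particular, if $f$ and $g$ have the same germ of hedgehog, $[\mathcal{K}(f)] = [\mathcal{K}(g)]$ (so that all sufficiently small hedgehogs of one are hedgehogs of the other), then $f$ and $g$ commute.
   Context: A germ $f(z)=e^{2\pi i\alpha}z+O(z^2)$ with $\alpha\in\mathbb{R}\setminus\mathbb{Q}$ is linearizable if there is a holomorphic $h(w)=w+O(w^2)$ with $h^{-1}\circ f\circ h=R_\alpha$, $R_\alpha(w)=e^{2\pi i\alpha}w$; otherwise nonlinearizable. A Siegel compact of $f$ is a full, connected, compact $K\subset\mathbb{C}$ with $0\in K$, $K\ne\{0\}$, such that $f,f^{-1}$ extend univalently to a neighbourhood of $K$ and $f(K)=f^{-1}(K)=K$; a hedgehog is a Siegel compact not contained in the closure of a linearization domain (for nonlinearizable $f$, every Siegel compact is a hedgehog). $\mathcal{K}(f)$ is the family of all Siegel compacta of $f$. For families $\mathcal{K}$ of compacta containing $0$ with members of arbitrarily small diameter, $\mathcal{K}_1\sim\mathcal{K}_2$ if there is $\epsilon>0$ such that every compact of diameter $<\epsilon$ lies in $\mathcal{K}_1$ iff it lies in $\mathcal{K}_2$; the class $[\mathcal{K}(f)]$ is the germ of hedgehog of $f$. *)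

(* Defs.v *)
(* The complex plane is  R[i]^o  for  R : realType,
   i.e. the complex numbers (mathcomp-real-closed) seen as a normed module
   over themselves; so  derivable F z 1  is complex differentiability. *)
From mathcomp Require Import all_boot all_order all_algebra.
From mathcomp Require Import all_classical all_reals all_analysis.
From mathcomp Require Export complex.
Import Order.TTheory GRing.Theory Num.Theory.
Import numFieldNormedType.Exports.
Local Open Scope ring_scope.
Local Open Scope classical_set_scope.

Set Implicit Arguments.
Unset Strict Implicit.
Unset Printing Implicit Defensive.

Notation Cplx R := ((R[i])^o).

Section Defs.
Variable R : realType.
Local Notation C := (Cplx R).

Definition holo_on (U : set C) (F : C -> C) : Prop :=
  open U /\ forall z, U z -> derivable F z 1.

Definition inj_on (U : set C) (F : C -> C) : Prop :=
  forall x y, U x -> U y -> F x = F y -> x = y.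

Definition multiplier (alpha : R) : C :=
  Complex (cos (2 * pi * alpha)) (sin (2 * pi * alpha)).

Definition irrational (alpha : R) : Prop := ~ exists q : rat, alpha = ratr q.

Definition rot_germ (f : C -> C) (alpha : R) : Prop :=
  (exists U : set C, U 0 /\ holo_on U f) /\ f 0 = 0 /\
  f^`() 0 = multiplier alpha.

Definition linearizable (f : C -> C) (alpha : R) : Prop :=
  exists h : C -> C,
    (exists U : set C, U 0 /\ holo_on U h) /\ h 0 = 0 /\ h^`() 0 = 1 /\
    \forall w \near (0 : C), f (h w) = h (multiplier alpha * w).

Definition nonlinearizable_germ (f : C -> C) (alpha : R) : Prop :=
  rot_germ f alpha /\ irrational alpha /\ ~ linearizable f alpha.

(* Siegel compact: full, connected, compact K with 0 in K, K <> {0},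
   such that f and f^{-1} extend univalently to a neighbourhood U of K
   (extensions F, G; G extends the inverse germ: G o f = id near 0), and
   f(K) = f^{-1}(K) = K. *)
Definition siegel_compact (f : C -> C) (K : set C) : Prop :=
  compact K /\ connected K /\ connected (~` K) /\ K 0 /\ K <> [set 0] /\
  exists (U : set C) (F G : C -> C),
    K `<=` U /\ holo_on U F /\ inj_on U F /\ holo_on U G /\ inj_on U G /\
    (\forall z \near (0 : C), F z = f z) /\
    (\forall z \near (0 : C), G (f z) = z) /\
    F @` K = K /\ G @` K = K.

Definition disk (r : R) : set C := [set w : C | `|w| < r%:C%C].

Definition lin_domain (f : C -> C) (alpha : R) (D : set C) : Prop :=
  exists r : R, 0 < r /\
  exists h F : C -> C,
    holo_on (disk r) h /\ inj_on (disk r) h /\ h 0 = 0 /\ h^`() 0 = 1 /\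
    D = h @` disk r /\ holo_on D F /\
    (\forall z \near (0 : C), F z = f z) /\
    (forall w, disk r w -> F (h w) = h (multiplier alpha * w)).

Definition hedgehog (f : C -> C) (alpha : R) (K : set C) : Prop :=
  siegel_compact f K /\
  ~ (exists D : set C, lin_domain f alpha D /\ K `<=` closure D).

Definition diam_lt (K : set C) (eps : R) : Prop :=
  forall x y, K x -> K y -> `|x - y| < eps%:C%C.

Definition same_hedgehog_germ (f g : C -> C) : Prop :=
  exists eps : R, 0 < eps /\
  forall K : set C, compact K -> diam_lt K eps ->
    (siegel_compact f K <-> siegel_compact g K).

End Defs.

(* Main.v *)
Require Import Defs.
From mathcomp Require Import all_boot all_order all_algebra.
From mathcomp Require Import all_classical all_reals all_analysis.
From mathcomp Require Import complex.
From mathcomp Require cyclic separable cyclotomic.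
From mathcomp Require Import ring lra.
Import Order.TTheory GRing.Theory Num.Theory.
Import numFieldNormedType.Exports ComplexField.Normc.
Local Open Scope ring_scope.
Local Open Scope classical_set_scope.

Set Implicit Arguments.
Unset Strict Implicit.
Unset Printing Implicit Defensive.

Local Notation Re := complex.Re.
Local Notation Im := complex.Im.

(** Let [K] be invariant under [f] and [g]. Their commutator is tangent to the
    identity; if it is not trivial it has the form [h = z + a z^(m+1) + ...],
    and the conjugates of [h] by the iterates of [f] are approximately
    [z + a v z^(m+1)] with a dense set of unit numbers [v]. Moving points of [K]
    by these near-translations shows that [K] is asymptotically dense at the
    scale [|z|^(m+1)]; transporting a gap of [K] along the attracting petal of
    [h], where relative distances are almost preserved, shows that [K] contains
    the petal. Rotating the petal by [f], [K] is a neighbourhood of [0]. Then the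
    iterates of [f] are uniformly bounded near [0], and a limit of their averages
    linearizes [f].

    When [f] and [g] have the same germ of hedgehog it remains to find
    arbitrarily small Siegel compacta (a theorem of Perez-Marco). Take the
    component of [0] in the set of points whose full orbit stays in a small
    disc; it is full by the maximum principle. If it were [{0}], compactness
    would give two nested neighbourhoods of [0] whose boundaries are crossed by
    long orbits only near their ends. The harmonic measure, seen from [0], of the
    orbits of length [L] that leave early does not depend on [L], by pullback
    under [f]; but it is positive, and it drops by a definite factor when [L]
    grows, because for nonlinearizable [f] some points near [0] leave the disc. *)

(** * The real-valued complex modulus *)

Section Norm.
Variable R : realType.
Implicit Types (x y z w : R[i]).

(** The complex analysis rests on differentiability alone. Goursat's theorem on rectangles yields
    only [nrm (H 0) <= 4 * M], with a factor due to the square; high powers absorb it, so that the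
    maximum principle is reached without an exact mean value formula. Subharmonicity is tested
    pointwise, which makes it stable under maxima and under composition with [f]. The division
    [H z = H 0 + z * Q z], obtained from Poisson sums, replaces power series: orders of vanishing,
    Taylor estimates and local inverses come from it. Harmonic measure is never constructed. Its
    value at [0] is replaced, in the manner of Perron, by bounds on [u 0] over a class of
    competitors. This class has to be stable both under pullback to longer orbits and under
    restriction to shorter ones, although the domain changes with the length; what makes this
    possible is that the boundary of the domain carries only early exits, where nothing is required
    of [u], and late exits, where [u] must tend to zero. The larger neighbourhood of [0] separates
    the two kinds of exits; the much smaller one makes some positive competitor vanish at the late
    ones. *)

Definition nrm (z : R[i]) : R := normc z.

(** The library modulus takes values in [R[i]], whose order is partial; [nrm] is its real-valued
    form, open to real arithmetic. *)
Lemma nrmE z : `|z| = (nrm z)%:C%C. Proof. by []. Qed.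

Lemma nrm_sqrtE z : nrm z = Num.sqrt (Re z ^+ 2 + Im z ^+ 2).
Proof. by case: z. Qed.

Lemma nrm_sqr z : nrm z ^+ 2 = Re z ^+ 2 + Im z ^+ 2.
Proof. by rewrite nrm_sqrtE sqr_sqrtr // addr_ge0 // sqr_ge0. Qed.

Lemma nrm_ge0 z : 0 <= nrm z.
Proof. by rewrite nrm_sqrtE sqrtr_ge0. Qed.

Lemma nrm0 : nrm 0 = 0. Proof. exact: normc0. Qed.

Lemma nrm1 : nrm 1 = 1. Proof. exact: normc1. Qed.

Lemma nrm_eq0 z : (nrm z == 0) = (z == 0).
Proof. by apply/eqP/eqP => [/eq0_normc //|->]; rewrite nrm0. Qed.

Lemma nrm_gt0 z : (0 < nrm z) = (z != 0).
Proof. by rewrite lt_neqAle nrm_ge0 andbT eq_sym nrm_eq0. Qed.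

Lemma nrm_le0 z : (nrm z <= 0) = (z == 0).
Proof. by rewrite -nrm_eq0 eq_le nrm_ge0 andbT. Qed.

Lemma nrmM z w : nrm (z * w) = nrm z * nrm w. Proof. exact: normcM. Qed.

Lemma nrmX z n : nrm (z ^+ n) = nrm z ^+ n.
Proof. by elim: n => [|n IH]; rewrite ?expr0 ?nrm1 // !exprS nrmM IH. Qed.

Lemma nrmV z : nrm z^-1 = (nrm z)^-1. Proof. exact: normcV. Qed.

Lemma nrmf z w : nrm (z / w) = nrm z / nrm w. Proof. by rewrite nrmM nrmV. Qed.

Lemma nrmN z : nrm (- z) = nrm z. Proof. exact: normcN. Qed.

Lemma nrmD z w : nrm (z + w) <= nrm z + nrm w. Proof. exact: le_normcD. Qed.

Lemma nrmB z w : nrm (z - w) <= nrm z + nrm w.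
Proof. by rewrite -(nrmN w) nrmD. Qed.

Lemma nrmC z w : nrm (z - w) = nrm (w - z).
Proof. by rewrite -nrmN opprB. Qed.

Lemma nrm_tri (t z w : R[i]) : nrm (z - w) <= nrm (z - t) + nrm (t - w).
Proof. by rewrite -{1}(subrK t z) -addrA nrmD. Qed.

Lemma nrm_lb z w : nrm z - nrm w <= nrm (z - w).
Proof. by rewrite lerBlDr -{1}(subrK w z) nrmD. Qed.

Lemma nrm_lbD z w : nrm z - nrm w <= nrm (z + w).
Proof. by rewrite -(nrmN w) -{2}(opprK w) nrm_lb. Qed.

Lemma nrm_real (a : R) : nrm a%:C%C = `|a|.
Proof. by rewrite nrm_sqrtE /= expr0n /= addr0 sqrtr_sqr. Qed.

Lemma nrm_nat n : nrm n%:R = n%:R.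
Proof. by rewrite -(rmorph_nat (real_complex R)) nrm_real normr_nat. Qed.

Lemma nrm_sum (I : Type) (r : seq I) (P : pred I) (F : I -> R[i]) :
  nrm (\sum_(i <- r | P i) F i) <= \sum_(i <- r | P i) nrm (F i).
Proof.
elim/big_ind2 : _ => [|x y u v|//]; first by rewrite nrm0.
by move=> h1 h2; apply: (le_trans (nrmD _ _)); exact: lerD.
Qed.

Lemma nrm_i : nrm ('i)%C = 1.
Proof. by rewrite nrm_sqrtE /= expr0n /= add0r expr1n sqrtr1. Qed.

Lemma normRe_le z : `|Re z| <= nrm z.
Proof. by rewrite nrm_sqrtE -sqrtr_sqr ler_wsqrtr // lerDl sqr_ge0. Qed.

Lemma normIm_le z : `|Im z| <= nrm z.
Proof. by rewrite nrm_sqrtE -sqrtr_sqr ler_wsqrtr // lerDr sqr_ge0. Qed.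

Lemma Re_le z : Re z <= nrm z.
Proof. exact: le_trans (ler_norm _) (normRe_le z). Qed.

Lemma Re_ge z : - nrm z <= Re z.
Proof. by have := normRe_le z; rewrite ler_norml => /andP[]. Qed.

Lemma nrm_le_ReIm z : nrm z <= `|Re z| + `|Im z|.
Proof.
rewrite -(@ler_pXn2r _ 2) ?nnegrE ?nrm_ge0 ?addr_ge0 // nrm_sqr sqrrD.
have h : 0 <= `|Re z| * `|Im z| by rewrite mulr_ge0.
rewrite -(real_normK (num_real (Re z))) -(real_normK (num_real (Im z))).
move: h; set u := `|Re z| * _; lra.
Qed.

Lemma ReD z w : Re (z + w) = Re z + Re w. Proof. by case: z; case: w. Qed.
Lemma ImD z w : Im (z + w) = Im z + Im w. Proof. by case: z; case: w. Qed.
Lemma ReN z : Re (- z) = - Re z. Proof. by case: z. Qed.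
Lemma ImN z : Im (- z) = - Im z. Proof. by case: z. Qed.
Lemma ReM z w : Re (z * w) = Re z * Re w - Im z * Im w. Proof. by case: z; case: w. Qed.
Lemma ImM z w : Im (z * w) = Re z * Im w + Im z * Re w. Proof. by case: z; case: w. Qed.
Lemma Re_sum (I : Type) (r : seq I) (P : pred I) (F : I -> R[i]) :
  Re (\sum_(i <- r | P i) F i) = \sum_(i <- r | P i) Re (F i).
Proof. by elim/big_ind2 : _ => [//|x y u v|//]; rewrite ReD => -> ->. Qed.

Lemma complex_eq z w : Re z = Re w -> Im z = Im w -> z = w.
Proof. by case: z w => a b [c d] /= -> ->. Qed.

Lemma ReZ (a : R) z : Re (a%:C%C * z) = a * Re z.
Proof. by rewrite ReM /= mul0r subr0. Qed.

Lemma mulcJ z : z * conjc z = (nrm z ^+ 2)%:C%C.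
Proof. by rewrite nrm_sqr; case: z => a b; apply: complex_eq => /=; ring. Qed.

Lemma nrm_conj z : nrm (conjc z) = nrm z.
Proof. by rewrite !nrm_sqrtE; case: z => a b /=; rewrite sqrrN. Qed.

(** Multiplication by [conjc c] turns a modulus into a real part at the chosen point; moduli of
    holomorphic functions are thereby reduced to real parts. *)
Lemma exists_phase z : exists c : R[i], nrm c = 1 /\ c * (nrm z)%:C%C = z.
Proof.
have [->|z0] := eqVneq z 0; first by exists 1; rewrite nrm1 nrm0 mul1r.
have n0 : nrm z != 0 by rewrite nrm_eq0.
exists (z / (nrm z)%:C%C); rewrite nrmf nrm_real ger0_norm ?nrm_ge0 // divff //.
by rewrite divfK //; apply/eqP => /(congr1 (@Re R)) /= /eqP; rewrite (negbTE n0).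
Qed.

Lemma expr_small (x e : R) : 0 <= x -> x < 1 -> 0 < e ->
  exists n0, forall n, (n0 <= n)%N -> x ^+ n < e.
Proof.
move=> x0 x1 e0; have h1 : `|x| < 1 by rewrite ger0_norm.
have := cvg_expr h1 => /cvgrPdist_lt /(_ e e0)[n0 _ hn]; exists n0 => n /hn /=.
by rewrite sub0r normrN ger0_norm // exprn_ge0.
Qed.

End Norm.
Arguments nrm : simpl never.

(** * Limits along an ultrafilter *)

Section UltraLimit.
Variable R : realType.

(** Along one fixed ultrafilter containing all tails every bounded sequence converges, so limits can
    be taken at all points of the plane simultaneously, without extracting subsequences. *)
Definition ulf : set_system nat :=
  projT1 (cid (ultraFilterLemma (F := \oo%classic) (eventually_filter))).

Lemma ulf_ultra : UltraFilter ulf.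
Proof. by rewrite /ulf; case: cid => G []. Qed.

Lemma ulf_eventually (P : set nat) : (\forall n \near \oo, P n) -> ulf P.
Proof. by rewrite /ulf; case: cid => G [_ /= ]; exact. Qed.

Local Instance ulf_proper : ProperFilter ulf.
Proof. by have [] := ulf_ultra. Qed.

Lemma ulfI (P Q : set nat) : ulf P -> ulf Q -> ulf (P `&` Q).
Proof. exact: filterI. Qed.

Lemma ulfS (P Q : set nat) : (forall n, P n -> Q n) -> ulf P -> ulf Q.
Proof. exact: filterS. Qed.

Lemma ulf_ex (P : set nat) : ulf P -> exists n, P n.
Proof. exact: filter_ex. Qed.

Lemma ulfT (P : set nat) : (forall n, P n) -> ulf P.
Proof. by move=> h; apply: ulf_eventually; apply: nearW. Qed.

Definition ucv (u : nat -> R[i]) (l : R[i]) :=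
  forall e : R, 0 < e -> ulf [set n | nrm (u n - l) < e].

Lemma ucv_real_ex (u : nat -> R) (M : R) : (forall n, `|u n| <= M) ->
  exists l : R, forall e, 0 < e -> ulf [set n | `|u n - l| < e].
Proof.
move=> h.
have := @segment_compact R (- M) M => /(_ (u n @[n --> ulf]) _).
case=> [|l [_ /= hl]].
  by apply: ulfT => n /=; rewrite in_itv /= -ler_norml.
exists l => e e0.
have [//|hn] := in_ultra_setVsetC [set n | `|u n - l| < e] ulf_ultra.
have [||x [/= h1 h2]] := hl [set x | ~ (`|x - l| < e)] (ball l e).
- by apply: ulfS hn => n.
- exact: nbhsx_ballx.
- by exfalso; apply: h1; move: h2; rewrite /ball /= distrC.
Qed.

Lemma ucv_ex (u : nat -> R[i]) (M : R) : (forall n, nrm (u n) <= M) ->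
  exists l, ucv u l.
Proof.
move=> h.
have [a ha] := @ucv_real_ex (fun n => Re (u n)) M (fun n => le_trans (normRe_le _) (h n)).
have [b hb] := @ucv_real_ex (fun n => Im (u n)) M (fun n => le_trans (normIm_le _) (h n)).
exists (Complex a b) => e e0; have e2 : 0 < e / 2 by rewrite divr_gt0.
have := ulfI (ha _ e2) (hb _ e2); apply: ulfS => n [/= h1 h2].
apply: le_lt_trans (nrm_le_ReIm _) _; rewrite !(ReD, ImD, ReN, ImN) /=; lra.
Qed.

Lemma ucv_unique u l l' : ucv u l -> ucv u l' -> l = l'.
Proof.
move=> h h'; apply/eqP; rewrite -subr_eq0 -nrm_le0; apply/ler_addgt0Pl => e e0.
have e2 : 0 < e / 2 by rewrite divr_gt0.
have [n [/= h1 h2]] := ulf_ex (ulfI (h _ e2) (h' _ e2)).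
apply: le_trans (nrm_tri (u n) _ _) _; rewrite (nrmC l); lra.
Qed.

Lemma ucv_cst l : ucv (fun=> l) l.
Proof. by move=> e e0; apply: ulfT => n /=; rewrite subrr nrm0. Qed.

Lemma ucvD u v l m : ucv u l -> ucv v m -> ucv (fun n => u n + v n) (l + m).
Proof.
move=> h h' e e0; have e2 : 0 < e / 2 by rewrite divr_gt0.
have := ulfI (h _ e2) (h' _ e2); apply: ulfS => n [/= h1 h2].
have -> : u n + v n - (l + m) = (u n - l) + (v n - m) by ring.
apply: le_lt_trans (nrmD _ _) _; lra.
Qed.

Lemma ucvZ c u l : ucv u l -> ucv (fun n => c * u n) (c * l).
Proof.
move=> h e e0; have e2 : 0 < e / (nrm c + 1) by rewrite divr_gt0 // ltr_wpDl ?nrm_ge0.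
have := h _ e2; apply: ulfS => n /=.
rewrite -mulrBr nrmM ltr_pdivlMr ?ltr_wpDl ?nrm_ge0 // => h1.
apply: le_lt_trans h1; rewrite mulrC ler_wpM2l ?nrm_ge0 //.
by rewrite lerDl.
Qed.

Lemma ucvN u l : ucv u l -> ucv (fun n => - u n) (- l).
Proof. by move=> h e /h; apply: ulfS => n /=; rewrite -opprD nrmN. Qed.

Lemma ucvB u v l m : ucv u l -> ucv v m -> ucv (fun n => u n - v n) (l - m).
Proof. by move=> h h'; apply: ucvD => //; exact: ucvN. Qed.

Lemma ucv_le u l (M : R) : ucv u l -> ulf [set n | nrm (u n) <= M] -> nrm l <= M.
Proof.
move=> h hM; apply/ler_addgt0Pl => e e0.
have [n [/= h1 h2]] := ulf_ex (ulfI (h _ e0) hM).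
have := nrm_lb l (u n); rewrite nrmC; lra.
Qed.

Lemma ucv_Re_le u l (M : R) : ucv u l -> ulf [set n | Re (u n) <= M] -> Re l <= M.
Proof.
move=> h hM; apply/ler_addgt0Pl => e e0.
have [n [/= h1 h2]] := ulf_ex (ulfI (h _ e0) hM).
have := Re_ge (u n - l); rewrite ReD ReN; lra.
Qed.

Lemma ucv_eventually u l :
  (forall e, 0 < e -> exists n0, forall n, (n0 <= n)%N -> nrm (u n - l) < e) -> ucv u l.
Proof.
move=> h e /h[n0 hn0]; apply: ulf_eventually.
by exists n0 => // n /= /hn0.
Qed.

End UltraLimit.

(** * Complex differentiability by explicit estimates *)

Section Hol.
Variable R : realType.
Implicit Types (F G : R[i] -> R[i]) (z w d : R[i]).

Lemma posC (e : R[i]) : 0 < e -> exists2 e' : R, 0 < e' & e = e'%:C%C.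
Proof.
case: e => a b; rewrite ltcE /= => /andP[/eqP -> a0]; by exists a.
Qed.

Lemma nearC (a : Cplx R) (P : Cplx R -> Prop) :
  (\forall z \near a, P z) <->
  exists2 r : R, 0 < r & forall z, nrm (z - a) < r -> P z.
Proof.
split=> [/nbhs_ballP[e /= /posC[e' e0 ->] h]|[r r0 h]].
  exists e' => // z hz; apply: h; rewrite /ball /= -normrN opprB.
  by rewrite (nrmE (z - a)) ltcR.
apply/nbhs_ballP; exists (r%:C)%C; first by rewrite /= ltcR.
by move=> z; rewrite /ball /= -normrN opprB (nrmE (z - a)) ltcR => /h.
Qed.

Lemma openC (U : set (Cplx R)) :
  open U <-> forall a, U a -> exists2 r : R, 0 < r & forall z, nrm (z - a) < r -> U z.
Proof.
rewrite openE; split=> h a /h; first by rewrite /interior => /nearC.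
by move=> h1; apply/nearC.
Qed.

(** The derivative as a first order estimate that includes [w = 0], so that no quotient has to be
    formed. [cdP] relates it to the library derivative. *)
Definition cd F z d := forall e : R, 0 < e -> exists2 r : R, 0 < r &
  forall w, nrm w < r -> nrm (F (z + w) - F z - d * w) <= e * nrm w.

Definition hol F z := exists d, cd F z d.

Definition cont F z := forall e : R, 0 < e -> exists2 r : R, 0 < r &
  forall w, nrm w < r -> nrm (F (z + w) - F z) < e.

Definition rcont (u : R[i] -> R) z := forall e : R, 0 < e -> exists2 r : R, 0 < r &
  forall w, nrm w < r -> `|u (z + w) - u z| < e.

Lemma min_gt0 (a b : R) : 0 < a -> 0 < b -> 0 < Num.min a b.
Proof. by rewrite lt_min => -> ->. Qed.

Lemma cd_cst c z : cd (fun=> c) z 0.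
Proof. by move=> e e0; exists 1 => // w _; rewrite subrr mul0r subr0 nrm0 mulr_ge0 ?nrm_ge0 ?ltW. Qed.

Lemma cd_id z : cd id z 1.
Proof.
move=> e e0; exists 1 => // w _ /=; have -> : z + w - z - 1 * w = 0 by ring.
rewrite nrm0.
by rewrite mulr_ge0 ?nrm_ge0 // ltW.
Qed.

Lemma cd_lip F z d : cd F z d -> exists2 r : R, 0 < r &
  forall w, nrm w < r -> nrm (F (z + w) - F z) <= (nrm d + 1) * nrm w.
Proof.
move=> /(_ 1 ltr01)[r r0 h]; exists r => // w /h h1.
have -> : F (z + w) - F z = (F (z + w) - F z - d * w) + d * w by ring.
apply: le_trans (nrmD _ _) _; rewrite nrmM; lra.
Qed.

Lemma cd_cont F z d : cd F z d -> cont F z.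
Proof.
move=> /cd_lip[r r0 h] e e0.
have D0 : 0 < nrm d + 1 by rewrite ltr_wpDl ?nrm_ge0.
exists (Num.min r (e / (nrm d + 1))); first by rewrite min_gt0 // divr_gt0.
move=> w; rewrite lt_min => /andP[/h h1]; rewrite ltr_pdivlMr // => h2.
by apply: le_lt_trans h1 _; rewrite mulrC.
Qed.

Lemma hol_cont F z : hol F z -> cont F z.
Proof. by case=> d /cd_cont. Qed.

Lemma cd_local F G z d (r : R) : 0 < r -> (forall w, nrm w < r -> F (z + w) = G (z + w)) ->
  cd F z d -> cd G z d.
Proof.
move=> r0 h hF e /hF[r' r'0 h']; exists (Num.min r r'); first exact: min_gt0.
move=> w; rewrite lt_min => /andP[h1 h2]; rewrite -h // -[in G z](addr0 z) -h ?nrm0 //.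
by rewrite addr0; exact: h'.
Qed.

Lemma hol_local F G z (r : R) : 0 < r -> (forall x, nrm (x - z) < r -> F x = G x) ->
  hol F z -> hol G z.
Proof.
move=> r0 h [d hd]; exists d; apply: cd_local r0 _ hd => w hw.
by apply: h; rewrite addrC addKr.
Qed.

Lemma cd_ext F G z d : F =1 G -> cd F z d -> cd G z d.
Proof. by move=> h; apply: (@cd_local _ _ _ _ 1). Qed.

Lemma cdD F G z d d' : cd F z d -> cd G z d' -> cd (fun x => F x + G x) z (d + d').
Proof.
move=> h h' e e0; have e2 : 0 < e / 2 by rewrite divr_gt0.
have [r r0 h1] := h _ e2; have [r' r'0 h2] := h' _ e2.
exists (Num.min r r'); first exact: min_gt0.
move=> w; rewrite lt_min => /andP[/h1 {}h1 /h2 {}h2].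
have -> : F (z + w) + G (z + w) - (F z + G z) - (d + d') * w =
  (F (z + w) - F z - d * w) + (G (z + w) - G z - d' * w) by ring.
apply: le_trans (nrmD _ _) _; lra.
Qed.

Lemma cdM F G z d d' : cd F z d -> cd G z d' ->
  cd (fun x => F x * G x) z (d * G z + F z * d').
Proof.
move=> h h' e e0.
pose M : R := 1 + nrm (G z) + nrm d + nrm (F z).
have M0 : 0 < M by rewrite /M !ltr_wpDr ?nrm_ge0.
have e3 : 0 < Num.min 1 (e / (3 * M)) by rewrite min_gt0 // divr_gt0 // mulr_gt0.
have [r r0 h1] := h _ e3; have [r' r'0 h2] := h' _ e3.
have [r2 r20 h3] := cd_cont h' e3.
exists (Num.min (Num.min r r') r2); first by rewrite !min_gt0.
move=> w; rewrite !lt_min => /andP[/andP[/h1 {}h1 /h2 {}h2] /h3 {}h3].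
have -> : F (z + w) * G (z + w) - F z * G z - (d * G z + F z * d') * w =
  (F (z + w) - F z - d * w) * (G z + (G (z + w) - G z)) +
  d * w * (G (z + w) - G z) + F z * (G (z + w) - G z - d' * w) by ring.
move: h1 h2 h3 e3; set t := Num.min _ _ => h1 h2 h3 t0.
have t1 : t <= 1 by rewrite /t ge_min lexx.
have tM : t * (3 * M) <= e by rewrite -ler_pdivlMr ?mulr_gt0 // /t ge_min lexx orbT.
have := nrm_ge0 w => w0.
have A : nrm (F (z + w) - F z - d * w) * nrm (G z + (G (z + w) - G z)) <= t * nrm w * M.
  apply: ler_pM; rewrite ?nrm_ge0 //; apply: le_trans (nrmD _ _) _.
  have := nrm_ge0 d; have := nrm_ge0 (F z); rewrite /M; lra.
have B : nrm (d * w) * nrm (G (z + w) - G z) <= M * nrm w * t.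
  apply: ler_pM; rewrite ?nrm_ge0 //; last exact: ltW.
  rewrite nrmM ler_wpM2r //.
  have := nrm_ge0 (G z); have := nrm_ge0 (F z); rewrite /M; lra.
have D : nrm (F z) * nrm (G (z + w) - G z - d' * w) <= M * (t * nrm w).
  apply: ler_pM; rewrite ?nrm_ge0 //.
  have := nrm_ge0 (G z); have := nrm_ge0 d; rewrite /M; lra.
have E : 3 * (t * nrm w * M) <= e * nrm w.
  have -> : 3 * (t * nrm w * M) = t * (3 * M) * nrm w by ring.
  by rewrite ler_wpM2r.
apply: le_trans (nrmD _ _) _; rewrite nrmM.
apply: le_trans (lerD (nrmD _ _) (lexx _)) _; rewrite !nrmM.
rewrite nrmM in B.
have EB : M * nrm w * t = t * nrm w * M by ring.
have ED : M * (t * nrm w) = t * nrm w * M by ring.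
rewrite EB in B; rewrite ED in D; lra.
Qed.

Lemma cd_comp F G z d d' : cd F z d -> cd G (F z) d' -> cd (G \o F) z (d' * d).
Proof.
move=> h h' e e0.
pose M : R := 1 + nrm d + nrm d'.
have M0 : 0 < M by rewrite /M !ltr_wpDr ?nrm_ge0.
have e2 : 0 < e / (2 * M) by rewrite divr_gt0 // mulr_gt0.
have [r r0 h1] := h _ e2; have [r' r'0 h2] := h' _ e2.
have [r2 r20 h3] := cd_lip h.
have [r3 r30 h4] := cd_cont h r'0.
exists (Num.min (Num.min r r2) r3); first by rewrite !min_gt0.
move=> w; rewrite !lt_min => /andP[/andP[/h1 {}h1 /h3 {}h3] /h4 {}h4].
pose k := F (z + w) - F z.
have hk : F z + k = F (z + w) by rewrite /k; ring.
have := h2 k h4; rewrite hk => h5 /=.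
have -> : G (F (z + w)) - G (F z) - d' * d * w =
  (G (F (z + w)) - G (F z) - d' * k) + d' * (F (z + w) - F z - d * w) by rewrite /k; ring.
apply: le_trans (nrmD _ _) _; rewrite nrmM.
have eM : e / (2 * M) * M = e / 2 by field; exact: lt0r_neq0.
have A : nrm (G (F (z + w)) - G (F z) - d' * k) <= e / 2 * nrm w.
  apply: le_trans h5 _; rewrite -eM -(mulrA (e / (2 * M))) ler_wpM2l ?(ltW e2) //.
  apply: le_trans h3 _; rewrite ler_wpM2r ?nrm_ge0 //.
  have := nrm_ge0 d'; rewrite /M; lra.
have B : nrm d' * nrm (F (z + w) - F z - d * w) <= e / 2 * nrm w.
  apply: le_trans (ler_wpM2l (nrm_ge0 _) h1) _.
  rewrite mulrA ler_wpM2r ?nrm_ge0 // -eM [leLHS]mulrC ler_wpM2l ?(ltW e2) //.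
  have := nrm_ge0 d; rewrite /M; lra.
lra.
Qed.

Lemma cd_inv z : z != 0 -> cd (fun x => x^-1) z (- z^-1 ^+ 2).
Proof.
move=> z0 e e0; have n0 : 0 < nrm z by rewrite nrm_gt0.
(* The remainder of [x^-1] is [w^2 / (z^2 (z + w))]. The first bound gives
   [nrm (z + w) >= nrm z / 2], the second then makes the remainder at most [e * nrm w]. *)
exists (Num.min (nrm z / 2) (e * nrm z ^+ 3 / 2)).
  by rewrite min_gt0 ?divr_gt0 ?mulr_gt0 ?exprn_gt0.
move=> w; rewrite lt_min => /andP[w1 w2].
have zw : nrm z / 2 <= nrm (z + w) by have := nrm_lbD z w; lra.
have zw0 : z + w != 0 by rewrite -nrm_gt0; lra.
have -> : (z + w)^-1 - z^-1 - - z^-1 ^+ 2 * w = w ^+ 2 / (z ^+ 2 * (z + w)).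
  by field; rewrite z0 zw0.
rewrite nrmf nrmX nrmM nrmX ler_pdivrMr; last first.
  by rewrite mulr_gt0 ?exprn_gt0 ?nrm_gt0.
rewrite expr2.
have -> : e * nrm w * (nrm z ^+ 2 * nrm (z + w)) = e * nrm z ^+ 2 * nrm (z + w) * nrm w by ring.
rewrite ler_wpM2r ?nrm_ge0 //.
have : e * nrm z ^+ 2 * (nrm z / 2) <= e * nrm z ^+ 2 * nrm (z + w).
  by rewrite ler_wpM2l // mulr_ge0 ?exprn_ge0 ?nrm_ge0 // ltW.
have -> : e * nrm z ^+ 2 * (nrm z / 2) = e * nrm z ^+ 3 / 2 by field.
lra.
Qed.

Lemma hol_cst c z : hol (fun=> c) z. Proof. by exists 0; exact: cd_cst. Qed.
Lemma hol_id z : hol id z. Proof. by exists 1; exact: cd_id. Qed.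
Lemma holD F G z : hol F z -> hol G z -> hol (fun x => F x + G x) z.
Proof. by move=> [d h] [d' h']; exists (d + d'); exact: cdD. Qed.
Lemma holM F G z : hol F z -> hol G z -> hol (fun x => F x * G x) z.
Proof. by move=> [d h] [d' h']; exists (d * G z + F z * d'); exact: cdM. Qed.
Lemma hol_comp F G z : hol F z -> hol G (F z) -> hol (G \o F) z.
Proof. by move=> [d h] [d' h']; exists (d' * d); exact: cd_comp. Qed.
Lemma holZ c F z : hol F z -> hol (fun x => c * F x) z.
Proof. by apply: holM; exact: hol_cst. Qed.
Lemma holN F z : hol F z -> hol (fun x => - F x) z.
Proof.
by move=> /(@holZ (-1))[d h]; exists d; apply: cd_ext h => x; rewrite mulN1r.
Qed.
Lemma holB F G z : hol F z -> hol G z -> hol (fun x => F x - G x) z.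
Proof. by move=> h h'; apply: holD => //; exact: holN. Qed.
Lemma holV F z : hol F z -> F z != 0 -> hol (fun x => (F x)^-1) z.
Proof.
move=> h h0; apply: (@hol_comp F (fun x => x^-1)) => //.
by exists (- (F z)^-1 ^+ 2); exact: cd_inv.
Qed.
Lemma holX F z n : hol F z -> hol (fun x => F x ^+ n) z.
Proof.
move=> h; elim: n => [|n [d IH]]; first by exists 0; apply: cd_ext (cd_cst 1 z).
have [d' h'] := holM h (ex_intro _ d IH).
by exists d'; apply: cd_ext h' => x; rewrite exprS.
Qed.
Lemma hol_sum (I : Type) (r : seq I) (F : I -> R[i] -> R[i]) z :
  (forall i, hol (F i) z) -> hol (fun x => \sum_(i <- r) F i x) z.
Proof.
move=> h; elim: r => [|i r [d IH]].
  by exists 0; apply: cd_ext (cd_cst 0 z) => x; rewrite big_nil.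
have [d' h'] := holD (h i) (ex_intro _ d IH).
by exists d'; apply: cd_ext h' => x; rewrite big_cons.
Qed.
Lemma cd_unique F z d d' : cd F z d -> cd F z d' -> d = d'.
Proof.
move=> h h'; apply/eqP; rewrite -subr_eq0 -nrm_le0; apply/ler_addgt0Pl => e e0.
have e2 : 0 < e / 2 by rewrite divr_gt0.
have [r r0 h1] := h _ e2; have [r' r'0 h2] := h' _ e2.
pose t := Num.min r r' / 2.
have t0 : 0 < t by rewrite divr_gt0 ?min_gt0.
have tn : nrm (t%:C)%C = t by rewrite nrm_real gtr0_norm.
have tr : t < r /\ t < r'.
  by split; rewrite /t; [have : Num.min r r' <= r by rewrite ge_min lexx|have : Num.min r r' <= r' by rewrite ge_min lexx orbT]; lra.
have := h1 (t%:C)%C; have := h2 (t%:C)%C; rewrite tn => /(_ tr.2) h3 /(_ tr.1) h4.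
rewrite -(ler_pM2r t0) -{1}tn -nrmM.
have -> : (d - d') * t%:C%C = (F (z + t%:C%C) - F z - d' * t%:C%C) - (F (z + t%:C%C) - F z - d * t%:C%C) by ring.
apply: le_trans (nrmB _ _) _; lra.
Qed.

Lemma cdP F z d : cd F z d <-> (derivable (F : Cplx R -> Cplx R) z 1 /\ (F : Cplx R -> Cplx R)^`() z = d).
Proof.
have key : cd F z d <-> (fun h : Cplx R => h^-1 *: ((((F : Cplx R -> Cplx R) \o shift z) (h *: (1 : Cplx R)) - F z) : Cplx R)) @ (0 : Cplx R)^' --> (d : Cplx R).
  split=> [hd|hl].
    apply/cvgrPdist_le => e /posC[e' e0 ->].
    have [r r0 h] := hd _ e0.
    rewrite near_withinE; apply/nearC; exists r => // w; rewrite subr0 => wr w0.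
    have n0 : 0 < nrm w by rewrite nrm_gt0.
    rewrite nrmE lecR nrmC /= /shift /= -(ler_pM2r n0) -nrmM.
    rewrite -[_ *: 1]/(w * 1) mulr1 -[_ *: _]/(w^-1 * _) (addrC w) mulrBl mulrAC mulVf // mul1r.
    exact: h.
  move=> e e0.
  have /cvgrPdist_le := hl => /(_ (e%:C)%C); rewrite ltcR => /(_ e0).
  rewrite near_withinE => /nearC[r r0 h]; exists r => // w wr.
  have [->|w0] := eqVneq w 0; first by rewrite addr0 subrr mulr0 subrr nrm0 mulr0.
  have n0 : 0 < nrm w by rewrite nrm_gt0.
  have := h w; rewrite subr0 => /(_ wr w0).
  rewrite nrmE lecR nrmC /= /shift /= -(ler_pM2r n0) -nrmM.
  by rewrite -[_ *: 1]/(w * 1) mulr1 -[_ *: _]/(w^-1 * _) (addrC w) mulrBl mulrAC mulVf // mul1r.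
rewrite key derive1E; split=> [h|[h <-]].
  by split; [apply/cvg_ex; exists d|apply: cvg_lim h].
exact: h.
Qed.

Lemma holP F z : hol F z <-> derivable (F : Cplx R -> Cplx R) z 1.
Proof.
split=> [[d /cdP[]//]|h]; exists ((F : Cplx R -> Cplx R)^`() z).
by apply/cdP.
Qed.

End Hol.

(** * Integrals of continuous real functions on a segment *)

Section RealIntegral.
Variable R : realType.
Implicit Types (f g : R -> R) (a b c M : R).

Definition rint f a b : R := \int[lebesgue_measure]_(t in `[a, b]) f t.

Definition con f a b := forall t : R, a <= t <= b -> {for t, continuous f}.

Lemma con_within f a b : con f a b -> {within `[a, b], continuous f}.
Proof. by move=> h; apply: continuous_in_subspaceT => t; rewrite inE /= in_itv /=; exact: h. Qed.

Lemma con_integrable f a b : con f a b ->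
  lebesgue_measure.-integrable `[a, b] (EFin \o f).
Proof.
move=> /con_within h; apply: continuous_compact_integrable => //.
exact: segment_compact.
Qed.

Lemma rintD f g a b : con f a b -> con g a b ->
  rint (fun t => f t + g t) a b = rint f a b + rint g a b.
Proof.
by move=> hf hg; rewrite /rint RintegralD //; exact: con_integrable.
Qed.

Lemma rintZ k f a b : con f a b -> rint (fun t => k * f t) a b = k * rint f a b.
Proof. by move=> hf; rewrite /rint RintegralZl //; exact: con_integrable. Qed.

Lemma rint_cst k a b : a <= b -> rint (fun=> k) a b = k * (b - a).
Proof.
move=> ab; rewrite /rint Rintegral_cst //= lebesgue_measure_itv /= lte_fin.
case: ltP => [//|ba]; have -> : b = a by apply/eqP; rewrite eq_le ab ba.
by rewrite subrr.
Qed.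

Lemma rint_le f M a b : a <= b -> con f a b ->
  (forall t, a <= t <= b -> `|f t| <= M) -> `|rint f a b| <= M * (b - a).
Proof.
move=> ab hf hM; rewrite -rint_cst //.
apply: le_trans (le_normr_Rintegral _ _) _ => //; first exact: con_integrable.
apply: le_Rintegral => //.
- by apply: integrable_norm; exact: con_integrable.
- by apply: con_integrable => t _; exact: cvg_cst.
Qed.

Lemma rint_ge f M a b : a <= b -> con f a b ->
  (forall t, a <= t <= b -> M <= f t) -> M * (b - a) <= rint f a b.
Proof.
move=> ab hf hM; rewrite -rint_cst //.
apply: le_Rintegral => //.
- by apply: con_integrable => t _; exact: cvg_cst.
- exact: con_integrable.
Qed.

Lemma rint_cat f a b c : a <= b -> b <= c -> con f a c ->
  rint f a c = rint f a b + rint f b c.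
Proof.
move=> ab bc hf.
have hi := con_integrable hf.
have := @Rintegral_itvB R f (BLeft a) (BRight c) b hi.
rewrite !bnd_simp => /(_ ab bc).
rewrite (@Rintegral_itv_obnd_cbnd R b (BRight c)); last first.
  apply: (integrableS _ _ _ hi) => // x /=.
  by rewrite !in_itv /= => /andP[/ltW/(le_trans ab) -> ->].
by rewrite /rint => <-; rewrite addrC subrK.
Qed.

Lemma eq_rint f g a b : (forall t, a <= t <= b -> f t = g t) -> rint f a b = rint g a b.
Proof. by move=> h; apply: eq_Rintegral => t; rewrite inE /= in_itv /=; exact: h. Qed.
End RealIntegral.

(** * Componentwise complex integrals *)

Section ComplexIntegral.
Variable R : realType.
Implicit Types (f g : R -> R[i]) (a b c M : R).

Definition cint f a b : R[i] :=
  Complex (rint (fun t => Re (f t)) a b) (rint (fun t => Im (f t)) a b).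

Definition ccon f a b := forall t : R, a <= t <= b ->
  forall e : R, 0 < e -> exists2 r : R, 0 < r &
    forall s, `|s - t| < r -> nrm (f s - f t) < e.

Lemma ccon_Re f a b : ccon f a b -> con (fun t => Re (f t)) a b.
Proof.
move=> h t /h ht; apply/cvgrPdist_lt => e /ht[r r0 hr].
apply/nbhs_ballP; exists r => // s; rewrite /ball /= distrC => /hr.
by apply: le_lt_trans; rewrite distrC -ReN -ReD normRe_le.
Qed.

Lemma ccon_Im f a b : ccon f a b -> con (fun t => Im (f t)) a b.
Proof.
move=> h t /h ht; apply/cvgrPdist_lt => e /ht[r r0 hr].
apply/nbhs_ballP; exists r => // s; rewrite /ball /= distrC => /hr.
by apply: le_lt_trans; rewrite distrC -ImN -ImD normIm_le.
Qed.

Lemma cconD f g a b : ccon f a b -> ccon g a b -> ccon (fun t => f t + g t) a b.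
Proof.
move=> hf hg t ht e e0; have e2 : 0 < e / 2 by rewrite divr_gt0.
have [r r0 h] := hf _ ht _ e2; have [r' r'0 h'] := hg _ ht _ e2.
exists (Num.min r r'); first exact: min_gt0.
move=> s; rewrite lt_min => /andP[/h h1 /h' h2].
have -> : f s + g s - (f t + g t) = (f s - f t) + (g s - g t) by ring.
apply: le_lt_trans (nrmD _ _) _; lra.
Qed.

Lemma cconZ k f a b : ccon f a b -> ccon (fun t => k * f t) a b.
Proof.
move=> hf t ht e e0.
have k0 : 0 < nrm k + 1 by rewrite ltr_wpDl ?nrm_ge0.
have [r r0 h] := hf _ ht _ (divr_gt0 e0 k0).
exists r => // s /h; rewrite -mulrBr nrmM ltr_pdivlMr // => h1.
apply: le_lt_trans h1; rewrite mulrC ler_wpM2l ?nrm_ge0 //; lra.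
Qed.

Lemma cconB f g a b : ccon f a b -> ccon g a b -> ccon (fun t => f t - g t) a b.
Proof.
move=> hf hg t ht e e0.
have [r r0 h] := cconD hf (cconZ (-1) hg) ht e0.
by exists r => // s /h; rewrite !mulN1r.
Qed.

Lemma cintD f g a b : ccon f a b -> ccon g a b ->
  cint (fun t => f t + g t) a b = cint f a b + cint g a b.
Proof.
move=> hf hg; apply: complex_eq; rewrite ?(ReD, ImD) /=.
- by rewrite -rintD; [apply: eq_rint => t _; rewrite ReD|exact: ccon_Re|exact: ccon_Re].
- by rewrite -rintD; [apply: eq_rint => t _; rewrite ImD|exact: ccon_Im|exact: ccon_Im].
Qed.

Lemma eq_cint f g a b : (forall t, a <= t <= b -> f t = g t) -> cint f a b = cint g a b.
Proof.
move=> h; apply: complex_eq => /=; apply: eq_rint => t ht; by rewrite h.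
Qed.

Lemma cintZ k f a b : ccon f a b -> cint (fun t => k * f t) a b = k * cint f a b.
Proof.
move=> hf; have hR := ccon_Re hf; have hI := ccon_Im hf.
have conZ (x : R) (u : R -> R) : con u a b -> con (fun t => x * u t) a b.
  by move=> hu t ht; apply: cvgZl_tmp; exact: hu.
apply: complex_eq; rewrite ?(ReM, ImM) /= -?mulNr -!rintZ // -rintD //; try exact: conZ.
- by apply: eq_rint => t _; rewrite ReM mulNr.
- by apply: eq_rint => t _; rewrite ImM.
Qed.

Lemma cintB f g a b : ccon f a b -> ccon g a b ->
  cint (fun t => f t - g t) a b = cint f a b - cint g a b.
Proof.
move=> hf hg; rewrite -mulN1r -cintZ // -cintD //; last exact: cconZ.
by apply: eq_cint => t _; rewrite mulN1r.
Qed.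

Lemma cint_cst k a b : a <= b -> cint (fun=> k) a b = k * (b - a)%:C%C.
Proof.
by move=> ab; apply: complex_eq; rewrite ?(ReM, ImM) /= rint_cst // mulr0 ?subr0 ?add0r.
Qed.

(** The factor [2] comes from estimating the two components separately. Such constants are harmless,
    since the maximum principle will use high powers. *)
Lemma cint_le f M a b : a <= b -> ccon f a b ->
  (forall t, a <= t <= b -> nrm (f t) <= M) -> nrm (cint f a b) <= 2 * (M * (b - a)).
Proof.
move=> ab hf hM; apply: le_trans (nrm_le_ReIm _) _ => /=.
have h1 : `|rint (fun t => Re (f t)) a b| <= M * (b - a).
  by apply: rint_le => //; [exact: ccon_Re|move=> t /hM; apply: le_trans; exact: normRe_le].
have h2 : `|rint (fun t => Im (f t)) a b| <= M * (b - a).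
  by apply: rint_le => //; [exact: ccon_Im|move=> t /hM; apply: le_trans; exact: normIm_le].
lra.
Qed.

Lemma cint_cat f a b c : a <= b -> b <= c -> ccon f a c ->
  cint f a c = cint f a b + cint f b c.
Proof.
by move=> ab bc h; apply: complex_eq; rewrite ?(ReD, ImD) /=; apply: rint_cat => //;
  [exact: ccon_Re|exact: ccon_Im].
Qed.

End ComplexIntegral.

(** * Goursat's theorem for rectangles *)

Section Goursat.
Variable R : realType.
Implicit Types (G : R[i] -> R[i]) (x y : R).

(* The contour integral of [G] along the counterclockwise boundary of
   [[x0, x1] x [y0, y1]], opposite sides being grouped in one integrand. *)
Definition rect_int G x0 x1 y0 y1 : R[i] :=
  cint (fun x => G (Complex x y0) - G (Complex x y1)) x0 x1 +
  ('i)%C * cint (fun y => G (Complex x1 y) - G (Complex x0 y)) y0 y1.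

Definition contR G x0 x1 y0 y1 :=
  forall x y, x0 <= x <= x1 -> y0 <= y <= y1 -> cont G (Complex x y).

Lemma cont_ccon_h G x0 x1 y : (forall x, x0 <= x <= x1 -> cont G (Complex x y)) ->
  ccon (fun x => G (Complex x y)) x0 x1.
Proof.
move=> h x hx e e0; have [r r0 hr] := h _ hx _ e0.
exists r => // s hs; have := hr (Complex (s - x) 0).
have -> : Complex x y + Complex (s - x) 0 = Complex s y.
  by apply: complex_eq => /=; ring.
by apply; rewrite (_ : Complex _ _ = (s - x)%:C%C) // nrm_real.
Qed.

Lemma cont_ccon_v G y0 y1 x : (forall y, y0 <= y <= y1 -> cont G (Complex x y)) ->
  ccon (fun y => G (Complex x y)) y0 y1.
Proof.
move=> h y hy e e0; have [r r0 hr] := h _ hy _ e0.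
exists r => // s hs; have := hr (Complex 0 (s - y)).
have -> : Complex x y + Complex 0 (s - y) = Complex x s.
  by apply: complex_eq => /=; ring.
apply; rewrite (_ : Complex _ _ = ('i)%C * (s - y)%:C%C) ?nrmM ?nrm_i ?mul1r ?nrm_real //.
by apply: complex_eq => /=; ring.
Qed.

Lemma contR_h G x0 x1 y0 y1 y : contR G x0 x1 y0 y1 -> y0 <= y <= y1 ->
  ccon (fun x => G (Complex x y)) x0 x1.
Proof. by move=> h hy; apply: cont_ccon_h => x hx; exact: h. Qed.

Lemma contR_v G x0 x1 y0 y1 x : contR G x0 x1 y0 y1 -> x0 <= x <= x1 ->
  ccon (fun y => G (Complex x y)) y0 y1.
Proof. by move=> h hx; apply: cont_ccon_v => y hy; exact: h. Qed.

Definition bdry x0 x1 y0 y1 x y := [&& x0 <= x <= x1, y0 <= y <= y1 &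
  (x == x0) || (x == x1) || (y == y0) || (y == y1)].

(** Continuity on the boundary only, for integrands such as [z^-1] that are singular inside the
    rectangle. *)
Definition contB G x0 x1 y0 y1 :=
  forall x y, bdry x0 x1 y0 y1 x y -> cont G (Complex x y).

Lemma contR_B G x0 x1 y0 y1 : contR G x0 x1 y0 y1 -> contB G x0 x1 y0 y1.
Proof. by move=> h x y /and3P[hx hy _]; exact: h. Qed.

Lemma contB_h G x0 x1 y0 y1 y : contB G x0 x1 y0 y1 -> y0 <= y1 -> (y == y0) || (y == y1) ->
  ccon (fun x => G (Complex x y)) x0 x1.
Proof.
move=> h h01 hy; apply: cont_ccon_h => x hx; apply: h; rewrite /bdry hx -orbA hy orbT andbT /=.
by case/orP: hy => /eqP ->; rewrite lexx h01.
Qed.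

Lemma contB_v G x0 x1 y0 y1 x : contB G x0 x1 y0 y1 -> x0 <= x1 -> (x == x0) || (x == x1) ->
  ccon (fun y => G (Complex x y)) y0 y1.
Proof.
move=> h h01 hx; apply: cont_ccon_v => y hy; apply: h; rewrite /bdry hy hx /= andbT.
by case/orP: hx => /eqP ->; rewrite lexx h01.
Qed.

Lemma contR_sub G x0 x1 y0 y1 x0' x1' y0' y1' : contR G x0 x1 y0 y1 ->
  x0 <= x0' -> x1' <= x1 -> y0 <= y0' -> y1' <= y1 -> contR G x0' x1' y0' y1'.
Proof.
move=> h a b c d x y /andP[e f] /andP[g i]; apply: h.
- by rewrite (le_trans a e) (le_trans f b).
- by rewrite (le_trans c g) (le_trans i d).
Qed.

Lemma rect_int_catx G x0 x1 x2 y0 y1 : x0 <= x1 -> x1 <= x2 -> y0 <= y1 ->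
  contR G x0 x2 y0 y1 ->
  rect_int G x0 x2 y0 y1 = rect_int G x0 x1 y0 y1 + rect_int G x1 x2 y0 y1.
Proof.
move=> h01 h12 hy hG; rewrite /rect_int.
have h02 := le_trans h01 h12.
rewrite (@cint_cat R _ x0 x1 x2) //; last first.
  by apply: cconB; apply: contR_h hG _; rewrite lexx ?hy.
set A := cint _ x0 x1; set B := cint _ x1 x2.
have -> : cint (fun y => G (Complex x2 y) - G (Complex x0 y)) y0 y1 =
  cint (fun y => G (Complex x1 y) - G (Complex x0 y)) y0 y1 +
  cint (fun y => G (Complex x2 y) - G (Complex x1 y)) y0 y1.
  rewrite -cintD; try by apply: cconB; apply: contR_v hG _; rewrite ?lexx ?h01 ?h12 ?h02.
  by apply: eq_cint => t _; ring.
ring.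
Qed.

Lemma rect_int_caty G x0 x1 y0 y1 y2 : y0 <= y1 -> y1 <= y2 -> x0 <= x1 ->
  contR G x0 x1 y0 y2 ->
  rect_int G x0 x1 y0 y2 = rect_int G x0 x1 y0 y1 + rect_int G x0 x1 y1 y2.
Proof.
move=> h01 h12 hx hG; rewrite /rect_int.
have h02 := le_trans h01 h12.
rewrite (@cint_cat R _ y0 y1 y2) //; last first.
  by apply: cconB; apply: contR_v hG _; rewrite lexx ?hx.
set A := cint _ y0 y1; set B := cint _ y1 y2.
have -> : cint (fun x => G (Complex x y0) - G (Complex x y2)) x0 x1 =
  cint (fun x => G (Complex x y0) - G (Complex x y1)) x0 x1 +
  cint (fun x => G (Complex x y1) - G (Complex x y2)) x0 x1.
  rewrite -cintD; try by apply: cconB; apply: contR_h hG _; rewrite ?lexx ?h01 ?h12 ?h02.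
  by apply: eq_cint => t _; ring.
ring.
Qed.

Lemma rect_int_le G M x0 x1 y0 y1 : x0 <= x1 -> y0 <= y1 -> contB G x0 x1 y0 y1 ->
  (forall x y, bdry x0 x1 y0 y1 x y -> nrm (G (Complex x y)) <= M) ->
  nrm (rect_int G x0 x1 y0 y1) <= 4 * M * ((x1 - x0) + (y1 - y0)).
Proof.
move=> hx hy hG hM; apply: le_trans (nrmD _ _) _; rewrite nrmM nrm_i mul1r.
have h1 : nrm (cint (fun x => G (Complex x y0) - G (Complex x y1)) x0 x1) <= 2 * (2 * M * (x1 - x0)).
  apply: cint_le => //; first by apply: cconB; apply: contB_h hG _ _; rewrite ?eqxx ?orbT.
  move=> t ht; apply: le_trans (nrmB _ _) _.
  have := hM t y0; have := hM t y1; rewrite /bdry ?eqxx ?orbT ht hy !lexx => /(_ isT) a /(_ isT) b.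
  lra.
have h2 : nrm (cint (fun y => G (Complex x1 y) - G (Complex x0 y)) y0 y1) <= 2 * (2 * M * (y1 - y0)).
  apply: cint_le => //; first by apply: cconB; apply: contB_v hG _ _; rewrite ?eqxx ?orbT.
  move=> t ht; apply: le_trans (nrmB _ _) _.
  have := hM x0 t; have := hM x1 t; rewrite /bdry ?eqxx ?orbT ht hx !lexx => /(_ isT) a /(_ isT) b.
  lra.
lra.
Qed.

Lemma rect_int_ext G H x0 x1 y0 y1 : x0 <= x1 -> y0 <= y1 ->
  (forall x y, bdry x0 x1 y0 y1 x y -> G (Complex x y) = H (Complex x y)) ->
  rect_int G x0 x1 y0 y1 = rect_int H x0 x1 y0 y1.
Proof.
move=> hx hy h; rewrite /rect_int; congr (_ + _ * _); apply: eq_cint => t ht.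
- by rewrite !h // /bdry ?eqxx ?orbT ht hy !lexx.
- by rewrite !h // /bdry ?eqxx ?orbT ht hx !lexx.
Qed.

Lemma rect_intB G H x0 x1 y0 y1 : x0 <= x1 -> y0 <= y1 ->
  contB G x0 x1 y0 y1 -> contB H x0 x1 y0 y1 ->
  rect_int (fun z => G z - H z) x0 x1 y0 y1 = rect_int G x0 x1 y0 y1 - rect_int H x0 x1 y0 y1.
Proof.
move=> hx hy hG hH; rewrite /rect_int.
have E1 : cint (fun x => (G (Complex x y0) - H (Complex x y0)) - (G (Complex x y1) - H (Complex x y1))) x0 x1 =
 cint (fun x => G (Complex x y0) - G (Complex x y1)) x0 x1 - cint (fun x => H (Complex x y0) - H (Complex x y1)) x0 x1.
  rewrite -cintB; last 2 first.
  - by apply: cconB; apply: contB_h hG _ _; rewrite ?eqxx ?orbT.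
  - by apply: cconB; apply: contB_h hH _ _; rewrite ?eqxx ?orbT.
  by apply: eq_cint => t _; ring.
have E2 : cint (fun y => (G (Complex x1 y) - H (Complex x1 y)) - (G (Complex x0 y) - H (Complex x0 y))) y0 y1 =
 cint (fun y => G (Complex x1 y) - G (Complex x0 y)) y0 y1 - cint (fun y => H (Complex x1 y) - H (Complex x0 y)) y0 y1.
  rewrite -cintB; last 2 first.
  - by apply: cconB; apply: contB_v hG _ _; rewrite ?eqxx ?orbT.
  - by apply: cconB; apply: contB_v hH _ _; rewrite ?eqxx ?orbT.
  by apply: eq_cint => t _; ring.
by rewrite E1 E2; ring.
Qed.

Lemma rect_intZ k G x0 x1 y0 y1 : x0 <= x1 -> y0 <= y1 -> contB G x0 x1 y0 y1 ->
  rect_int (fun z => k * G z) x0 x1 y0 y1 = k * rect_int G x0 x1 y0 y1.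
Proof.
move=> hx hy hG.
have hA : ccon (fun x => G (Complex x y0) - G (Complex x y1)) x0 x1.
  by apply: cconB; apply: contB_h hG _ _; rewrite ?eqxx ?orbT.
have hB : ccon (fun y => G (Complex x1 y) - G (Complex x0 y)) y0 y1.
  by apply: cconB; apply: contB_v hG _ _; rewrite ?eqxx ?orbT.
rewrite /rect_int mulrDr mulrCA -(cintZ _ hA) -(cintZ _ hB).
by congr (_ + _ * _); apply: eq_cint => t _; rewrite mulrBr.
Qed.

Lemma rect_int_affine a d x0 x1 y0 y1 : x0 <= x1 -> y0 <= y1 ->
  rect_int (fun z => a + d * z) x0 x1 y0 y1 = 0.
Proof.
move=> hx hy; rewrite /rect_int.
rewrite (@eq_cint R _ (fun=> - d * ('i)%C * (y1 - y0)%:C%C) x0 x1); last first.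
  by move=> t _; case: d => p q; case: a => u v; apply: complex_eq; rewrite /= ; ring.
rewrite cint_cst // (@eq_cint R _ (fun=> d * (x1 - x0)%:C%C)); last first.
  by move=> t _; case: d => p q; case: a => u v; apply: complex_eq; rewrite /= ; ring.
rewrite cint_cst //; ring.
Qed.

Lemma hol_contR G x0 x1 y0 y1 :
  (forall x y, x0 <= x <= x1 -> y0 <= y <= y1 -> hol G (Complex x y)) -> contR G x0 x1 y0 y1.
Proof. by move=> h x y hx hy; apply: hol_cont; exact: h. Qed.

Lemma affine_contR a d x0 x1 y0 y1 : contR (fun z => a + d * z) x0 x1 y0 y1.
Proof.
by apply: hol_contR => x y _ _; apply: holD; [exact: hol_cst|apply: holZ; exact: hol_id].
Qed.

(** The integral is the sum of those over the four quarters, and four moduli below [c] cannot add up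
    to [4 * c]. *)
Lemma rect_int_quarter G x y (a b c : R) : 0 <= a -> 0 <= b ->
  contR G x (x + 2 * a) y (y + 2 * b) ->
  4 * c <= nrm (rect_int G x (x + 2 * a) y (y + 2 * b)) ->
  exists x' y', [/\ (x <= x') && (x' + a <= x + 2 * a), (y <= y') && (y' + b <= y + 2 * b) &
    c <= nrm (rect_int G x' (x' + a) y' (y' + b))].
Proof.
move=> a0 b0 hG hc; apply: contrapT => hN.
have aux x' y' : (x' == x) || (x' == x + a) -> (y' == y) || (y' == y + b) ->
    nrm (rect_int G x' (x' + a) y' (y' + b)) < c.
  move=> hx hy; rewrite ltNge; apply/negP => h; apply: hN; exists x', y'; split => //.
  - by case/orP: hx => /eqP ->; lra.
  - by case/orP: hy => /eqP ->; lra.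
have := aux x y; have := aux (x + a) y; have := aux x (y + b); have := aux (x + a) (y + b).
rewrite !eqxx !orbT !orTb => /(_ isT isT) h1 /(_ isT isT) h2 /(_ isT isT) h3 /(_ isT isT) h4.
have E : rect_int G x (x + 2 * a) y (y + 2 * b) =
  (rect_int G x (x + a) y (y + b) + rect_int G x (x + a) (y + b) (y + b + b)) +
  (rect_int G (x + a) (x + a + a) y (y + b) + rect_int G (x + a) (x + a + a) (y + b) (y + b + b)).
  have ex : x + a + a = x + 2 * a by ring.
  have ey : y + b + b = y + 2 * b by ring.
  have [i1 i2 i3 i4] : [/\ x <= x + a, x + a <= x + 2 * a, y <= y + b & y + b <= y + 2 * b].
    by rewrite !lerD2l !lerDl !mulr_natl !mulr2n !lerDl; split.
  have i5 := le_trans i3 i4; rewrite ex ey (rect_int_catx i1 i2 i5 hG).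
  by rewrite (rect_int_caty i3 i4 i1) ?(rect_int_caty i3 i4 i2) //;
    apply: contR_sub hG _ _ _ _.
move: hc; rewrite E leNgt => /negP; apply.
apply: le_lt_trans (nrmD _ _) _; apply: le_lt_trans (lerD (nrmD _ _) (nrmD _ _)) _.
by clear -h1 h2 h3 h4; lra.
Qed.

(** Bisection: bad rectangles nest down to a point [(X, Y)]. There the affine part of [G] integrates
    to zero, and the rest is at most [e] times the distance to that point, integrated over a
    perimeter. Both lengths are of order [2^-n], against a lower bound of order [4^-n]. *)
Theorem goursat G x0 x1 y0 y1 : x0 <= x1 -> y0 <= y1 ->
  (forall x y, x0 <= x <= x1 -> y0 <= y <= y1 -> hol G (Complex x y)) ->
  rect_int G x0 x1 y0 y1 = 0.
Proof.
move=> hx hy hG; have hC := hol_contR hG.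
apply/eqP; rewrite -nrm_le0 leNgt; apply/negP => c0.
set c := nrm _ in c0.
pose a n : R := (x1 - x0) * 2^-1 ^+ n; pose b n : R := (y1 - y0) * 2^-1 ^+ n.
have a0 n : 0 <= a n by rewrite mulr_ge0 ?exprn_ge0 ?subr_ge0.
have b0 n : 0 <= b n by rewrite mulr_ge0 ?exprn_ge0 ?subr_ge0.
have aS n : a n = 2 * a n.+1 by rewrite /a exprS; field.
have bS n : b n = 2 * b n.+1 by rewrite /b exprS; field.
pose Bad n (p : R * R) := [/\ x0 <= p.1, p.1 + a n <= x1, y0 <= p.2, p.2 + b n <= y1 &
   c * 4^-1 ^+ n <= nrm (rect_int G p.1 (p.1 + a n) p.2 (p.2 + b n))].
pose Nest n (p q : R * R) := [/\ p.1 <= q.1, q.1 + a n.+1 <= p.1 + a n,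
  p.2 <= q.2 & q.2 + b n.+1 <= p.2 + b n].
(* The implication makes the step total, as [choice] requires; a pair that is not [Bad] stays in
   place. *)
have step (s : nat * (R * R)) : exists q, Bad s.1 s.2 -> Bad s.1.+1 q /\ Nest s.1 s.2 q.
  case: s => n [x y] /=.
  have [[/= h1 h2 h3 h4 h5]|nB] := pselect (Bad n (x, y)); last by exists (x, y).
  have [||||x' [y' [/andP[g1 g2] /andP[g3 g4] g5]]] :=
    @rect_int_quarter G x y (a n.+1) (b n.+1) (c * 4^-1 ^+ n.+1).
  - exact: a0.
  - exact: b0.
  - by rewrite -aS -bS; apply: contR_sub hC _ _ _ _.
  - rewrite -aS -bS; apply: le_trans h5; rewrite exprS; lra.
  exists (x', y') => _; rewrite /Bad /Nest /= aS bS in h2 h4 *; split; split => //; lra.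
have {step}[st hst] := choice step.
pose p := fix p n : R * R := if n is m.+1 then st (m, p m) else (x0, y0).
have pBad n : Bad n (p n).
  elim: n => [|n IH]; last by have [] := hst (n, p n) IH.
  by rewrite /Bad /= /a /b !expr0 !mulr1 !subrKC !lexx; split.
have pNest n : Nest n (p n) (p n.+1) by have [] := hst (n, p n) (pBad n).
have mono (n k : nat) : [/\ (p n).1 <= (p (n + k)%N).1, (p (n + k)%N).1 + a (n + k)%N <= (p n).1 + a n,
    (p n).2 <= (p (n + k)%N).2 & (p (n + k)%N).2 + b (n + k)%N <= (p n).2 + b n].
  elim: k => [|k [i1 i2 i3 i4]]; first by rewrite addn0 !lexx.
  rewrite addnS; have [j1 j2 j3 j4] := pNest (n + k)%N; split; lra.
have mono2 n k : [/\ (p k).1 <= (p n).1 + a n & (p k).2 <= (p n).2 + b n].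
  case: (leqP n k) => [/subnKC <-|/ltnW /subnKC E].
    by have [_ i2 _ i4] := mono n (k - n)%N; have := a0 (n + (k - n))%N; have := b0 (n + (k - n))%N; split; lra.
  have [i1 i2 i3 i4] := mono k (n - k)%N; rewrite E in i1 i2 i3 i4.
  by have := a0 n; have := b0 n; split; lra.
pose X := sup (range (fun n => (p n).1)); pose Y := sup (range (fun n => (p n).2)).
have hX n : (p n).1 <= X <= (p n).1 + a n.
  apply/andP; split.
    by apply: ub_le_sup; [exists ((p 0%N).1 + a 0%N) => _ [k _ <-]; have [] := mono2 0%N k|exists n].
  by apply: ge_sup; [exists (p 0%N).1, 0%N|move=> _ [k _ <-]; have [] := mono2 n k].
have hY n : (p n).2 <= Y <= (p n).2 + b n.
  apply/andP; split.
    by apply: ub_le_sup; [exists ((p 0%N).2 + b 0%N) => _ [k _ <-]; have [] := mono2 0%N k|exists n].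
  by apply: ge_sup; [exists (p 0%N).2, 0%N|move=> _ [k _ <-]; have [] := mono2 n k].
have hXY : hol G (Complex X Y).
  apply: hG; [have := hX 0%N|have := hY 0%N]; have [/= ] := pBad 0%N; rewrite /a /b expr0 !mulr1; lra.
have [d hd] := hXY.
pose S := (x1 - x0) + (y1 - y0).
have S0 : 0 <= S by rewrite addr_ge0 ?subr_ge0.
(* The upper bound will be [4 * e * S^2 * 4^-n], which this choice keeps below [c * 4^-n]. *)
pose e := c / (8 * S ^+ 2 + 1).
have e0 : 0 < e by rewrite divr_gt0 // ltr_wpDl // mulr_ge0 // exprn_ge0.
have [r r0 hr] := hd e e0.
have [n hn] : exists n : nat, S * 2^-1 ^+ n < r.
  have [|||n /(_ n (leqnn _))] := @expr_small R 2^-1 (r / (S + 1)) _ _ _.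
  - by rewrite invr_ge0.
  - by rewrite invf_lt1 ?ltr1n.
  - by rewrite divr_gt0 ?ltr_wpDl.
  rewrite ltr_pdivlMr ?ltr_wpDl // => h.
  exists n; apply: le_lt_trans h; rewrite mulrC ler_wpM2l ?exprn_ge0 //; lra.
have [h1 h2 h3 h4 h5] := pBad n.
have hA := a0 n; have hB := b0 n.
have hCn : contR G (p n).1 ((p n).1 + a n) (p n).2 ((p n).2 + b n).
  exact: contR_sub hC h1 h2 h3 h4.
pose aff := fun z => (G (Complex X Y) - d * Complex X Y) + d * z.
have EJ : rect_int G (p n).1 ((p n).1 + a n) (p n).2 ((p n).2 + b n) =
   rect_int (fun z => G z - aff z) (p n).1 ((p n).1 + a n) (p n).2 ((p n).2 + b n).
  have affC := @affine_contR (G (Complex X Y) - d * Complex X Y) d (p n).1 ((p n).1 + a n) (p n).2 ((p n).2 + b n).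
  by rewrite rect_intB ?rect_int_affine ?subr0 ?lerDl //; exact: contR_B.
have Sn : a n + b n = S * 2^-1 ^+ n by rewrite /a /b /S -mulrDl.
have bound : nrm (rect_int (fun z => G z - aff z) (p n).1 ((p n).1 + a n) (p n).2 ((p n).2 + b n)) <=
   4 * (e * (S * 2^-1 ^+ n)) * (((p n).1 + a n - (p n).1) + ((p n).2 + b n - (p n).2)).
  apply: rect_int_le; rewrite ?lerDl //.
    move=> x y /and3P[hx' hy' _]; apply: hol_cont; apply: holB; first by apply: hG; lra.
    by apply: holD; [exact: hol_cst|apply: holZ; exact: hol_id].
  move=> x y /and3P[hx' hy' _].
  pose w : R[i] := Complex x y - Complex X Y.
  have hw : nrm w <= S * 2^-1 ^+ n.
    rewrite -Sn; apply: le_trans (nrm_le_ReIm _) _; rewrite /w /=.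
    have := hX n; have := hY n => /andP[? ?] /andP[? ?].
    by apply: lerD; rewrite ler_norml; lra.
  have := hr w (le_lt_trans hw hn); rewrite /w subrKC => h.
  have -> : G (Complex x y) - aff (Complex x y) =
    G (Complex x y) - G (Complex X Y) - d * (Complex x y - Complex X Y) by rewrite /aff; ring.
  by apply: le_trans h _; rewrite ler_wpM2l // ltW.
have : c * 4^-1 ^+ n <= 4 * e * S ^+ 2 * 4^-1 ^+ n.
  apply: le_trans h5 _; rewrite EJ; apply: le_trans bound _.
  have -> : (p n).1 + a n - (p n).1 + ((p n).2 + b n - (p n).2) = S * 2^-1 ^+ n by rewrite -Sn; ring.
  have -> : 4^-1 ^+ n = (2^-1 ^+ n) ^+ 2 :> R.
    by rewrite -exprM mulnC exprM; congr (_ ^+ n); field.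
  by rewrite le_eqVlt; apply/orP; left; apply/eqP; ring.
rewrite ler_pM2r ?exprn_gt0 ?invr_gt0 // => hc.
have : e * (8 * S ^+ 2 + 1) = c.
  by rewrite /e divfK // lt0r_neq0 // ltr_wpDl // mulr_ge0 // exprn_ge0.
have : 0 <= e * S ^+ 2 by rewrite mulr_ge0 ?(ltW e0) // exprn_ge0.
have E4 : 4 * e * S ^+ 2 = 4 * (e * S ^+ 2) by ring.
rewrite E4 in hc.
lra.
Qed.
End Goursat.

(** * A Cauchy estimate with a lossy constant and the strict maximum principle *)

Section MaxP.
Variable R : realType.
Implicit Types (F G H : R[i] -> R[i]) (x y s : R).

Lemma square_nrm s x y : 0 < s -> bdry (- s) s (- s) s x y ->
  s <= nrm (Complex x y) <= 2 * s.
Proof.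
move=> s0 /and3P[hx hy hb]; apply/andP; split; last first.
  apply: le_trans (nrm_le_ReIm _) _ => /=.
  have : `|x| <= s by rewrite ler_norml.
  have : `|y| <= s by rewrite ler_norml.
  lra.
have /= h1 := normRe_le (Complex x y); have /= h2 := normIm_le (Complex x y).
have ns : `|s| = s by rewrite gtr0_norm.
case/orP: hb => [/orP[/orP[]|]|] /eqP e.
- by rewrite e normrN ns in h1; rewrite e.
- by rewrite e ns in h1; rewrite e.
- by rewrite e normrN ns in h2; rewrite e.
- by rewrite e ns in h2; rewrite e.
Qed.

(** A lower bound stands in for the exact value [2 pi i]. Each of the two grouped integrals
    contributes at least [2] to the imaginary part, its integrand being [2 s / (s^2 + t^2) >= 1 / s]
    over a length [2 s]. *)
Lemma rect_int_inv_ge s : 0 < s -> 4 <= nrm (rect_int (fun z => z^-1) (- s) s (- s) s).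
Proof.
move=> s0; have s1 : - s <= s by lra.
have hB : contB (fun z : R[i] => z^-1) (- s) s (- s) s.
  move=> x y /(square_nrm s0)/andP[h _]; apply: hol_cont; apply: holV; first exact: hol_id.
  by rewrite -nrm_gt0; lra.
have hA : ccon (fun x => (Complex x (- s))^-1 - (Complex x s)^-1) (- s) s.
  by apply: cconB; apply: (contB_h hB) => //; rewrite ?eqxx ?orbT.
have hC : ccon (fun y => (Complex s y)^-1 - (Complex (- s) y)^-1) (- s) s.
  by apply: cconB; apply: (contB_v hB) => //; rewrite ?eqxx ?orbT.
have key (t : R) : - s <= t <= s -> s^-1 <= 2 * s / (s ^+ 2 + t ^+ 2).
  move=> ht; have t2 : t ^+ 2 <= s ^+ 2.
    rewrite -(real_normK (num_real t)) ler_pXn2r ?nnegrE ?(ltW s0) //; by rewrite ler_norml.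
  have p0 : 0 < s ^+ 2 + t ^+ 2 by rewrite ltr_wpDr ?sqr_ge0 // exprn_gt0.
  rewrite ler_pdivlMr // mulrC ler_pdivrMr //.
  have -> : 2 * s * s = 2 * s ^+ 2 by ring.
  lra.
apply: (le_trans _ (le_trans (ler_norm _) (normIm_le _))).
rewrite /rect_int ImD ImM /= mul0r add0r mul1r.
have h1 : s^-1 * (s - - s) <= rint (fun t => Im ((Complex t (- s))^-1 - (Complex t s)^-1)) (- s) s.
  apply: rint_ge => //; first exact: ccon_Im.
  move=> t /key h; apply: (le_trans h); rewrite le_eqVlt; apply/orP; left; apply/eqP.
  by rewrite ImD ImN /= sqrrN; field; rewrite lt0r_neq0 // ltr_wpDl ?sqr_ge0 // exprn_gt0.
have h2 : s^-1 * (s - - s) <= rint (fun t => Re ((Complex s t)^-1 - (Complex (- s) t)^-1)) (- s) s.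
  apply: rint_ge => //; first exact: ccon_Re.
  move=> t /key h; apply: (le_trans h); rewrite le_eqVlt; apply/orP; left; apply/eqP.
  by rewrite ReD ReN /= sqrrN; field; rewrite lt0r_neq0 // ltr_wpDr ?sqr_ge0 // exprn_gt0.
have -> : 4 = s^-1 * (s - - s) + s^-1 * (s - - s) by field; exact: lt0r_neq0.
exact: lerD.
Qed.

(** By Goursat only a square of half side [t] about the puncture contributes, and continuity at [0]
    bounds its contribution by a multiple of [t]. *)
Lemma rect_int_puncture G s : 0 < s ->
  (forall x y, - s <= x <= s -> - s <= y <= s -> Complex x y != 0 -> hol G (Complex x y)) ->
  cont G 0 -> rect_int G (- s) s (- s) s = 0.
Proof.
move=> s0 hG hG0; have [r r0 hr] := hG0 1 ltr01.
pose B := nrm (G 0) + 1.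
have hC : contR G (- s) s (- s) s.
  move=> x y hx hy; have [->|n0] := eqVneq (Complex x y) 0; first exact: hG0.
  by apply: hol_cont; exact: hG.
have B0 : 0 <= B by rewrite addr_ge0 ?nrm_ge0.
have bound t : 0 < t -> t <= s -> 2 * t < r -> nrm (rect_int G (- s) s (- s) s) <= 4 * B * (4 * t).
  move=> t0 ts tr.
  have a1 : - s <= - t by lra.
  have a2 : - t <= t by lra.
  have a3 : - s <= s by lra.
  have nz x y : Complex x y = 0 -> x = 0 /\ y = 0 by case=> -> ->.
  rewrite (rect_int_catx a1 (le_trans a2 ts) a3 hC).
  have h1 : rect_int G (- s) (- t) (- s) s = 0.
    apply: goursat => // x y hx hy; apply: hG => //; first lra.
    by apply/eqP => /nz[]; lra.
  have hC' : contR G (- t) s (- s) s by apply: contR_sub hC _ _ _ _.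
  rewrite h1 add0r (rect_int_catx a2 ts a3 hC').
  have h2 : rect_int G t s (- s) s = 0.
    apply: goursat => // x y hx hy; apply: hG => //; first lra.
    by apply/eqP => /nz[]; lra.
  have hC2 : contR G (- t) t (- s) s by apply: contR_sub hC _ _ _ _.
  rewrite h2 addr0 (rect_int_caty a1 (le_trans a2 ts) a2 hC2).
  have h3 : rect_int G (- t) t (- s) (- t) = 0.
    apply: goursat => // x y hx hy; apply: hG; try lra.
    by apply/eqP => /nz[]; lra.
  have hC3 : contR G (- t) t (- t) s by apply: contR_sub hC _ _ _ _.
  rewrite h3 add0r (rect_int_caty a2 ts a2 hC3).
  have h4 : rect_int G (- t) t t s = 0.
    apply: goursat => // x y hx hy; apply: hG; try lra.
    by apply/eqP => /nz[]; lra.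
  rewrite h4 addr0; have -> : 4 * t = (t - - t) + (t - - t) by ring.
  apply: rect_int_le => //; first by apply: contR_B; apply: contR_sub hC _ _ _ _.
  move=> x y hb; have /andP[_ h] := square_nrm t0 hb.
  have := hr _ (le_lt_trans h tr); rewrite add0r => h5.
  have := nrm_lb (G (Complex x y)) (G 0); rewrite /B; lra.
apply/eqP; rewrite -nrm_le0; apply/ler_addgt0Pl => e e0; rewrite addr0.
pose t := Num.min (Num.min s (r / 4)) (e / (16 * B + 1)).
have p0 : 0 < 16 * B + 1 by rewrite ltr_wpDl // mulr_ge0.
have t0 : 0 < t by rewrite !min_gt0 // divr_gt0.
have ts : t <= s by rewrite /t !ge_min lexx.
have tr : 2 * t < r by have : t <= r / 4 by [rewrite /t !ge_min lexx orbT]; lra.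
have te : t * (16 * B + 1) <= e by rewrite -ler_pdivlMr // /t ge_min lexx orbT.
apply: le_trans (bound _ t0 ts tr) _.
have -> : 4 * B * (4 * t) = t * (16 * B + 1) - t by ring.
lra.
Qed.

(** The quotient [(H z - H 0) / z], completed by the derivative at [0], has zero integral, so [H 0]
    times the integral of [1 / z] equals that of [H z / z]. The former has modulus at least
    [4 * nrm (H 0)], the latter at most [16 * M]. *)
Lemma square_bound H s M : 0 < s ->
  (forall x y, - s <= x <= s -> - s <= y <= s -> hol H (Complex x y)) ->
  (forall x y, bdry (- s) s (- s) s x y -> nrm (H (Complex x y)) <= M) ->
  nrm (H 0) <= 4 * M.
Proof.
move=> s0 hH hM; have s1 : - s <= s by lra.
have [d hd] : hol H 0 by apply: (hH 0 0); lra.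
have M0 : 0 <= M.
  by apply: le_trans (nrm_ge0 _) (hM s s _); rewrite /bdry !eqxx !orbT lexx s1.
pose q z := if z == 0 then d else (H z - H 0) * z^-1.
have qhol z : z != 0 -> hol H z -> hol q z.
  move=> z0 hz; have n0 : 0 < nrm z by rewrite nrm_gt0.
  apply: (@hol_local R (fun z => (H z - H 0) * z^-1) _ _ _ n0).
    move=> x hx; rewrite /q; case: eqP => // x0.
    by rewrite x0 sub0r nrmN ltxx in hx.
  apply: holM; first by apply: holB => //; exact: hol_cst.
  by apply: holV => //; exact: hol_id.
have qcont : cont q 0.
  move=> e e0; have e2 : 0 < e / 2 by rewrite divr_gt0.
  have [r r0 h] := hd _ e2; exists r => // w /h {h}; rewrite !add0r /q eqxx.
  case: eqP => [->|/eqP w0] h; first by rewrite subrr nrm0.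
  have n0 : 0 < nrm w by rewrite nrm_gt0.
  rewrite -(ltr_pM2r n0) -nrmM mulrBl mulfVK //.
  by apply: le_lt_trans h _; rewrite ltr_pM2r //; lra.
have hq : rect_int q (- s) s (- s) s = 0.
  apply: (rect_int_puncture s0 _ qcont) => x y hx hy n0; apply: qhol => //; exact: hH.
have bn x y : bdry (- s) s (- s) s x y -> Complex x y != 0.
  by move=> /(square_nrm s0)/andP[h _]; rewrite -nrm_gt0; lra.
have hI : contB (fun z : R[i] => z^-1) (- s) s (- s) s.
  move=> x y /bn h; apply: hol_cont; apply: holV => //; exact: hol_id.
have hHI : contB (fun z : R[i] => H z * z^-1) (- s) s (- s) s.
  move=> x y hb; have /and3P[hx hy _] := hb; apply: hol_cont; apply: holM; first exact: hH.
  by apply: holV; [exact: hol_id|exact: bn].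
have hcI : contB (fun z : R[i] => H 0 * z^-1) (- s) s (- s) s.
  move=> x y /bn h; apply: hol_cont; apply: holZ; apply: holV => //; exact: hol_id.
have E : rect_int (fun z => H z * z^-1) (- s) s (- s) s = H 0 * rect_int (fun z => z^-1) (- s) s (- s) s.
  apply/eqP; rewrite -subr_eq0 -rect_intZ // -rect_intB //; apply/eqP.
  apply: etrans _ hq; apply: rect_int_ext => // x y /bn h; by rewrite /q (negbTE h) mulrBl.
have h1 : nrm (rect_int (fun z => H z * z^-1) (- s) s (- s) s) <= 4 * (M / s) * ((s - - s) + (s - - s)).
  apply: rect_int_le => // x y hb; have /andP[hs _] := square_nrm s0 hb.
  rewrite nrmf; apply: ler_pM; rewrite ?nrm_ge0 ?invr_ge0 ?nrm_ge0 ?hM //.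
  by rewrite lef_pV2 // posrE //; lra.
have h2 := ler_wpM2l (nrm_ge0 (H 0)) (rect_int_inv_ge s0).
rewrite -nrmM -E in h2.
have E2 : 4 * (M / s) * ((s - - s) + (s - - s)) = 16 * M by field; exact: lt0r_neq0.
rewrite E2 in h1; lra.
Qed.

(* Quadratic strictness turns a maximum of [Re H] into one of [|K + H - H z0|]
   for large [K]; Cauchy's estimate for high powers then forbids it. *)
Lemma weak_max H z0 (r e : R) : 0 < r -> 0 < e -> (forall z, nrm (z - z0) < r -> hol H z) ->
  ~ (forall z, nrm (z - z0) < r -> Re (H z) + e * nrm (z - z0) ^+ 2 <= Re (H z0)).
Proof.
move=> r0 e0 hH hmax.
have [d hd] : hol H z0 by apply: hH; rewrite subrr nrm0.
have [r1 r10 hlip] := cd_lip hd.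
(* For [v = H (z0 + w) - H z0], expand [nrm (K + v)^2 = K^2 + 2 K Re v + nrm v^2]. The middle term
   is at most [- (C^2 + 1) nrm w^2] by the choice of [K], the last at most [C^2 nrm w^2]; a deficit
   of [nrm w^2] is left. *)
pose C := nrm d + 1; pose K := (C ^+ 2 + 1) / (2 * e).
have C0 : 0 < C by rewrite /C ltr_wpDl ?nrm_ge0.
have K0 : 0 < K by rewrite divr_gt0 ?mulr_gt0 // ltr_wpDl // exprn_ge0 // ltW.
have KE : 2 * e * K = C ^+ 2 + 1 by rewrite /K; field; exact: lt0r_neq0.
clearbody K; pose s := Num.min (Num.min r r1) K / 4.
have s0 : 0 < s by rewrite divr_gt0 ?min_gt0.
have sm : [/\ 4 * s <= r, 4 * s <= r1 & 4 * s <= K].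
  have -> : 4 * s = Num.min (Num.min r r1) K by rewrite /s; field.
  by rewrite !ge_min !lexx !orbT.
have [sr sr1 sK] := sm.
pose F w := H (z0 + w) - H z0 + K%:C%C.
have F0 : nrm (F 0) = K by rewrite /F addr0 subrr add0r nrm_real gtr0_norm.
have zw w : z0 + w - z0 = w by ring.
have Fhol w : nrm w < r -> hol F w.
  move=> wr; apply: holD; last exact: hol_cst.
  apply: holB; last exact: hol_cst.
  apply: (@hol_comp R (fun w => z0 + w) H); first by apply: holD; [exact: hol_cst|exact: hol_id].
  by apply: hH; rewrite zw.
have Fb w : s <= nrm w -> nrm w <= 2 * s -> nrm (F w) ^+ 2 <= K ^+ 2 - s ^+ 2.
  move=> h1 h2.
  have := hmax (z0 + w); rewrite zw => /(_ _) hm; have {hm}hm := hm ltac:(lra).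
  have := hlip w => hl; have {}hl := hl ltac:(lra).
  have E : nrm (F w) ^+ 2 = K ^+ 2 + 2 * K * Re (H (z0 + w) - H z0) + nrm (H (z0 + w) - H z0) ^+ 2.
    by rewrite /F !nrm_sqr !(ReD, ImD) /=; ring.
  have hq : nrm (H (z0 + w) - H z0) ^+ 2 <= C ^+ 2 * nrm w ^+ 2.
    by rewrite -exprMn ler_pXn2r ?nnegrE ?nrm_ge0 // mulr_ge0 ?nrm_ge0 // ltW.
  have hR : Re (H (z0 + w) - H z0) <= - (e * nrm w ^+ 2) by rewrite ReD ReN; lra.
  have hK := ler_wpM2l (ltW K0) hR.
  have hs : s ^+ 2 <= nrm w ^+ 2 by rewrite ler_pXn2r ?nnegrE ?nrm_ge0 // ltW.
  have E2 : K * - (e * nrm w ^+ 2) = - (2 * e * K) * nrm w ^+ 2 / 2 by field.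
  rewrite E2 KE in hK.
  have E3 : - (C ^+ 2 + 1) * nrm w ^+ 2 / 2 = - (C ^+ 2 * nrm w ^+ 2) / 2 - nrm w ^+ 2 / 2 by field.
  rewrite E3 in hK; rewrite E.
  have -> : 2 * K * Re (H (z0 + w) - H z0) = 2 * (K * Re (H (z0 + w) - H z0)) by ring.
  lra.
pose rho := (K ^+ 2 - s ^+ 2) / K ^+ 2.
have K2 : 0 < K ^+ 2 by rewrite exprn_gt0.
have s2 : 0 < s ^+ 2 by rewrite exprn_gt0.
have sK2 : s ^+ 2 <= K ^+ 2 by rewrite ler_pXn2r ?nnegrE ?(ltW s0) ?(ltW K0) //; lra.
have rho0 : 0 <= rho by rewrite divr_ge0 ?subr_ge0 // ltW.
have rho1 : rho < 1 by rewrite ltr_pdivrMr // mul1r; lra.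
(* The constant [4] of [square_bound], squared because squares of moduli are compared. *)
have p16 : 0 < (16^-1 : R) by rewrite invr_gt0.
have [n /(_ n (leqnn n)) hn] := expr_small rho0 rho1 p16.
have hsq := @square_bound (fun w => F w ^+ n) s (Num.sqrt ((K ^+ 2 - s ^+ 2) ^+ n)) s0.
have {hsq} : nrm (F 0 ^+ n) <= 4 * Num.sqrt ((K ^+ 2 - s ^+ 2) ^+ n).
  apply: hsq.
    move=> x y hx hy; apply: holX; apply: Fhol; apply: le_lt_trans (nrm_le_ReIm _) _ => /=.
    have : `|x| <= s by rewrite ler_norml.
    have : `|y| <= s by rewrite ler_norml.
    lra.
  move=> x y hb; have /andP[h1 h2] := square_nrm s0 hb.
  rewrite -(@ler_pXn2r _ 2) ?nnegrE ?nrm_ge0 ?sqrtr_ge0 // sqr_sqrtr ?exprn_ge0 ?subr_ge0 //.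
  by rewrite nrmX exprAC lerXn2r ?nnegrE ?subr_ge0 ?exprn_ge0 ?nrm_ge0 ?Fb.
rewrite nrmX F0 -(@ler_pXn2r _ 2) ?nnegrE ?mulr_ge0 ?sqrtr_ge0 ?exprn_ge0 ?(ltW K0) //.
rewrite exprMn sqr_sqrtr ?exprn_ge0 ?subr_ge0 // exprAC leNgt => /negP; apply.
have -> : (K ^+ 2 - s ^+ 2) ^+ n = rho ^+ n * (K ^+ 2) ^+ n.
  by rewrite -exprMn /rho divfK // lt0r_neq0.
have Kn : 0 < (K ^+ 2) ^+ n by rewrite exprn_gt0.
rewrite mulrA -[ltRHS]mul1r ltr_pM2r //; lra.
Qed.
End MaxP.

(** * Compact sets, pointwise subharmonicity and comparison *)

Section Compactness.
Variable R : realType.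
Implicit Types (S : set R[i]) (u : R[i] -> R) (z x : R[i]).

Definition cclosed S := forall z, (forall e : R, 0 < e -> exists2 x, S x & nrm (x - z) < e) -> S z.
Definition cbounded S := exists M : R, forall x, S x -> nrm x <= M.
Definition usc S u := forall z, S z -> forall e : R, 0 < e -> exists2 r : R, 0 < r &
  forall x, S x -> nrm (x - z) < r -> u x < u z + e.

Lemma seq_compact S (x : nat -> R[i]) : cclosed S -> cbounded S -> (forall n, S (x n)) ->
  exists2 l, S l & ucv x l.
Proof.
move=> hc [M hM] hx; have [l hl] := @ucv_ex R x M (fun n => hM _ (hx n)).
exists l => //; apply: hc => e /hl /ulf_ex[n /= hn].
by exists (x n).
Qed.

Lemma exists_lt_inv (e : R) : 0 < e -> exists n0 : nat, forall n, (n0 <= n)%N -> n.+1%:R^-1 < e.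
Proof.
move=> e0; exists (Num.Def.archi_bound e^-1) => n hn.
have h := archi_boundP (ltW (_ : 0 < e^-1)); rewrite invr_gt0 in h.
rewrite -(invrK e) ltf_pV2 ?posrE ?invr_gt0 ?ltr0n //.
by apply: lt_le_trans (h e0) _; rewrite ler_nat ltnW.
Qed.

Lemma exists_gt_nat (a : R) : exists n0 : nat, forall n, (n0 <= n)%N -> a < n%:R.
Proof.
exists (Num.Def.archi_bound `|a|) => n hn.
apply: le_lt_trans (ler_norm _) (lt_le_trans (archi_boundP (normr_ge0 a)) _).
by rewrite ler_nat.
Qed.

Lemma ulf_ge n0 : ulf [set n | (n0 <= n)%N].
Proof. by apply: ulf_eventually; exists n0. Qed.

Lemma usc_max S u : cclosed S -> cbounded S -> S !=set0 -> usc S u ->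
  exists2 z, S z & forall x, S x -> u x <= u z.
Proof.
move=> hc hb [z0 Sz0] hu.
have [hub|hnub] := pselect (has_ubound (u @` S)).
  have hs : has_sup (u @` S) by split => //; exists (u z0), z0.
  have ex n : exists x, S x /\ sup (u @` S) - n.+1%:R^-1 < u x.
    have n0 : 0 < n.+1%:R^-1 :> R by rewrite invr_gt0 ltr0n.
    by have [_ [x Sx <-] h] := sup_adherent n0 hs; exists x.
  have [x hx] := choice ex.
  have [l Sl hl] := seq_compact hc hb (fun n => (hx n).1).
  exists l => // y Sy; apply: le_trans (_ : sup (u @` S) <= _).
    by apply: ub_le_sup => //; exists y.
  apply/ler_addgt0Pl => e e0; have e2 : 0 < e / 2 by rewrite divr_gt0.
  have [r r0 hr] := hu _ Sl _ e2; have [n0 hn0] := exists_lt_inv e2.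
  have [n [/= h1 /hn0 h2]] := ulf_ex (ulfI (hl _ r0) (ulf_ge n0)).
  have g1 := hr _ (hx n).1 h1; have g2 := (hx n).2.
  rewrite ltrBlDr in g2; apply: ltW; apply: lt_trans g2 _.
  apply: lt_le_trans (ltrD g1 h2) _; lra.
exfalso; have ex n : exists x, S x /\ n%:R < u x.
  apply: contrapT => hN; apply: hnub; exists n%:R => _ [x Sx <-].
  by rewrite leNgt; apply/negP => h; apply: hN; exists x.
have [x hx] := choice ex.
have [l Sl hl] := seq_compact hc hb (fun n => (hx n).1).
have [r r0 hr] := hu _ Sl _ ltr01; have [n0 hn0] := exists_gt_nat (u l + 1).
have [n [/= h1 /hn0 h2]] := ulf_ex (ulfI (hl _ r0) (ulf_ge n0)).
by have := lt_trans (lt_trans (hx n).2 (hr _ (hx n).1 h1)) h2; rewrite ltxx.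
Qed.

(* Subharmonicity in the viscosity sense, tested against real parts of
   holomorphic functions with a quadratic margin. *)
Definition sub u z0 := forall (H : R[i] -> R[i]) (r e : R), 0 < r -> 0 < e ->
  (forall z, nrm (z - z0) < r -> hol H z) ->
  ~ (forall z, nrm (z - z0) < r ->
       u z - Re (H z) + e * nrm (z - z0) ^+ 2 <= u z0 - Re (H z0)).

Lemma nrm_sqr_expand (z z1 : R[i]) :
  nrm z ^+ 2 = nrm z1 ^+ 2 + 2 * Re (conjc z1 * (z - z1)) + nrm (z - z1) ^+ 2.
Proof. by case: z z1 => a b [c d]; rewrite !nrm_sqr /=; ring. Qed.

(** At a maximum [z2] of [u z + e * nrm z ^+ 2], expanding the square about [z2] shows that the real
    part of [- 2 * e * conjc z2 * z] touches [u] with quadratic margin [e], which [sub] forbids.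
    Hence [u z2 <= B], and [e] is too small for the added term to make up for [u z1 - B]. *)
Lemma comparison S u (B : R) : cclosed S -> cbounded S -> usc S u ->
  (forall z, S z -> u z <= B \/
     ((exists2 r, 0 < r & forall x, nrm (x - z) < r -> S x) /\ sub u z)) ->
  forall z, S z -> u z <= B.
Proof.
move=> hc hb hu h z1 S1; rewrite leNgt; apply/negP => hB.
have [M hM] := hb.
have M0 : 0 <= M by apply: le_trans (nrm_ge0 _) (hM _ S1).
pose e := (u z1 - B) / (M ^+ 2 + 1).
have p0 : 0 < M ^+ 2 + 1 by rewrite ltr_wpDl // exprn_ge0.
have e0 : 0 < e by rewrite divr_gt0 // subr_gt0.
have eE : e * (M ^+ 2 + 1) = u z1 - B by rewrite /e divfK // lt0r_neq0.
have hv : usc S (fun z => u z + e * nrm z ^+ 2).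
  move=> z Sz t t0; have t2 : 0 < t / 2 by rewrite divr_gt0.
  have q0 : 0 < e * (2 * M) + 1.
    by apply: ltr_wpDl => //; apply: mulr_ge0; [exact: ltW|exact: mulr_ge0].
  have [r r0 hr] := hu _ Sz _ t2.
  exists (Num.min r (t / 2 / (e * (2 * M) + 1))).
    by rewrite min_gt0 // divr_gt0.
  move=> x Sx; rewrite lt_min ltr_pdivlMr //.
  move=> /andP[/(hr _ Sx) h1 h2].
  have E : nrm x ^+ 2 - nrm z ^+ 2 = (nrm x - nrm z) * (nrm x + nrm z) by ring.
  have h3 : nrm x ^+ 2 - nrm z ^+ 2 <= nrm (x - z) * (2 * M).
    rewrite E; apply: le_trans (_ : nrm (x - z) * (nrm x + nrm z) <= _).
      by rewrite ler_wpM2r ?nrm_lb // addr_ge0 ?nrm_ge0.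
    rewrite ler_wpM2l ?nrm_ge0 //; have := hM _ Sx; have := hM _ Sz; lra.
  have := ler_wpM2l (ltW e0) h3.
  have E2 : nrm (x - z) * (e * (2 * M) + 1) = e * (nrm (x - z) * (2 * M)) + nrm (x - z) by ring.
  rewrite E2 in h2; have := nrm_ge0 (x - z); lra.
have [z2 S2 hz2] := usc_max hc hb (ex_intro _ _ S1) hv.
have n2 (x : R[i]) : S x -> e * nrm x ^+ 2 <= e * M ^+ 2.
  by move=> /hM hx; rewrite ler_pM2l // ler_pXn2r ?nnegrE ?nrm_ge0.
have := hz2 _ S1; have := n2 _ S2 => h1 h2.
have := h _ S2; case; first by have : 0 <= e * nrm z1 ^+ 2 by [rewrite mulr_ge0 ?exprn_ge0 ?nrm_ge0 // ltW]; lra.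
move=> [[r r0 hr] /(_ (fun z => (- 2 * e)%:C%C * (conjc z2 * z)) r e r0 e0)]; apply.
  by move=> z _; apply: holZ; apply: holZ; exact: hol_id.
move=> z /hr /hz2; rewrite !ReZ (nrm_sqr_expand z z2).
rewrite mulrBr ReD ReN; lra.
Qed.

(** A function testing [v] at [z0] also tests [u], which lies below [v] and meets it there.
    Stability under maxima and locality follow. *)
Lemma sub_le u v z0 (r : R) : 0 < r -> (forall z, nrm (z - z0) < r -> u z <= v z) -> u z0 = v z0 ->
  sub u z0 -> sub v z0.
Proof.
move=> r0 h h0 hu H r' e r'0 e0 hH hv.
apply: (hu H (Num.min r r') e) => //; first exact: min_gt0.
  by move=> z; rewrite lt_min => /andP[_]; exact: hH.
move=> z; rewrite lt_min => /andP[/h h1 /hv h2]; rewrite h0; lra.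
Qed.

Lemma sub_max u v z0 : sub u z0 -> sub v z0 -> sub (fun z => Num.max (u z) (v z)) z0.
Proof.
move=> hu hv; case: (leP (u z0) (v z0)) => h.
- apply: (@sub_le v _ _ 1) => // [z _|]; first by rewrite le_max lexx orbT.
  by apply/esym/max_idPr.
- apply: (@sub_le u _ _ 1) => // [z _|]; first by rewrite le_max lexx.
  by apply/esym/max_idPl; exact: ltW.
Qed.

Lemma sub_local u v z0 (r : R) : 0 < r -> (forall z, nrm (z - z0) < r -> u z = v z) ->
  sub u z0 -> sub v z0.
Proof.
move=> r0 h; apply: (@sub_le _ _ _ r) => // [z /h ->//|].
by apply: h; rewrite subrr nrm0.
Qed.

(** A test function at a minimum of [u] would itself contradict [weak_max]. In particular a
    nonnegative function is subharmonic at its zeros, which is how competitors can be extended by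
    zero. *)
Lemma sub_min u z0 (r : R) : 0 < r -> (forall z, nrm (z - z0) < r -> u z0 <= u z) -> sub u z0.
Proof.
move=> r0 h H r' e r'0 e0 hH hu.
apply: (@weak_max R (fun z => - H z) z0 (Num.min r r') e) => //; first exact: min_gt0.
  by move=> z; rewrite lt_min => /andP[_ /hH]; exact: holN.
move=> z; rewrite lt_min => /andP[/h h1 /hu h2]; rewrite !ReN; lra.
Qed.

(* The modulus of a holomorphic function is touched from below by the real part
   of a rotated copy. *)
Lemma sub_addN u G z0 (r : R) : 0 < r -> (forall z, nrm (z - z0) < r -> hol G z) ->
  sub u z0 -> sub (fun z => u z + nrm (G z)) z0.
Proof.
move=> r0 hG hu H r' e r'0 e0 hH hv.
have [c [c1 cG]] := exists_phase (G z0).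
apply: (hu (fun z => H z - conjc c * G z) (Num.min r r') e) => //; first exact: min_gt0.
  by move=> z; rewrite lt_min => /andP[/hG h1 /hH h2]; apply: holB => //; exact: holZ.
have E : Re (conjc c * G z0) = nrm (G z0).
  rewrite -{1}cG mulrA (mulrC (conjc c)) mulcJ c1 expr1n mul1r //.
move=> z; rewrite lt_min => /andP[_ /hv h1]; rewrite !(ReD, ReN) E.
have := Re_le (conjc c * G z); rewrite nrmM nrm_conj c1 mul1r; lra.
Qed.

Lemma sub_addRe u G z0 (r : R) : 0 < r -> (forall z, nrm (z - z0) < r -> hol G z) ->
  sub u z0 -> sub (fun z => u z + Re (G z)) z0.
Proof.
move=> r0 hG hu H r' e r'0 e0 hH hv.
apply: (hu (fun z => H z - G z) (Num.min r r') e) => //; first exact: min_gt0.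
  by move=> z; rewrite lt_min => /andP[/hG h1 /hH h2]; exact: holB.
by move=> z; rewrite lt_min => /andP[_ /hv h1]; rewrite !(ReD, ReN); lra.
Qed.

Lemma sub_cst (c : R) z0 : sub (fun=> c) z0.
Proof. by apply: (@sub_min _ _ 1). Qed.

Lemma sub_Re G z0 (r : R) : 0 < r -> (forall z, nrm (z - z0) < r -> hol G z) ->
  sub (fun z => Re (G z)) z0.
Proof.
move=> r0 hG; apply: (@sub_local (fun z => 0 + Re (G z)) _ _ 1) => // [z _|]; first by rewrite add0r.
by apply: (@sub_addRe (fun=> 0) G z0 r) => //; exact: sub_cst.
Qed.

Lemma sub_scale (k : R) u z0 : 0 < k -> sub u z0 -> sub (fun z => k * u z) z0.
Proof.
move=> k0 hu H r e r0 e0 hH hv.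
apply: (hu (fun z => (k^-1)%:C%C * H z) r (e / k)) => //; first exact: divr_gt0.
  by move=> z /hH; exact: holZ.
move=> z /hv h; rewrite !ReZ -(ler_pM2l k0) !mulrDr !mulrN !mulrA divff ?lt0r_neq0 // !mul1r.
by rewrite (mulrC k e) mulfK ?lt0r_neq0 // -mulrA -expr2.
Qed.

Lemma cont_usc S u : (forall z, S z -> rcont u z) -> usc S u.
Proof.
move=> h z /h hz e /hz[r r0 hr]; exists r => // x _ /hr.
rewrite subrKC => /(le_lt_trans (ler_norm _)); lra.
Qed.

(** After multiplication by a phase the modulus at the given point is a real part, to which
    [comparison] applies. *)
Lemma max_principle S H (M : R) : cclosed S -> cbounded S -> (forall z, S z -> cont H z) ->
  (forall z, S z -> nrm (H z) <= M \/
     exists2 r, 0 < r & forall x, nrm (x - z) < r -> S x /\ hol H x) ->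
  forall z, S z -> nrm (H z) <= M.
Proof.
move=> hc hb hco h z Sz; have [c [c1 cH]] := exists_phase (H z).
have {}cH : nrm (H z) = Re (conjc c * H z).
  rewrite -{2}cH mulrA (mulrC (conjc c)) mulcJ c1 expr1n mul1r //.
rewrite cH; apply: (@comparison S (fun z => Re (conjc c * H z))) => //.
  apply: cont_usc => x /hco hx e /hx[r r0 hr]; exists r => // w /hr.
  apply: le_lt_trans; rewrite -ReN -ReD -mulrBr; apply: le_trans (normRe_le _) _.
  by rewrite nrmM nrm_conj c1 mul1r.
move=> x /h[hx|[r r0 hr]]; [left|right].
  by apply: le_trans (Re_le _) _; rewrite nrmM nrm_conj c1 mul1r.
split; first by exists r => // y /hr[].
by apply: (sub_Re r0) => y /hr[_]; exact: holZ.
Qed.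

Lemma cclosed_disc (a : R[i]) (r : R) : cclosed [set z | nrm (z - a) <= r].
Proof.
move=> z h /=; apply/ler_addgt0Pl => e /h[x /= hx hz].
have := nrm_tri x z a; rewrite (nrmC z x); lra.
Qed.

Lemma cbounded_disc (a : R[i]) (r : R) : cbounded [set z | nrm (z - a) <= r].
Proof.
exists (r + nrm a) => x /= h; have := nrm_lb x a; lra.
Qed.

Lemma max_disc H (r M : R) : (forall z, nrm z <= r -> hol H z) ->
  (forall z, nrm z = r -> nrm (H z) <= M) -> forall z, nrm z <= r -> nrm (H z) <= M.
Proof.
move=> hH hM z hz; apply: (@max_principle [set z | nrm (z - 0) <= r] H M) => /=; last by rewrite subr0.
- exact: cclosed_disc.
- exact: cbounded_disc.
- by move=> x; rewrite subr0 => /hH/hol_cont.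
move=> x; rewrite subr0 le_eqVlt => /orP[/eqP/hM|xr]; first by left.
right; exists (r - nrm x); first by rewrite subr_gt0.
move=> y hy; have := nrm_lb y x => h; have yr : nrm y <= r by lra.
by rewrite subr0; split => //; exact: hH.
Qed.

End Compactness.

(** * Poisson kernels and finite Poisson sums *)

Section Poisson.
Variable R : realType.
Implicit Types (p x y z : R[i]) (u : R[i] -> R).

Lemma prim_root_exists n : (0 < n)%N -> exists z : R[i], n.-primitive_root z.
Proof.
pose p : {poly R[i]} := 'X^n - 1; have [r Dp] := closed_field_poly_normal p.
move=> n_gt0; rewrite (monicP _) ?monicXnsubC // scale1r in Dp.
have rn1 : all n.-unity_root r by apply/allP => z; rewrite -root_prod_XsubC -Dp.
have sz_r : (n < (size r).+1)%N by rewrite -(size_prod_XsubC r id) -Dp size_XnsubC.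
have [|z] := hasP (cyclic.has_prim_root n_gt0 rn1 _ sz_r); last by exists z.
by rewrite -separable.separable_prod_XsubC -Dp cyclotomic.separable_Xn_sub_1 // pnatr_eq0 -lt0n.
Qed.

(** All [(h^j x)^n] equal [x^n], so each term is a finite geometric sum over [1 - x^n], and
    summation over [j] kills every power but the zeroth. The total mass of the discretized Poisson
    kernel is thus known exactly. *)
Lemma sum_inv_unity n (h x : R[i]) : n.-primitive_root h -> nrm x < 1 ->
  \sum_(j < n) (1 - h ^+ j * x)^-1 = n%:R / (1 - x ^+ n).
Proof.
move=> hp x1; have n0 := prim_order_gt0 hp.
have hn : nrm h = 1.
  by apply/eqP; rewrite -(pexpr_eq1 n0 (nrm_ge0 _)) -nrmX (prim_expr_order hp) nrm1.
have neq y : nrm y < 1 -> 1 - y != 0.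
  by move=> y1; rewrite subr_eq0; apply/eqP => e; rewrite -e nrm1 ltxx in y1.
have yn j : nrm (h ^+ j * x) < 1 by rewrite nrmM nrmX hn expr1n mul1r.
have E j : (1 - h ^+ j * x)^-1 = (\sum_(k < n) (h ^+ j * x) ^+ k) / (1 - x ^+ n).
  have -> : x ^+ n = (h ^+ j * x) ^+ n by rewrite exprMn exprAC (prim_expr_order hp) expr1n mul1r.
  have := subrX1 (h ^+ j * x) n; set y := h ^+ j * x => Ey.
  have -> : 1 - y ^+ n = (1 - y) * \sum_(k < n) y ^+ k by rewrite -opprB Ey -mulNr opprB.
  have S0 : \sum_(k < n) y ^+ k != 0.
    apply/eqP => S0; have := Ey; rewrite S0 mulr0 => /eqP; rewrite -oppr_eq0 opprB.
    apply/negP; apply: neq; rewrite nrmX exprn_ilt1 ?nrm_ge0 //; last exact: yn.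
    by rewrite -lt0n.
  by rewrite invfM mulrCA mulfV // mulr1.
under eq_bigr => j _ do rewrite E.
rewrite -mulr_suml exchange_big /=; congr (_ / _).
rewrite (bigD1 (Ordinal n0)) //= [X in _ + X]big1 ?addr0.
  by under eq_bigr => j _ do rewrite expr0; rewrite sumr_const card_ord.
move=> k k0; under eq_bigr => j _ do rewrite exprMn exprAC.
rewrite -mulr_suml; have hk : h ^+ k != 1.
  rewrite -(prim_order_dvd hp) gtnNdvd //.
  by rewrite lt0n; apply: contra k0 => /eqP k0; apply/eqP/val_inj.
have := subrX1 (h ^+ k) n; rewrite exprAC (prim_expr_order hp) expr1n subrr => /esym/eqP.
by rewrite mulf_eq0 subr_eq0 (negbTE hk) /= => /eqP ->; rewrite mul0r.
Qed.

(* The Poisson kernel of a disc, with the boundary point [1 / p]. *)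
Definition pk p z := (1 + p * z) / (1 - p * z).

Lemma Re_pk p z : nrm (p * z) < 1 -> Re (pk p z) = (1 - nrm (p * z) ^+ 2) / nrm (1 - p * z) ^+ 2.
Proof.
rewrite /pk; set y := p * z => y1.
have y0 : 1 - y != 0 by rewrite subr_eq0; apply/eqP => e; rewrite -e nrm1 ltxx in y1.
have n0 : nrm (1 - y) ^+ 2 != 0 by rewrite expf_neq0 // nrm_eq0.
have E : (1 + y) / (1 - y) = ((nrm (1 - y) ^+ 2)^-1)%:C%C * ((1 + y) * conjc (1 - y)).
  apply: (mulIf y0); rewrite divfK // -!mulrA (mulrC _ (1 - y)) mulcJ.
  by rewrite mulrC -mulrA -rmorphM /= divff // mulr1.
rewrite E ReZ mulrC; congr (_ / _).
by rewrite nrm_sqr; case: (y) => a b /=; ring.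
Qed.

Lemma pk_hol p z : nrm (p * z) < 1 -> hol (pk p) z.
Proof.
move=> y1; apply: holM.
  by apply: holD; [exact: hol_cst|apply: holZ; exact: hol_id].
apply: holV; first by apply: holB; [exact: hol_cst|apply: holZ; exact: hol_id].
by rewrite subr_eq0; apply/eqP => e; rewrite -e nrm1 ltxx in y1.
Qed.

(** The lower Harnack bound: [1/3] is [(1 - t) / (1 + t)] at [t = 1/2]. *)
Lemma pk_harnack p z : nrm (p * z) <= 2^-1 -> 3^-1 <= Re (pk p z).
Proof.
move=> h; have h1 : nrm (p * z) < 1 by lra.
rewrite Re_pk //; set t := nrm (p * z) in h h1 *.
have d : nrm (1 - p * z) <= 1 + t by apply: le_trans (nrmB _ _) _; rewrite nrm1.
have d0 : 0 < nrm (1 - p * z).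
  by have := nrm_lb 1 (p * z); rewrite nrm1 -/t; lra.
rewrite ler_pdivlMr ?exprn_gt0 //.
have : nrm (1 - p * z) ^+ 2 <= (1 + t) ^+ 2 by rewrite ler_pXn2r ?nnegrE ?nrm_ge0 // addr_ge0 ?nrm_ge0.
have t0 : 0 <= t by exact: nrm_ge0.
have : 0 <= t * (1/2 - t) by rewrite mulr_ge0 //; lra.
rewrite !expr2; lra.
Qed.

Lemma circle_closed (s : R) : cclosed [set z : R[i] | nrm z = s].
Proof.
move=> z h /=; apply/eqP; rewrite eq_le; apply/andP; split; apply/ler_addgt0Pl => e /h[x /= hx hz].
- have := nrm_lb z x; rewrite (nrmC z x); lra.
- have := nrm_lb x z; lra.
Qed.

Lemma circle_bounded (s : R) : cbounded [set z : R[i] | nrm z = s].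
Proof. by exists s => x /= ->. Qed.

Definition contS (S : set R[i]) u := forall z, S z -> forall e : R, 0 < e -> exists2 r : R, 0 < r &
  forall x, S x -> nrm (x - z) < r -> `|u x - u z| < e.

Lemma contS_bounded S u : cclosed S -> cbounded S -> contS S u ->
  exists2 M : R, 0 <= M & forall x, S x -> `|u x| <= M.
Proof.
move=> hc hb hu; have [[z0 S0]|hN] := pselect (S !=set0); last first.
  by exists 0 => // x Sx; exfalso; apply: hN; exists x.
have [|z Sz hz] := @usc_max R S (fun x => `|u x|) hc hb (ex_intro _ _ S0); last by exists `|u z|.
move=> z Sz e e0; have [r r0 hr] := hu _ Sz _ e0; exists r => // x Sx /(hr _ Sx) h.
have := ler_normD (u x - u z) (u z); rewrite subrK; lra.
Qed.

Lemma contS_uniform S u (e : R) : cclosed S -> cbounded S -> contS S u -> 0 < e ->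
  exists2 d : R, 0 < d & forall x z, S x -> S z -> nrm (x - z) < d -> `|u x - u z| < e.
Proof.
move=> hc hb hu e0; apply: contrapT => hN.
have ex n : exists p : R[i] * R[i], [/\ S p.1, S p.2, nrm (p.1 - p.2) < n.+1%:R^-1 & e <= `|u p.1 - u p.2|].
  apply: contrapT => hn; apply: hN; exists n.+1%:R^-1; first by rewrite invr_gt0 ltr0n.
  move=> x z Sx Sz h; rewrite ltNge; apply/negP => h'; apply: hn; by exists (x, z).
have [f hf] := choice ex.
have Sf n : S (f n).1 by have [] := hf n.
have [l Sl hl] := seq_compact hc hb Sf.
have e2 : 0 < e / 2 by rewrite divr_gt0.
have [r r0 hr] := hu _ Sl _ e2.
have r2 : 0 < r / 2 by rewrite divr_gt0.
have [n0 hn0] := exists_lt_inv r2.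
have [n [/= h1 /hn0 h2]] := ulf_ex (ulfI (hl _ r2) (ulf_ge n0)).
have [_ S2 h3 h4] := hf n.
have a1 : `|u (f n).1 - u l| < e / 2 by apply: hr => //; lra.
have a2 : `|u (f n).2 - u l| < e / 2.
  apply: hr => //; have := nrm_tri (f n).1 (f n).2 l; rewrite (nrmC (f n).2 (f n).1).
  have := lt_trans h3 h2; lra.
have := ler_distD (u l) (u (f n).1) (u (f n).2); rewrite (distrC (u l)); lra.
Qed.

(** Equally spaced kernels with poles on a slightly larger circle form an approximate identity:
    their mean is close to [1] by [sum_inv_unity], and far from its node a kernel is of the order of
    the gap [del] between the circles. The strict bound on [p j] makes the sums holomorphic on the
    closed disc. *)
Lemma poisson_approx u (s eta : R) : 0 < s -> 0 < eta -> contS [set z | nrm z = s] u ->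
  exists n (p x : nat -> R[i]), [/\ (0 < n)%N, forall j, nrm (p j) < s^-1, forall j, nrm (x j) = s &
    forall z, nrm z = s -> `| \sum_(j < n) u (x j) / n%:R * Re (pk (p j) z) - u z | <= eta ].
Proof.
move=> s0 eta0 hu.
have [M M0 hM] := contS_bounded (@circle_closed s) (@circle_bounded s) hu.
have eta4 : 0 < eta / 4 by rewrite divr_gt0.
have [d d0 hd] := contS_uniform (@circle_closed s) (@circle_bounded s) hu eta4.
(* [2 * M] bounds the oscillation of [u], and [32 * s / d^2 * del] bounds a kernel at distance at
   least [d] from its node; [del] will make the product at most [eta / 4]. *)
pose K := 2 * M * 32 * s / d ^+ 2.
have K0 : 0 <= K by rewrite /K divr_ge0 ?exprn_ge0 ?mulr_ge0 // ltW.
pose del := Num.min (Num.min (d / 2) s) (eta / 4 / (K + 1)).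
have del0 : 0 < del by rewrite !min_gt0 // ?divr_gt0 // ltr_wpDl.
have deld : del <= d / 2 by rewrite /del !ge_min lexx.
have dels : del <= s by rewrite /del !ge_min lexx !orbT.
have delK : K * del <= eta / 4.
  have : del * (K + 1) <= eta / 4 by rewrite -ler_pdivlMr ?ltr_wpDl // /del ge_min lexx orbT.
  rewrite mulrDr mulr1 (mulrC del); lra.
clearbody del; pose s' := s + del.
have s'0 : 0 < s' by rewrite /s'; lra.
pose q := s / s'.
have q0 : 0 <= q by rewrite divr_ge0 // ltW.
have q1 : q < 1 by rewrite ltr_pdivrMr // mul1r /s'; lra.
(* The first bound keeps [1 - q^n] away from zero and gives [|T - 1| <= 3 q^n]; the second makes
   this error, multiplied by [M], at most [eta / 4]. *)
pose e1 := Num.min (3^-1) (eta / (12 * (M + 1))).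
have e10 : 0 < e1 by rewrite min_gt0 // ?invr_gt0 // divr_gt0 // mulr_gt0 // ltr_wpDl.
have [n0 hn0] := expr_small q0 q1 e10.
pose n := n0.+1.
have qn : q ^+ n < e1 by apply: hn0; rewrite /n.
have [h hp] := @prim_root_exists n isT.
have hn : nrm h = 1.
  by apply/eqP; rewrite -(@pexpr_eq1 _ _ n) ?nrm_ge0 // -nrmX (prim_expr_order hp) nrm1.
have h0 : h != 0 by rewrite -nrm_gt0 hn.
(* The pole [1 / p j] lies on the circle of radius [s'], radially beyond the node [x j]. *)
exists n, (fun j => h ^+ j / s'%:C%C), (fun j => h ^- j * s%:C%C).
have ps j : nrm (h ^+ j / s'%:C%C) = s'^-1.
  by rewrite nrmf nrmX hn expr1n mul1r nrm_real gtr0_norm.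
have xs j : nrm (h ^- j * s%:C%C) = s.
  by rewrite nrmM nrmV nrmX hn expr1n invr1 mul1r nrm_real gtr0_norm.
split => // [j|z zs]; first by rewrite ps ltf_pV2 // ?posrE // /s'; lra.
have s'C : s'%:C%C != 0 :> R[i] by rewrite -nrm_gt0 nrm_real gtr0_norm.
pose X := z / s'%:C%C.
have Xq : nrm X = q by rewrite nrmf zs nrm_real gtr0_norm.
have yE j : h ^+ j / s'%:C%C * z = h ^+ j * X by rewrite /X; field.
have yn j : nrm (h ^+ j * X) = q by rewrite nrmM nrmX hn expr1n mul1r.
have pk0 j : 0 <= Re (pk (h ^+ j / s'%:C%C) z).
  rewrite Re_pk yE yn // divr_ge0 ?exprn_ge0 ?nrm_ge0 // subr_ge0 exprn_ile1 //; exact: ltW.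
have Xn1 : 1 - X ^+ n != 0.
  rewrite subr_eq0; apply/eqP => e; have : nrm (X ^+ n) < 1 by rewrite nrmX Xq exprn_ilt1.
  by rewrite -e nrm1 ltxx.
pose T := \sum_(j < n) Re (pk (h ^+ j / s'%:C%C) z) / n%:R.
have nn : n%:R != 0 :> R by rewrite pnatr_eq0.
have TE : T = Re ((1 + X ^+ n) / (1 - X ^+ n)).
  rewrite /T -mulr_suml -Re_sum; apply: (mulIf nn); rewrite divfK // mulrC -ReZ; congr (Re _).
  have pkE j : pk (h ^+ j / s'%:C%C) z = 2 * (1 - h ^+ j * X)^-1 - 1.
    rewrite /pk yE; field; rewrite subr_eq0; apply/eqP => e.
    by have := yn j; rewrite -e nrm1 => e1q; rewrite e1q ltxx in q1.
  under eq_bigr => j _ do rewrite pkE.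
  rewrite sumrB -mulr_sumr sum_inv_unity ?Xq // sumr_const card_ord.
  by rewrite -(rmorph_nat (real_complex R)) /= rmorph_nat -[1 *+ n]/(n%:R); field.
have q3 : q ^+ n < 3^-1 by apply: lt_le_trans qn _; rewrite /e1 ge_min lexx.
have qM : q ^+ n * (12 * (M + 1)) <= eta.
  by rewrite -ler_pdivlMr ?mulr_gt0 ?ltr_wpDl //; apply: ltW; apply: lt_le_trans qn _; rewrite /e1 ge_min lexx orbT.
have T1 : `|T - 1| <= 3 * q ^+ n.
  have -> : T - 1 = Re (2 * X ^+ n / (1 - X ^+ n)).
    have -> : 2 * X ^+ n / (1 - X ^+ n) = (1 + X ^+ n) / (1 - X ^+ n) - 1 by field.
    by rewrite TE ReD ReN.
  apply: le_trans (normRe_le _) _; rewrite nrmf nrmM nrmX Xq nrm_nat.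
  have : 1 - q ^+ n <= nrm (1 - X ^+ n) by rewrite -{1}nrm1 -Xq -nrmX nrm_lb.
  move=> hden; rewrite ler_pdivrMr; last by lra.
  have qn0 : 0 <= q ^+ n by rewrite exprn_ge0.
  have := ler_wpM2l qn0 hden; have : 0 <= q ^+ n * (3^-1 - q ^+ n) by rewrite mulr_ge0 //; lra.
  rewrite !mulrBr; lra.
have E : \sum_(j < n) u (h ^- j * s%:C%C) / n%:R * Re (pk (h ^+ j / s'%:C%C) z) - u z =
  \sum_(j < n) (u (h ^- j * s%:C%C) - u z) * (Re (pk (h ^+ j / s'%:C%C) z) / n%:R) + u z * (T - 1).
  rewrite /T mulrBr mulr1 addrA mulr_sumr -big_split /=; congr (_ - _).
  by apply: eq_bigr => j _; field.
rewrite E; apply: le_trans (ler_normD _ _) _.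
have B2 : `|u z * (T - 1)| <= eta / 4.
  rewrite normrM; apply: le_trans (ler_pM (normr_ge0 _) (normr_ge0 _) (hM _ zs) T1) _.
  have : 0 <= q ^+ n by rewrite exprn_ge0.
  move: qM; rewrite mulrDr; have -> : q ^+ n * (12 * M + 12 * 1) = 4 * (M * (3 * q ^+ n)) + 12 * q ^+ n by ring.
  lra.
have B1 : `|\sum_(j < n) (u (h ^- j * s%:C%C) - u z) * (Re (pk (h ^+ j / s'%:C%C) z) / n%:R)| <=
   \sum_(j < n) (eta / 4 * (Re (pk (h ^+ j / s'%:C%C) z) / n%:R) + K * del / n%:R).
  apply: le_trans (ler_norm_sum _ _ _) _; apply: ler_sum => j _.
  have nn0 : 0 <= n%:R^-1 :> R by rewrite invr_ge0 ler0n.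
  have w0 : 0 <= Re (pk (h ^+ j / s'%:C%C) z) / n%:R by rewrite mulr_ge0.
  rewrite normrM (ger0_norm w0).
  have Kd0 : 0 <= K * del / n%:R by rewrite mulr_ge0 // mulr_ge0 // ltW.
  case: (ltP (nrm (h ^- j * s%:C%C - z)) d) => hdj.
    apply: le_trans (_ : eta / 4 * (Re (pk (h ^+ j / s'%:C%C) z) / n%:R) <= _); last by rewrite lerDl.
    by rewrite ler_wpM2r // ltW // hd.
  apply: le_trans (_ : K * del / n%:R <= _); last first.
    by have : 0 <= eta / 4 * (Re (pk (h ^+ j / s'%:C%C) z) / n%:R) by [rewrite mulr_ge0 // ltW]; clear; lra.
  rewrite mulrA ler_wpM2r //.
  have hu2 : `|u (h ^- j * s%:C%C) - u z| <= 2 * M.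
    by apply: le_trans (ler_normB _ _) _; have m1 := hM _ zs; have m2 := hM _ (xs j); clear -m1 m2; lra.
  have hpk : Re (pk (h ^+ j / s'%:C%C) z) <= 32 * s / d ^+ 2 * del.
    rewrite Re_pk yE yn //.
    have dn : d / (2 * s') <= nrm (1 - h ^+ j * X).
      have EX : 1 - h ^+ j * X = h ^+ j / s'%:C%C * (h ^- j * s'%:C%C - z).
        by rewrite /X; field; rewrite s'C expf_neq0.
      rewrite EX nrmM ps ler_pdivrMr ?mulr_gt0 //.
      have -> : s'^-1 * nrm (h ^- j * s'%:C%C - z) * (2 * s') = 2 * nrm (h ^- j * s'%:C%C - z).
        by field; exact: lt0r_neq0.
      have -> : h ^- j * s'%:C%C - z = (h ^- j * s%:C%C - z) + h ^- j * del%:C%C.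
        by rewrite /s' rmorphD /= mulrDr; ring.
      have := nrm_lbD (h ^- j * s%:C%C - z) (h ^- j * del%:C%C).
      rewrite nrmM nrmV nrmX hn expr1n invr1 mul1r nrm_real gtr0_norm //; lra.
    have ds0 : 0 < d / (2 * s') by rewrite divr_gt0 // mulr_gt0.
    rewrite ler_pdivrMr; last by rewrite exprn_gt0 //; apply: lt_le_trans dn.
    have A1 : 1 - q ^+ 2 <= 2 * (del / s').
      have -> : del / s' = 1 - q by rewrite /q /s'; field; rewrite lt0r_neq0.
      have : 0 <= (1 - q) * (1 - q) by exact: sqr_ge0.
      rewrite expr2; clear; lra.
    apply: (le_trans A1).
    have A2 : (d / (2 * s')) ^+ 2 <= nrm (1 - h ^+ j * X) ^+ 2.
      by rewrite ler_pXn2r ?nnegrE ?nrm_ge0 // ltW.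
    have c0 : 0 <= 32 * s / d ^+ 2 * del.
      by rewrite mulr_ge0 ?(ltW del0) // divr_ge0 ?exprn_ge0 ?mulr_ge0 // ltW.
    apply: le_trans _ (ler_wpM2l c0 A2).
    have -> : 32 * s / d ^+ 2 * del * (d / (2 * s')) ^+ 2 = del / s' * (8 * s / s').
      by field; rewrite !lt0r_neq0.
    rewrite mulrC ler_wpM2l ?divr_ge0 ?(ltW del0) ?(ltW s'0) // ler_pdivlMr // /s'; lra.
  have := ler_pM (normr_ge0 _) (pk0 j) hu2 hpk.
  by rewrite /K; have -> : 2 * M * (32 * s / d ^+ 2 * del) = 2 * M * 32 * s / d ^+ 2 * del by ring.
move: B1; rewrite big_split /= -mulr_sumr sumr_const card_ord -[X in eta / 4 * X]/T.
have -> : (K * del / n%:R) *+ n = K * del by rewrite -mulr_natr divfK.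
have T2 : T <= 2 by have := T1; rewrite ler_norml; lra.
have := ler_wpM2l (ltW eta4) T2; lra.
Qed.

End Poisson.

(** * Division of a holomorphic function by [z] *)

Section Factor.
Variable R : realType.
Implicit Types (F G H : R[i] -> R[i]) (z w : R[i]).

Lemma real_derive (f : R -> R) (t d : R) :
  (forall e, 0 < e -> exists2 r : R, 0 < r & forall h, `|h| < r -> `|f (t + h) - f t - d * h| <= e * `|h|) ->
  is_derive t 1 f d.
Proof.
move=> hd.
have key : (fun h : R => h^-1 *: ((f \o shift t) (h *: (1 : R)) - f t)) @ 0^' --> d.
  apply/cvgrPdist_le => e e0.
  have [r r0 h] := hd _ e0.
  rewrite near_withinE; apply/nbhs_ballP; exists r => // s; rewrite /ball /= sub0r normrN => sr s0.
  have n0 : 0 < `|s| by rewrite normr_gt0.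
  rewrite distrC -(ler_pM2r n0) -normrM.
  rewrite -[s *: 1]/(s * 1) mulr1 -[_ *: _]/(s^-1 * _) (addrC s) mulrBl mulrAC mulVf // mul1r.
  exact: h.
by split; [apply/cvg_ex; exists d|apply: cvg_lim key].
Qed.

Lemma derive0_segment (f : R -> R) (r0 : R) : 0 < r0 ->
  (forall t, - r0 < t < 1 + r0 -> forall e, 0 < e -> exists2 r : R, 0 < r &
     forall h, `|h| < r -> `|f (t + h) - f t| <= e * `|h|) -> f 1 = f 0.
Proof.
move=> r00 h.
have hd t : - r0 < t < 1 + r0 -> is_derive t 1 f 0.
  move=> /h ht; apply: real_derive => e /ht[r rp hr]; exists r => // s /hr.
  by rewrite mul0r subr0.
have [||c _] := @MVT_segment R f (fun=> 0) 0 1 ler01.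
- by move=> x; rewrite in_itv /= => hx; apply: hd; lra.
- apply: continuous_in_subspaceT => x; rewrite inE /= in_itv /= => hx.
  have [dx _] : is_derive x 1 f 0 by apply: hd; lra.
  exact/differentiable_continuous/derivable1_diffP.
by rewrite mul0r => /eqP; rewrite subr_eq0 => /eqP.
Qed.

Lemma cd0_cst F (rho : R) : (forall z, nrm z < rho -> cd F z 0) ->
  forall z, nrm z < rho -> F z = F 0.
Proof.
move=> hF z hz.
have key (p : R[i] -> R) : (forall x y, p (x - y) = p x - p y) -> (forall x, `|p x| <= nrm x) ->
    p (F z) = p (F 0).
  (* The margin lets the parameter run slightly past [[0, 1]], so that the derivative along the
     segment is two-sided at both ends. *)
  move=> pB pn; have := @derive0_segment (fun t => p (F (t%:C%C * z))) ((rho - nrm z) / (nrm z + 1)).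
  rewrite mul1r mul0r; apply.
    by rewrite divr_gt0 ?subr_gt0 // ltr_wpDl ?nrm_ge0.
  move=> t ht e e0.
  have n1 : 0 < nrm z + 1 by rewrite ltr_wpDl ?nrm_ge0.
  have tz : nrm (t%:C%C * z) < rho.
    rewrite nrmM nrm_real; set q := (rho - nrm z) / (nrm z + 1) in ht.
    have q0 : 0 < q by rewrite divr_gt0 ?subr_gt0.
    have qE : q * (nrm z + 1) = rho - nrm z by rewrite /q divfK // lt0r_neq0.
    have : `|t| <= 1 + q by rewrite ler_norml; lra.
    move=> tq; apply: le_lt_trans (ler_wpM2r (nrm_ge0 z) tq) _.
    rewrite mulrDl mul1r; lra.
  have [r rp hr] := hF _ tz _ (divr_gt0 e0 n1).
  exists (r / (nrm z + 1)); first exact: divr_gt0.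
  move=> s; rewrite ltr_pdivlMr // => hs.
  have sz : nrm (s%:C%C * z) <= `|s| * (nrm z + 1).
    by rewrite nrmM nrm_real ler_wpM2l // lerDl.
  have := hr _ (le_lt_trans sz hs); rewrite mul0r subr0 -mulrDl -rmorphD /= => h.
  rewrite -pB; apply: le_trans (pn _) _; apply: (le_trans h).
  have := ler_wpM2l (ltW (divr_gt0 e0 n1)) sz.
  by rewrite [leRHS](_ : _ = e * `|s|) //; field; exact: lt0r_neq0.
apply: complex_eq; apply: key => [x y|x]; rewrite ?ReD ?ReN ?ImD ?ImN //.
- exact: normRe_le.
- exact: normIm_le.
Qed.

(** [Re (d * c)] vanishes for every unit direction [c]; the directions [1] and [i] give both parts
    of the derivative. *)
Lemma hol_Re0_cst F (rho : R) : (forall z, nrm z < rho -> hol F z) ->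
  (forall z, nrm z < rho -> Re (F z) = 0) -> forall z, nrm z < rho -> F z = F 0.
Proof.
move=> hF hR; apply: cd0_cst => z hz.
have [d hd] := hF _ hz; suff -> : 0 = d by [].
have key (c : R[i]) : nrm c = 1 -> Re (d * c) = 0.
  move=> c1; apply/eqP; rewrite -normr_le0; apply/ler_addgt0Pl => e e0; rewrite addr0.
  have [r r0 hr] := hd _ e0.
  pose t := Num.min r (rho - nrm z) / 2.
  have t0 : 0 < t by rewrite divr_gt0 ?min_gt0 ?subr_gt0.
  have tm : 2 * t <= r /\ 2 * t <= rho - nrm z.
    have -> : 2 * t = Num.min r (rho - nrm z) by rewrite /t; field.
    by rewrite !ge_min !lexx !orbT.
  have tc : nrm (t%:C%C * c) = t by rewrite nrmM c1 mulr1 nrm_real gtr0_norm.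
  have hr' := hr (t%:C%C * c); rewrite tc in hr'.
  have {}hr' := hr' ltac:(lra).
  have zt : nrm (z + t%:C%C * c) < rho by apply: le_lt_trans (nrmD _ _) _; rewrite tc; lra.
  rewrite -(ler_pM2r t0); apply: le_trans hr'; apply: le_trans (normRe_le _).
  rewrite !(ReD, ReN) (hR _ hz) (hR _ zt) subrr sub0r normrN.
  have -> : d * (t%:C%C * c) = t%:C%C * (d * c) by ring.
  by rewrite ReZ normrM (gtr0_norm t0) mulrC.
have h1 := key 1 (nrm1 R); have h2 := key ('i)%C (nrm_i R).
rewrite mulr1 in h1; move: h2; rewrite ReM /= mulr0 mulr1 sub0r => /eqP; rewrite oppr_eq0 => /eqP h2.
by apply: complex_eq.
Qed.

(* The holomorphic functions [A_n + z B_n z] built from the Poisson sums of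
   [Re H] have real parts converging to [Re H]; any limit point of them is
   visibly of the form [A + z B z], and it differs from [H] by a constant. *)
Lemma hol_factor0 H (rho : R) : 0 < rho -> (forall z, nrm z < rho -> hol H z) ->
  exists Q, (forall z, nrm z < rho -> hol Q z) /\ forall z, H z = H 0 + z * Q z.
Proof.
move=> rho0 hH; pose s := rho / 2; have s0 : 0 < s by rewrite divr_gt0.
have hHs z : nrm z <= s -> hol H z by move=> h; apply: hH; rewrite /s in h; lra.
have hu : contS [set z | nrm z = s] (fun z => Re (H z)).
  move=> z /= zs e e0; have [r r0 hr] := hol_cont (hHs z ltac:(by rewrite zs)) e0.
  exists r => // x _ /hr; rewrite subrKC; apply: le_lt_trans; rewrite -ReN -ReD; exact: normRe_le.
have [M M0 hM] := contS_bounded (@circle_closed R s) (@circle_bounded R s) hu.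
have inv0 (n : nat) : 0 < n.+1%:R^-1 :> R by rewrite invr_gt0 ltr0n.
have ex n : exists T : nat * ((nat -> R[i]) * (nat -> R[i])),
   [/\ (0 < T.1)%N, forall j, nrm (T.2.1 j) < s^-1, forall j, nrm (T.2.2 j) = s &
    forall z, nrm z = s -> `| \sum_(j < T.1) Re (H (T.2.2 j)) / T.1%:R * Re (pk (T.2.1 j) z) - Re (H z) | <= n.+1%:R^-1 ].
  by have [N [p [x h]]] := poisson_approx s0 (inv0 n) hu; exists (N, (p, x)).
have [T hT] := choice ex.
(* Since [pk p z = 1 + z * (2 * p / (1 - p * z))], the Poisson sum with these weights splits as
   [A n + z * B n z]; [B' n] is the derivative of [B n]. *)
pose c n (j : nat) : R := Re (H ((T n).2.2 j)) / (T n).1%:R.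
pose p n := (T n).2.1.
pose A n : R[i] := \sum_(j < (T n).1) (c n j)%:C%C.
pose B n z : R[i] := \sum_(j < (T n).1) (c n j)%:C%C * (2 * p n j / (1 - p n j * z)).
pose B' n z : R[i] := \sum_(j < (T n).1) (c n j)%:C%C * (2 * p n j ^+ 2 / (1 - p n j * z) ^+ 2).
have pn n j : nrm (p n j) < s^-1 by have [_ + _ _] := hT n; apply.
have sum_le n (f : nat -> R[i]) (L : R) : (forall j, nrm (f j) <= L) ->
    nrm (\sum_(j < (T n).1) (c n j)%:C%C * f j) <= M * L.
  move=> hf; have [N0 _ xs _] := hT n.
  apply: le_trans (nrm_sum _ _ _) _.
  apply: le_trans (_ : \sum_(j < (T n).1) (M / (T n).1%:R * L) <= _).
    apply: ler_sum => j _; rewrite nrmM nrm_real; apply: ler_pM; rewrite ?nrm_ge0 // normrM.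
    by rewrite (@ger0_norm _ _^-1) ?invr_ge0 // ler_wpM2r ?invr_ge0 //; apply: hM; exact: xs.
  rewrite sumr_const card_ord -mulr_natl.
  have N1 : (T n).1%:R != 0 :> R by rewrite pnatr_eq0 -lt0n.
  by rewrite le_eqVlt; apply/orP; left; apply/eqP; field.
have pz n j z : nrm z <= s / 2 -> nrm (p n j * z) <= 2^-1.
  move=> hz; rewrite nrmM.
  have -> : 2^-1 = s^-1 * (s / 2) by field; exact: lt0r_neq0.
  by apply: ler_pM; rewrite ?nrm_ge0 // ltW.
have den n j z : nrm z <= s / 2 -> 2^-1 <= nrm (1 - p n j * z).
  by move=> /(pz n j) h; have := nrm_lb 1 (p n j * z); rewrite nrm1; lra.
have den0 n j z : nrm z <= s / 2 -> 1 - p n j * z != 0.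
  by move=> /(den n j) h; rewrite -nrm_gt0; lra.
have An n : nrm (A n) <= M.
  rewrite /A; have := sum_le n (fun=> 1) 1 (fun=> ltac:(by rewrite nrm1)).
  by under eq_bigr => j _ do rewrite mulr1; rewrite mulr1.
have invden n j z : nrm z <= s / 2 -> (nrm (1 - p n j * z))^-1 <= 2.
  move=> hz; rewrite -[2]invrK lef_pV2 ?posrE ?invr_gt0 //; first exact: den.
  by apply: lt_le_trans (den n j _ hz); rewrite invr_gt0.
have Bn n z : nrm z <= s / 2 -> nrm (B n z) <= M * (4 / s).
  move=> hz; apply: (sum_le n (fun j => 2 * p n j / (1 - p n j * z))) => j.
  rewrite nrmf nrmM nrm_nat.
  have -> : 4 / s = 2 * s^-1 * 2 by field; exact: lt0r_neq0.
  apply: ler_pM; rewrite ?invr_ge0 ?mulr_ge0 ?nrm_ge0 ?invden //.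
  by rewrite ler_pM2l // ltW.
have B'n n z : nrm z <= s / 2 -> nrm (B' n z) <= M * (8 / s ^+ 2).
  move=> hz; apply: (sum_le n (fun j => 2 * p n j ^+ 2 / (1 - p n j * z) ^+ 2)) => j.
  rewrite nrmf nrmM nrm_nat !nrmX.
  have -> : 8 / s ^+ 2 = 2 * s^-1 ^+ 2 * (2 ^+ 2) by field; exact: lt0r_neq0.
  rewrite -exprVn; apply: ler_pM; rewrite ?exprn_ge0 ?invr_ge0 ?mulr_ge0 ?exprn_ge0 ?nrm_ge0 //.
    by rewrite ler_pM2l // ler_pXn2r ?nnegrE ?nrm_ge0 ?invr_ge0 // ltW.
  by rewrite ler_pXn2r ?nnegrE ?invr_ge0 ?nrm_ge0 // invden.
(* A second order bound uniform in [n] survives the limit and makes [b] differentiable. *)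
have B2 n z w : nrm z <= s / 2 -> nrm (z + w) <= s / 2 ->
    nrm (B n (z + w) - B n z - B' n z * w) <= M * (16 / s ^+ 3 * nrm w ^+ 2).
  move=> hz hzw.
  have -> : B n (z + w) - B n z - B' n z * w =
     \sum_(j < (T n).1) (c n j)%:C%C * (2 * p n j ^+ 3 * w ^+ 2 / ((1 - p n j * z) ^+ 2 * (1 - p n j * (z + w)))).
    rewrite /B /B' mulr_suml -!sumrB; apply: eq_bigr => j _.
    by field; rewrite (den0 n j _ hz) (den0 n j _ hzw).
  apply: (sum_le n (fun j => 2 * p n j ^+ 3 * w ^+ 2 / ((1 - p n j * z) ^+ 2 * (1 - p n j * (z + w))))) => j.
  rewrite nrmf (nrmM _ (w ^+ 2)) (nrmM 2) (nrmM (_ ^+ 2)) !nrmX nrm_nat invfM -exprVn.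
  have -> : 16 / s ^+ 3 * nrm w ^+ 2 = 2 * s^-1 ^+ 3 * nrm w ^+ 2 * (2 ^+ 2 * 2) by field; exact: lt0r_neq0.
  apply: ler_pM; rewrite ?mulr_ge0 ?exprn_ge0 ?invr_ge0 ?nrm_ge0 //.
    rewrite ler_wpM2r ?exprn_ge0 ?nrm_ge0 // ler_pM2l //.
    by rewrite ler_pXn2r ?nnegrE ?nrm_ge0 ?invr_ge0 // ltW.
  apply: ler_pM; rewrite ?exprn_ge0 ?invr_ge0 ?nrm_ge0 ?invden //.
  by rewrite ler_pXn2r ?nnegrE ?invr_ge0 ?nrm_ge0 // invden.
have [a ha] := ucv_ex An.
have exb z : exists b, nrm z <= s / 2 -> ucv (fun n => B n z) b.
  have [hz|hz] := boolP (nrm z <= s / 2); last by exists 0.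
  by have [b hb] := ucv_ex (fun n => Bn n z hz); exists b.
have exb' z : exists b, nrm z <= s / 2 -> ucv (fun n => B' n z) b.
  have [hz|hz] := boolP (nrm z <= s / 2); last by exists 0.
  by have [b hb] := ucv_ex (fun n => B'n n z hz); exists b.
have [b hb] := choice exb; have [b' hb'] := choice exb'.
have bhol z : nrm z < s / 2 -> hol b z.
  move=> hz; exists (b' z) => e e0; pose L := M * (16 / s ^+ 3) + 1.
  have L0 : 0 < L by rewrite ltr_wpDl // mulr_ge0 // divr_ge0 ?exprn_ge0 // ltW.
  exists (Num.min (s / 2 - nrm z) (e / L)); first by rewrite min_gt0 ?subr_gt0 ?divr_gt0.
  move=> w; rewrite lt_min ltr_pdivlMr // => /andP[w1 w2].
  have hzw : nrm (z + w) <= s / 2 by apply: le_trans (nrmD _ _) _; lra.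
  have lim := ucvB (ucvB (hb _ hzw) (hb _ (ltW hz))) (ucvZ w (hb' _ (ltW hz))).
  rewrite (mulrC (b' z)); apply: (ucv_le lim); apply: ulfT => n /=.
  rewrite (mulrC w); apply: le_trans (B2 n z w (ltW hz) hzw) _.
  have : nrm w * L <= e by exact: ltW.
  move=> /(ler_wpM2r (nrm_ge0 w)); apply: le_trans.
  have -> : nrm w * L * nrm w = M * (16 / s ^+ 3 * nrm w ^+ 2) + nrm w ^+ 2 by rewrite /L; ring.
  by rewrite lerDl exprn_ge0 ?nrm_ge0.
pose Hn n z : R[i] := \sum_(j < (T n).1) (c n j)%:C%C * pk (p n j) z.
have pz1 n j z : nrm z <= s -> nrm (p n j * z) < 1.
  move=> hz; have [->|z0] := eqVneq z 0; first by rewrite mulr0 nrm0.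
  rewrite nrmM; have n0 : 0 < nrm z by rewrite nrm_gt0.
  have := pn n j; rewrite -(ltr_pM2r n0) => h; apply: lt_le_trans h _.
  by rewrite mulrC ler_pdivrMr // mul1r.
have Hnhol n z : nrm z <= s -> hol (Hn n) z.
  by move=> hz; apply: hol_sum => j; apply: holZ; apply: pk_hol; exact: pz1.
have HnE n z : nrm z <= s / 2 -> Hn n z = A n + z * B n z.
  move=> hz; rewrite /Hn /A /B mulr_sumr -big_split; apply: eq_bigr => j _ /=.
  by rewrite /pk; field; exact: den0.
(* Comparison carries the boundary error of the Poisson sum into the disc; the two signs give both
   one-sided bounds. *)
have cmp n (k : R[i]) : (k = 1 \/ k = -1) -> forall z, nrm z <= s -> Re (k * (Hn n z - H z)) <= n.+1%:R^-1.
  move=> hk z hz.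
  have kreal (x : R[i]) : `|Re (k * x)| = `|Re x| by case: hk => ->; rewrite ?mul1r ?mulN1r ?ReN ?normrN.
  apply: (@comparison R [set z | nrm (z - 0) <= s] (fun z => Re (k * (Hn n z - H z)))) => /=; last by rewrite subr0.
  - exact: cclosed_disc.
  - exact: cbounded_disc.
  - apply: cont_usc => x /=; rewrite subr0 => hx e e0.
    have [r r0 hr] := hol_cont (holB (Hnhol n _ hx) (hHs _ hx)) e0.
    exists r => // w /hr; apply: le_lt_trans; rewrite -ReN -ReD -mulrBr kreal; exact: normRe_le.
  move=> x; rewrite subr0 le_eqVlt => /orP[/eqP hx|hx].
    left; apply: le_trans (ler_norm _) _; rewrite kreal ReD ReN.
    have [_ _ _ /(_ x hx)] := hT n; apply: le_trans.
    by rewrite /Hn Re_sum; under [X in `|X - _| <= _]eq_bigr => j _ do rewrite ReZ.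
  right; have sx : 0 < s - nrm x by rewrite subr_gt0.
  have near y : nrm (y - x) < s - nrm x -> nrm y <= s by have := nrm_lb y x; lra.
  split; first by exists (s - nrm x) => // y /near; rewrite subr0.
  apply: (sub_Re sx) => y /near hy; apply: holZ; apply: holB; [exact: Hnhol|exact: hHs].
pose F z := H z - (a + z * b z).
have Fhol z : nrm z < s / 2 -> hol F z.
  move=> hz; apply: holB; first by apply: hHs; lra.
  by apply: holD; [exact: hol_cst|apply: holM; [exact: hol_id|exact: bhol]].
have F0 z : nrm z < s / 2 -> Re (F z) = 0.
  move=> hz; have hz' := ltW hz.
  have lim (k : R[i]) : ucv (fun n => k * (A n + z * B n z - H z)) (k * - F z).
    apply: ucvZ; have -> : - F z = (a + z * b z) - H z by rewrite /F opprB.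
    by apply: ucvB; [apply: ucvD => //; apply: ucvZ; exact: hb|exact: ucv_cst].
  have le0 (k : R[i]) : (k = 1 \/ k = -1) -> Re (k * - F z) <= 0.
    move=> hk; apply/ler_addgt0Pl => e e0; rewrite addr0; apply: (ucv_Re_le (lim k)).
    have [n0 hn0] := exists_lt_inv e0; apply: ulfS (ulf_ge n0) => n /= /hn0 h.
    by rewrite -HnE //; apply: le_trans (ltW h); apply: cmp => //; lra.
  have := le0 1 (or_introl erefl); have := le0 (-1) (or_intror erefl).
  by rewrite mul1r mulN1r !ReN opprK => h1 h2; apply/eqP; rewrite eq_le h1 -oppr_le0 h2.
have FE z : nrm z < s / 2 -> H z = H 0 + z * b z.
  move=> hz; have := hol_Re0_cst Fhol F0 hz; rewrite /F mul0r addr0 => h.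
  by rewrite -[LHS](subrK (a + z * b z)) h; ring.
(* [b] serves only near [0]; the explicit quotient continues it, and [FE] shows that the two agree
   where both make sense. *)
pose Q z := if nrm z < s / 2 then b z else (H z - H 0) / z.
have s2 : 0 < s / 2 by rewrite divr_gt0.
have QE z : z != 0 -> Q z = (H z - H 0) / z.
  by move=> z0; rewrite /Q; case: ifP => // /FE ->; field.
exists Q; split; last first.
  move=> z; have [->|z0] := eqVneq z 0; first by rewrite mul0r addr0.
  by rewrite QE //; field.
move=> z hz; have [hz2|hz2] := ltP (nrm z) (s / 2).
  apply: (@hol_local R b _ _ (s / 2 - nrm z)); rewrite ?subr_gt0 //; last exact: bhol.
  by move=> x hx; rewrite /Q ifT //; have := nrm_lb x z; lra.
have n0 : 0 < nrm z by exact: lt_le_trans hz2.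
apply: (@hol_local R (fun x => (H x - H 0) * x^-1) _ _ _ n0).
  move=> x hx; rewrite QE //; apply/eqP => x0.
  by rewrite x0 sub0r nrmN ltxx in hx.
apply: holM; first by apply: holB; [exact: hH|exact: hol_cst].
by apply: holV; [exact: hol_id|rewrite -nrm_gt0].
Qed.

End Factor.

(** * Orders of vanishing, Taylor estimates, local inverses, linearization *)

Section LocalTheory.
Variable R : realType.
Implicit Types (F G H f : R[i] -> R[i]) (z w x y : R[i]).

Lemma hol_bounded H (rho : R) : (forall z, nrm z <= rho -> hol H z) ->
  exists2 M : R, 0 <= M & forall z, nrm z <= rho -> nrm (H z) <= M.
Proof.
move=> hH; have [|M M0 hM] := @contS_bounded R [set z | nrm (z - 0) <= rho] (fun z => nrm (H z))
  (@cclosed_disc R 0 rho) (@cbounded_disc R 0 rho).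
  move=> z /=; rewrite subr0 => /hH/hol_cont hz e /hz[r r0 hr]; exists r => // x _ /hr.
  rewrite subrKC; apply: le_lt_trans; rewrite ler_norml.
  by have := nrm_lb (H x) (H z); have := nrm_lb (H z) (H x); rewrite (nrmC (H z)); lra.
exists M => // z hz; apply: le_trans (ler_norm _) (hM _ _) => /=; by rewrite subr0.
Qed.

(** If every successive quotient vanished at [0], then [z^n] would divide [H] for all [n], and the
    maximum principle on a disc of radius [t > nrm z] would bound [nrm (H z)] by
    [M (nrm z / t)^n]. *)
Lemma hol_order H (rho : R) : 0 < rho -> (forall z, nrm z < rho -> hol H z) ->
  (forall z, nrm z < rho -> H z = 0) \/
  exists k Q, [/\ forall z, nrm z < rho -> hol Q z, Q 0 != 0 & forall z, H z = z ^+ k * Q z].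
Proof.
move=> rho0 hH; have [|hN] := pselect (exists k Q, [/\ forall z, nrm z < rho -> hol Q z, Q 0 != 0 & forall z, H z = z ^+ k * Q z]); first by right.
left=> z hz.
have fac n : exists Q, (forall z, nrm z < rho -> hol Q z) /\ forall z, H z = z ^+ n * Q z.
  elim: n => [|n [Q [hQ QE]]]; first by exists H; split => // x; rewrite expr0 mul1r.
  have [Q1 [hQ1 Q1E]] := hol_factor0 rho0 hQ.
  exists Q1; split => // x; rewrite QE.
  have [Q0|Q0] := eqVneq (Q 0) 0; first by rewrite Q1E Q0 add0r mulrA exprSr.
  by exfalso; apply: hN; exists n, Q.
pose t := (nrm z + rho) / 2.
have zt : nrm z < t by rewrite /t; lra.
have t0 : 0 < t by apply: le_lt_trans (nrm_ge0 _) zt.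
have tr : t < rho by rewrite /t; lra.
clearbody t.
have [M M0 hM] := @hol_bounded H t (fun x hx => hH x (le_lt_trans hx tr)).
have q0 : 0 <= nrm z / t by rewrite divr_ge0 ?nrm_ge0 // ltW.
have q1 : nrm z / t < 1 by rewrite ltr_pdivrMr // mul1r.
apply/eqP; rewrite -nrm_le0; apply/ler_addgt0Pl => e e0; rewrite addr0.
have M1 : 0 < M + 1 by rewrite ltr_wpDl.
have [n0 /(_ n0 (leqnn _)) hn] := expr_small q0 q1 (divr_gt0 e0 M1).
have [Q [hQ QE]] := fac n0.
have tn : 0 < t ^+ n0 by rewrite exprn_gt0.
have hQz : nrm (Q z) <= M / t ^+ n0.
  apply: (@max_disc R Q t) => [x hx|x xt|]; last exact: ltW.
    by apply: hQ; apply: le_lt_trans tr.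
  by rewrite ler_pdivlMr // mulrC -{1}xt -nrmX -nrmM -QE hM // xt.
rewrite QE nrmM nrmX; apply: le_trans (ler_wpM2l (exprn_ge0 _ (nrm_ge0 _)) hQz) _.
have -> : nrm z ^+ n0 * (M / t ^+ n0) = M * (nrm z / t) ^+ n0 by rewrite expr_div_n mulrCA.
apply: le_trans (_ : (M + 1) * (nrm z / t) ^+ n0 <= _).
  by rewrite ler_wpM2r ?exprn_ge0 // lerDl.
by rewrite mulrC -ler_pdivlMr // ltW.
Qed.

(** Cauchy estimates by dividing twice: on the circle of radius [rho / 2] each division turns a
    bound [B] into [2 B / (rho / 2)], whence [4 M / rho] and [16 M / rho^2]. *)
Lemma hol_second H z0 (rho M : R) : 0 < rho -> (forall z, nrm (z - z0) < rho -> hol H z) ->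
  (forall z, nrm (z - z0) < rho -> nrm (H z) <= M) ->
  exists d, nrm d <= 4 * M / rho /\ forall w, nrm w <= rho / 2 ->
    nrm (H (z0 + w) - H z0) <= 4 * M / rho * nrm w /\
    nrm (H (z0 + w) - H z0 - d * w) <= 16 * M / rho ^+ 2 * nrm w ^+ 2.
Proof.
move=> rho0 hH hM.
have M0 : 0 <= M by apply: le_trans (nrm_ge0 _) (hM z0 _); rewrite subrr nrm0.
have r2 : 0 < rho / 2 by rewrite divr_gt0.
have zw w : z0 + w - z0 = w by ring.
have shol (G : R[i] -> R[i]) : (forall z, nrm (z - z0) < rho -> hol G z) -> forall w, nrm w < rho -> hol (fun w => G (z0 + w)) w.
  move=> hG w hw; apply: (@hol_comp R (fun w => z0 + w) G).
    by apply: holD; [exact: hol_cst|exact: hol_id].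
  by apply: hG; rewrite zw.
have [Q [hQ QE]] := hol_factor0 rho0 (shol _ hH).
rewrite /= addr0 in QE.
have bQ w : nrm w <= rho / 2 -> nrm (Q w) <= 4 * M / rho.
  apply: (@max_disc R Q) => [x hx|x xt]; first by apply: hQ; lra.
  rewrite -(ler_pM2l r2) -{1}xt -nrmM.
  have -> : x * Q x = H (z0 + x) - H z0 by rewrite QE; ring.
  have -> : rho / 2 * (4 * M / rho) = M + M by field; exact: lt0r_neq0.
  by apply: le_trans (nrmB _ _) _; apply: lerD; apply: hM; rewrite ?zw ?subrr ?nrm0 // xt; lra.
have [Q2 [hQ2 Q2E]] := hol_factor0 rho0 hQ.
have bQ2 w : nrm w <= rho / 2 -> nrm (Q2 w) <= 16 * M / rho ^+ 2.
  apply: (@max_disc R Q2) => [x hx|x xt]; first by apply: hQ2; lra.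
  rewrite -(ler_pM2l r2) -{1}xt -nrmM.
  have -> : x * Q2 x = Q x - Q 0 by rewrite Q2E; ring.
  have -> : rho / 2 * (16 * M / rho ^+ 2) = 4 * M / rho + 4 * M / rho by field; exact: lt0r_neq0.
  by apply: le_trans (nrmB _ _) _; apply: lerD; apply: bQ; rewrite ?nrm0 ?xt // ltW.
exists (Q 0); split; first by apply: bQ; rewrite nrm0 ltW.
move=> w hw; rewrite QE; split.
  have -> : H z0 + w * Q w - H z0 = Q w * w by ring.
  by rewrite nrmM ler_wpM2r ?nrm_ge0 ?bQ.
rewrite Q2E; have -> : H z0 + w * (Q 0 + w * Q2 w) - H z0 - Q 0 * w = Q2 w * w ^+ 2 by ring.
by rewrite nrmM nrmX ler_wpM2r ?exprn_ge0 ?nrm_ge0 ?bQ2.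
Qed.

Lemma second_cd H z d (C r : R) : 0 <= C -> 0 < r ->
  (forall w, nrm w <= r -> nrm (H (z + w) - H z - d * w) <= C * nrm w ^+ 2) -> cd H z d.
Proof.
move=> C0 r0 h e e0; have C1 : 0 < C + 1 by rewrite ltr_wpDl.
exists (Num.min r (e / (C + 1))); first by rewrite min_gt0 ?divr_gt0.
move=> w; rewrite lt_min ltr_pdivlMr // => /andP[/ltW/h hw w2].
apply: (le_trans hw); rewrite expr2 mulrA ler_wpM2r ?nrm_ge0 //.
have := nrm_ge0 w; have : 0 <= nrm w * C by rewrite mulr_ge0 ?nrm_ge0.
rewrite mulrDr mulr1 in w2; rewrite mulrC; lra.
Qed.

(** With [f z = f 0 + lam z + z^2 P z] the error is [(x - y)(x + y) P x + y^2 (P x - P y)]. The last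
    difference is bounded by a Lipschitz estimate when [x] and [y] are close, and by [2 M]
    otherwise. *)
Lemma hol_C2 f (rho : R) lam : 0 < rho -> (forall z, nrm z < rho -> hol f z) -> cd f 0 lam ->
  exists C r : R, [/\ 0 < C, 0 < r, r < rho & forall x y, nrm x <= r -> nrm y <= r ->
    nrm (f x - f y - lam * (x - y)) <= C * (nrm x + nrm y) * nrm (x - y)].
Proof.
move=> rho0 hf hd.
have [Q [hQ QE]] := hol_factor0 rho0 hf.
have [P [hP PE]] := hol_factor0 rho0 hQ.
have h2 : rho / 2 < rho by lra.
have [M M0 hM] := @hol_bounded P (rho / 2) (fun x hx => hP x (le_lt_trans hx h2)).
have r8 : 0 < rho / 8 by rewrite divr_gt0.
have Q0 : Q 0 = lam.
  apply: cd_unique hd; apply: (@second_cd f 0 (Q 0) M (rho / 2)) => //; first by rewrite divr_gt0.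
  move=> w hw; rewrite add0r QE PE.
  have -> : f 0 + w * (Q 0 + w * P w) - f 0 - Q 0 * w = P w * w ^+ 2 by ring.
  by rewrite nrmM nrmX ler_wpM2r ?exprn_ge0 ?nrm_ge0 ?hM.
exists (M + 8 * M + 1), (rho / 8); split => //; [lra|lra|].
move=> x y hx hy.
have [d [_ hdy]] := @hol_second P y (rho / 4) M ltac:(lra)
  (fun z hz => hP z ltac:(have := nrm_lb z y; lra)) (fun z hz => hM z ltac:(have := nrm_lb z y; lra)).
have xy : nrm (x - y) <= rho / 4 / 2 \/ rho / 8 < nrm (x - y) by have [|] := leP (nrm (x - y)) (rho / 8); [left; lra|right].
have n0 := nrm_ge0 x; have n1 := nrm_ge0 y; have nd := nrm_ge0 (x - y).
have Pxy : nrm (x - y) <= nrm x + nrm y by exact: nrmB.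
have PL : nrm y ^+ 2 * nrm (P x - P y) <= 8 * M * nrm y * nrm (x - y).
  case: xy => hxy.
    have [h1 _] := hdy _ hxy; rewrite subrKC in h1.
    apply: le_trans (ler_wpM2l (exprn_ge0 _ n1) h1) _.
    have -> : nrm y ^+ 2 * (4 * M / (rho / 4) * nrm (x - y)) = 8 * M * nrm y * nrm (x - y) * (2 * nrm y / rho).
      by field; exact: lt0r_neq0.
    rewrite -[leRHS]mulr1 ler_wpM2l ?mulr_ge0 // ler_pdivrMr // mul1r; lra.
  have : nrm (P x - P y) <= 2 * M.
    by apply: le_trans (nrmB _ _) _; have := hM x ltac:(lra); have := hM y ltac:(lra); lra.
  move=> h; apply: le_trans (ler_wpM2l (exprn_ge0 _ n1) h) _.
  have : nrm y * M * nrm y <= nrm y * M * nrm (x - y) by rewrite ler_wpM2l ?mulr_ge0 //; lra.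
  have : 0 <= nrm y * M * nrm (x - y) by rewrite !mulr_ge0.
  rewrite expr2; lra.
have -> : f x - f y - lam * (x - y) = (x - y) * (x + y) * P x + y ^+ 2 * (P x - P y).
  by rewrite (QE x) (QE y) (PE x) (PE y) Q0; ring.
apply: le_trans (nrmD _ _) _; rewrite !(nrmM, nrmX).
have hxy2 : nrm (x - y) * nrm (x + y) * nrm (P x) <= nrm (x - y) * (nrm x + nrm y) * M.
  apply: ler_pM; rewrite ?mulr_ge0 ?nrm_ge0 //; last by apply: hM; lra.
  by rewrite ler_wpM2l ?nrmD.
have : 8 * M * nrm y * nrm (x - y) <= 8 * M * (nrm x + nrm y) * nrm (x - y).
  by rewrite ler_wpM2r // ler_wpM2l ?mulr_ge0 // lerDr.
have : 0 <= (nrm x + nrm y) * nrm (x - y) by rewrite mulr_ge0 // addr_ge0.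
have -> : (M + 8 * M + 1) * (nrm x + nrm y) * nrm (x - y) =
  nrm (x - y) * (nrm x + nrm y) * M + 8 * M * (nrm x + nrm y) * nrm (x - y) + (nrm x + nrm y) * nrm (x - y) by ring.
lra.
Qed.

(** A solution of [f x = y] is found as a minimum of [nrm (f x - y)] on a closed disc. The lower
    Lipschitz bound keeps it off the boundary, and at an interior point with nonzero residue a
    damped Newton step would decrease it. *)
Lemma local_inverse f (rho : R) lam : 0 < rho -> (forall z, nrm z < rho -> hol f z) ->
  f 0 = 0 -> cd f 0 lam -> lam != 0 ->
  exists r r' G, [/\ 0 < r, 0 < r', r < rho,
    forall x y, nrm x <= r -> nrm y <= r -> nrm (f x - f y - lam * (x - y)) <= nrm lam / 4 * nrm (x - y) &
    [/\ forall y, nrm y < r' -> nrm (G y) < r, forall y, nrm y < r' -> f (G y) = y,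
        forall y, nrm y < r' -> hol G y & forall x, nrm x <= r -> nrm (f x) < r' -> G (f x) = x]].
Proof.
move=> rho0 hf f0 hd lam0.
have L0 : 0 < nrm lam by rewrite nrm_gt0.
have [C [r1 [C0 r10 r1rho hC]]] := hol_C2 rho0 hf hd.
pose r := Num.min r1 (nrm lam / (8 * C)).
have r0 : 0 < r by rewrite min_gt0 // divr_gt0 // mulr_gt0.
have rr1 : r <= r1 by rewrite /r ge_min lexx.
have rC : r * (8 * C) <= nrm lam by rewrite -ler_pdivlMr ?mulr_gt0 // /r ge_min lexx orbT.
have near x y : nrm x <= r -> nrm y <= r -> nrm (f x - f y - lam * (x - y)) <= nrm lam / 4 * nrm (x - y).
  move=> hx hy; apply: le_trans (hC _ _ (le_trans hx rr1) (le_trans hy rr1)) _.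
  rewrite ler_wpM2r ?nrm_ge0 //.
  have := ler_wpM2l (ltW C0) hx; have := ler_wpM2l (ltW C0) hy.
  rewrite mulrDr; rewrite mulrCA in rC; lra.
have lip x y : nrm x <= r -> nrm y <= r -> nrm (x - y) * (3 / 4 * nrm lam) <= nrm (f x - f y).
  move=> hx hy; have := near _ _ hx hy; have := nrm_lb (lam * (x - y)) (- (f x - f y - lam * (x - y))).
  rewrite nrmN opprK nrmM; have -> : lam * (x - y) + (f x - f y - lam * (x - y)) = f x - f y by ring.
  lra.
pose r' := nrm lam * r / 4.
have r'0 : 0 < r' by rewrite divr_gt0 ?mulr_gt0.
have ex y : exists x, nrm y < r' -> nrm x < r /\ f x = y.
  have [hy|hy] := boolP (nrm y < r'); last by exists 0.
  have [||x /= xr hx] := @usc_max R [set x | nrm (x - 0) <= r] (fun x => - nrm (f x - y))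
    (@cclosed_disc R 0 r) (@cbounded_disc R 0 r).
  - by exists 0 => /=; rewrite subr0 nrm0 ltW.
  - apply: cont_usc => x /=; rewrite subr0 => hx e e0.
    have [d d0 hd'] := hol_cont (hf x ltac:(lra)) e0.
    exists d => // w /hd'; apply: le_lt_trans; rewrite opprK addrC.
    have := nrm_lb (f x - y) (f (x + w) - y); have := nrm_lb (f (x + w) - y) (f x - y).
    have -> : f (x + w) - y - (f x - y) = f (x + w) - f x by ring.
    have -> : f x - y - (f (x + w) - y) = - (f (x + w) - f x) by ring.
    by rewrite nrmN ler_norml; lra.
  rewrite subr0 in xr.
  have hmin x' : nrm x' <= r -> nrm (f x - y) <= nrm (f x' - y).
    by move=> h; have := hx x'; rewrite /= subr0 => /(_ h); rewrite lerN2.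
  have h0 := hmin 0; rewrite nrm0 f0 sub0r nrmN in h0; have {}h0 := h0 (ltW r0).
  have xlt : nrm x < r.
    rewrite ltNge; apply/negP => rx.
    have := lip x 0 xr; rewrite nrm0 f0 !subr0 => /(_ (ltW r0)) h1.
    have := nrm_lb (f x) y => h2.
    have : r * (3 / 4 * nrm lam) <= nrm x * (3 / 4 * nrm lam) by rewrite ler_wpM2r // mulr_ge0 // ltW.
    rewrite /r' in hy; have -> : r * (3 / 4 * nrm lam) = 3 * (nrm lam * r / 4) by ring.
    have := mulr_gt0 L0 r0; lra.
  exists x => _; split => //; apply/eqP; rewrite -subr_eq0; apply: contraT => v0.
  set v := f x - y in v0.
  have nv : 0 < nrm v by rewrite nrm_gt0.
  (* The damping keeps [x + w] in the disc; the residue becomes [(1 - t) v] up to an error of at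
     most [t * nrm v / 4]. *)
  pose t := Num.min 1 ((r - nrm x) * nrm lam / nrm v).
  have t0 : 0 < t by rewrite min_gt0 // divr_gt0 // mulr_gt0 // subr_gt0.
  have t1 : t <= 1 by rewrite /t ge_min lexx.
  have tv : t * nrm v <= (r - nrm x) * nrm lam by rewrite -ler_pdivlMr // /t ge_min lexx orbT.
  pose w := - (t%:C%C * v / lam).
  have nw : nrm w * nrm lam = t * nrm v.
    by rewrite /w nrmN nrmf nrmM nrm_real (gtr0_norm t0) divfK // lt0r_neq0.
  have wr : nrm w <= r - nrm x by rewrite -(ler_pM2r L0) nw.
  have xw : nrm (x + w) <= r by apply: le_trans (nrmD _ _) _; lra.
  have h1 := near _ _ xw xr; have xwx : x + w - x = w by ring.
  rewrite xwx in h1.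
  have E : f (x + w) - y = (1 - t)%:C%C * v + (f (x + w) - f x - lam * w).
    have -> : lam * w = - (t%:C%C * v) by rewrite /w; field.
    by rewrite rmorphB /= rmorph1 /v; ring.
  have := hmin _ xw; rewrite E => h2; have := le_trans h2 (nrmD _ _).
  rewrite nrmM nrm_real ger0_norm ?subr_ge0 // => h3.
  have E2 : nrm lam / 4 * nrm w = t * nrm v / 4 by rewrite -nw; ring.
  rewrite E2 in h1; have := mulr_gt0 t0 nv; rewrite -/v in h3 h2.
  rewrite mulrBl mul1r in h3; lra.
have [G hG] := choice ex.
exists r, r', G; split => //; first lra.
split=> [y /hG[]//|y /hG[]//|y hy|x hx hfx]; last first.
  have [h1 h2] := hG _ hfx; apply/eqP; rewrite -subr_eq0 -nrm_le0.
  have := lip _ _ (ltW h1) hx; rewrite h2 subrr nrm0 => h3.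
  by rewrite -(@pmulr_lle0 _ (3 / 4 * nrm lam)) // mulr_gt0.
have [h1 h2] := hG _ hy.
have [d hdx] := hf _ (lt_trans h1 (le_lt_trans rr1 r1rho)).
(* The lower Lipschitz bound passes to the derivative, which is therefore invertible at [G y]. *)
have dn : 3 / 4 * nrm lam <= nrm d.
  apply/ler_addgt0Pl => e e0.
  have [t t0 ht] := hdx _ e0.
  pose k := Num.min t (r - nrm (G y)) / 2.
  have k0 : 0 < k by rewrite divr_gt0 ?min_gt0 ?subr_gt0.
  have [k1 k2] : 2 * k <= t /\ 2 * k <= r - nrm (G y).
    have -> : 2 * k = Num.min t (r - nrm (G y)) by rewrite /k; field.
    by rewrite !ge_min !lexx !orbT.
  have nk : nrm (k%:C%C) = k by rewrite nrm_real gtr0_norm.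
  have hk := ht (k%:C)%C ltac:(by rewrite nk; lra); rewrite nk in hk.
  have hk2 : nrm (G y + k%:C%C) <= r by apply: le_trans (nrmD _ _) _; rewrite nk; lra.
  have := lip _ _ hk2 (ltW h1); have -> : G y + k%:C%C - G y = k%:C%C by ring.
  rewrite nk => h3; rewrite -(ler_pM2l k0); apply: (le_trans h3).
  have := nrm_lb (f (G y + k%:C%C) - f (G y)) (d * k%:C%C); rewrite nrmM nk; lra.
have d0 : 0 < nrm d by apply: lt_le_trans dn; rewrite mulr_gt0.
have dn0 : d != 0 by rewrite -nrm_gt0.
exists (d^-1) => e e0.
pose e' := e * nrm d * (3 / 4 * nrm lam).
have e'0 : 0 < e' by rewrite !mulr_gt0.
have [t t0 ht] := hdx _ e'0.
exists (Num.min (r' - nrm y) (t * (3 / 4 * nrm lam))).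
  by rewrite min_gt0 ?subr_gt0 // !mulr_gt0.
move=> k; rewrite lt_min => /andP[kr kt].
have yk : nrm (y + k) < r' by apply: le_lt_trans (nrmD _ _) _; lra.
have [g1 g2] := hG _ yk.
pose w := G (y + k) - G y.
have wk : nrm w * (3 / 4 * nrm lam) <= nrm k.
  by have := lip _ _ (ltW g1) (ltW h1); rewrite g2 h2; have -> : y + k - y = k by ring.
have wt : nrm w < t by rewrite -(@ltr_pM2r _ (3 / 4 * nrm lam)) ?mulr_gt0 //; lra.
have := ht _ wt; rewrite /w subrKC g2 h2 -/w.
have -> : y + k - y - d * w = - d * (w - d^-1 * k) by field.
rewrite nrmM nrmN => h5; rewrite -(ler_pM2l d0); apply: (le_trans h5).
have -> : e' * nrm w = nrm d * e * (nrm w * (3 / 4 * nrm lam)) by rewrite /e'; ring.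
by rewrite [leRHS]mulrA ler_wpM2l // mulr_ge0 ?nrm_ge0 // ltW.
Qed.

(* The inverse of the conjugacy is a limit of the averages of
   [lam^-k * Phi k]. *)
Lemma bounded_iterates_linearize f (Phi : nat -> R[i] -> R[i]) lam (s M : R) : 0 < s ->
  nrm lam = 1 -> f 0 = 0 -> cont f 0 -> Phi 0%N =1 id ->
  (forall n, Phi n 0 = 0) ->
  (forall n z, nrm z < s -> hol (Phi n) z) -> (forall n, cd (Phi n) 0 (lam ^+ n)) ->
  (forall n z, nrm z < s -> nrm (Phi n z) <= M) ->
  (exists2 r, 0 < r & forall n z, nrm z < r -> Phi n (f z) = Phi n.+1 z) ->
  exists h r, [/\ 0 < r, forall w, nrm w < r -> hol h w, h 0 = 0, cd h 0 1 &
    forall w, nrm w < r -> f (h w) = h (lam * w)].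
Proof.
move=> s0 lam1 f0 fc P0 Pn0 Phol Pcd PM [r1 r10 Pf].
have l0 : lam != 0 by rewrite -nrm_gt0 lam1.
have M0 : 0 <= M by apply: le_trans (nrm_ge0 _) (PM 0%N 0 _); rewrite nrm0.
pose phi n z : R[i] := n.+1%:R^-1 * \sum_(k < n.+1) lam ^- k * Phi k z.
have phol n z : nrm z < s -> hol (phi n) z.
  by move=> hz; apply: holZ; apply: hol_sum => k; apply: holZ; exact: Phol.
have nn (n : nat) : n.+1%:R != 0 :> R[i] by rewrite pnatr_eq0.
have nl k : nrm (lam ^- k) = 1 by rewrite nrmV nrmX lam1 expr1n invr1.
have pM n z : nrm z < s -> nrm (phi n z) <= M.
  move=> hz; rewrite nrmM nrmV nrm_nat ler_pdivrMl ?ltr0n //.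
  apply: le_trans (nrm_sum _ _ _) _.
  apply: le_trans (_ : \sum_(k < n.+1) M <= _).
    by apply: ler_sum => k _; rewrite nrmM nl mul1r PM.
  by rewrite sumr_const card_ord mulr_natl.
have pcd n : cd (phi n) 0 1.
  have cd_sum m : cd (fun z => \sum_(k < m) lam ^- k * Phi k z) 0 (\sum_(k < m) 1).
    elim: m => [|m IH]; first by rewrite big_ord0; apply: cd_ext (cd_cst 0 0) => z; rewrite big_ord0.
    rewrite big_ord_recr /=.
    have := cdD IH (cdM (cd_cst (lam ^- m) 0) (Pcd m)).
    rewrite mul0r add0r mulVf ?expf_neq0 // => h.
    by apply: cd_ext h => z; rewrite big_ord_recr.
  have := cdM (cd_cst (n.+1%:R^-1) 0) (cd_sum n.+1).
  by rewrite mul0r add0r sumr_const card_ord mulVf.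
(* These Taylor bounds are uniform in [n] and make the pointwise limit [p] differentiable. *)
have exd z : exists d : nat -> R[i], nrm z < s -> forall n, nrm (d n) <= 4 * M / (s - nrm z) /\
    forall w, nrm w <= (s - nrm z) / 2 ->
    nrm (phi n (z + w) - phi n z - d n * w) <= 16 * M / (s - nrm z) ^+ 2 * nrm w ^+ 2.
  have [hz|hz] := boolP (nrm z < s); last by exists (fun=> 0).
  have ex n : exists d, nrm d <= 4 * M / (s - nrm z) /\
    forall w, nrm w <= (s - nrm z) / 2 ->
    nrm (phi n (z + w) - phi n z - d * w) <= 16 * M / (s - nrm z) ^+ 2 * nrm w ^+ 2.
    have near x : nrm (x - z) < s - nrm z -> nrm x < s by have := nrm_lb x z; lra.
    have sz : 0 < s - nrm z by rewrite subr_gt0.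
    have [d [h1 h2]] := hol_second sz (fun x hx => phol n x (near x hx)) (fun x hx => pM n x (near x hx)).
    by exists d; split => // w /h2[].
  by have [d hd] := choice ex; exists d.
have [d hd] := choice exd.
have exb z : exists b, nrm z < s -> ucv (fun n => phi n z) b.
  have [hz|hz] := boolP (nrm z < s); last by exists 0.
  by have [b hb] := ucv_ex (fun n => pM n z hz); exists b.
have exb' z : exists b, nrm z < s -> ucv (fun n => d z n) b.
  have [hz|hz] := boolP (nrm z < s); last by exists 0.
  by have [b hb] := ucv_ex (fun n => (hd z hz n).1); exists b.
have [p hp] := choice exb; have [p' hp'] := choice exb'.
have pder z : nrm z < s -> cd p z (p' z).
  move=> hz; have sz : 0 < s - nrm z by rewrite subr_gt0.
  apply: (@second_cd p z (p' z) (16 * M / (s - nrm z) ^+ 2) ((s - nrm z) / 2)).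
  - by rewrite divr_ge0 ?mulr_ge0 ?exprn_ge0 // ltW.
  - by rewrite divr_gt0.
  move=> w hw; have hzw : nrm (z + w) < s by apply: le_lt_trans (nrmD _ _) _; lra.
  have lim := ucvB (ucvB (hp _ hzw) (hp _ hz)) (ucvZ w (hp' _ hz)).
  rewrite (mulrC (p' z)); apply: (ucv_le lim); apply: ulfT => n /=.
  by rewrite (mulrC w); have [_ ] := hd z hz n; apply.
have z0s : nrm (0 : R[i]) < s by rewrite nrm0.
have p'0 : p' 0 = 1.
  apply: (ucv_unique (hp' 0 z0s)) => e e0; apply: ulfT => n /=.
  have [_ h2] := hd 0 z0s n.
  have -> : d 0 n = 1.
    apply: cd_unique (pcd n); apply: second_cd h2.
    - by rewrite divr_ge0 ?mulr_ge0 ?exprn_ge0 // nrm0 subr0 ltW.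
    - by rewrite nrm0 subr0 divr_gt0.
  by rewrite subrr nrm0.
have p0 : p 0 = 0.
  apply: (ucv_unique (hp 0 z0s)) => e e0; apply: ulfT => n /=.
  by rewrite /phi big1 ?mulr0 ?subr0 ?nrm0 // => k _; rewrite Pn0 mulr0.
have [r2 r20 hfc] := fc _ s0.
have pf z : nrm z < Num.min (Num.min r1 r2) s -> p (f z) = lam * p z.
  rewrite !lt_min => /andP[/andP[z1 z2] z3].
  have fzs : nrm (f z) < s by have := hfc z z2; rewrite add0r f0 subr0.
  have lim := ucvB (hp _ fzs) (ucvZ lam (hp _ z3)).
  apply/eqP; rewrite -subr_eq0; apply/eqP; apply: (ucv_unique lim).
  apply: ucv_eventually => e e0.
  have e1 : 0 < e / (2 * M + 1) by rewrite divr_gt0 // ltr_wpDl // mulr_ge0.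
  have [n0 hn0] := exists_lt_inv e1; exists n0 => n /hn0 hn; rewrite subr0.
  (* The defect of the averages telescopes to two bounded terms divided by [n + 1], so the limit
     satisfies [p (f z) = lam * p z]. *)
  have E : phi n (f z) - lam * phi n z = n.+1%:R^-1 * (lam * (lam ^- n.+1 * Phi n.+1 z - Phi 0%N z)).
    rewrite /phi mulrCA -mulrBr; congr (_ * _); rewrite mulr_sumr -sumrB.
    have tele : \sum_(k < n.+1) (lam * (lam ^- k.+1 * Phi k.+1 z) - lam * (lam ^- k * Phi k z)) =
       lam * (lam ^- n.+1 * Phi n.+1 z - Phi 0%N z).
      rewrite -(big_mkord predT (fun k => lam * (lam ^- k.+1 * Phi k.+1 z) - lam * (lam ^- k * Phi k z))).
      by rewrite telescope_sumr // expr0 invr1 mul1r mulrBr.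
    rewrite -tele; apply: eq_bigr => k _; rewrite Pf //; congr (_ - _).
    by rewrite exprS; field; rewrite l0 expf_neq0.
  rewrite E nrmM nrmV nrm_nat nrmM lam1 mul1r.
  have hb : nrm (lam ^- n.+1 * Phi n.+1 z - Phi 0%N z) <= 2 * M.
    apply: le_trans (nrmB _ _) _; rewrite nrmM nl mul1r.
    have := PM n.+1 z z3; have := PM 0%N z z3; lra.
  have in0 : 0 < n.+1%:R^-1 :> R by rewrite invr_gt0 ltr0n.
  apply: le_lt_trans (ler_wpM2l (ltW in0) hb) _.
  rewrite ltr_pdivlMr in hn; last by rewrite ltr_wpDl // mulr_ge0.
  apply: lt_trans hn; rewrite ltr_pM2l //; lra.
have [r [r' [h [rp r'p rs near [G1 G2 G3 G4]]]]] :=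
  local_inverse s0 (fun z hz => ex_intro _ _ (pder z hz)) p0
   (eq_ind _ (fun d => cd p 0 d) (pder 0 z0s) _ p'0) (oner_neq0 _).
have h0 : h 0 = 0 by rewrite -[0 in LHS]p0; apply: G4; rewrite ?p0 nrm0 // ltW.
have hc : cont h 0 by apply: hol_cont; apply: G3; rewrite nrm0.
pose r3 := Num.min (Num.min r1 r2) s.
have r30 : 0 < r3 by rewrite !min_gt0.
have [t t0 ht] := fc _ rp.
have m0 : 0 < Num.min t r3 by rewrite min_gt0.
have [t' t'0 ht'] := hc _ m0.
exists h, (Num.min r' t'); split => //.
- by rewrite min_gt0.
- by move=> w; rewrite lt_min => /andP[/G3].
- have [e he] := G3 0 ltac:(by rewrite nrm0).
  have := cd_comp he (_ : cd p (h 0) 1); rewrite h0 => /(_ ltac:(by rewrite -p'0; exact: pder)).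
  rewrite mul1r => hid; have e1 : e = 1.
    apply: (cd_unique hid); apply: (@cd_local _ id _ _ _ r') => //; last exact: cd_id.
    by move=> w hw /=; rewrite add0r G2.
  by rewrite -e1.
move=> w; rewrite lt_min => /andP[wr' wt'].
have := ht' w wt'; rewrite add0r h0 subr0 lt_min => /andP[hw1 hw2].
have fh : nrm (f (h w)) < r by have := ht _ hw1; rewrite add0r f0 subr0.
have E : p (f (h w)) = lam * w by rewrite pf // G2.
by rewrite -E G4 // ?E ?nrmM ?lam1 ?mul1r // ltW.
Qed.

End LocalTheory.

(** * Density of irrational rotations *)

Section Rotation.
Variable R : realType.
Implicit Types (s t alpha : R) (v : R[i]).

Lemma ex_floor (x : R) : exists k : int, k%:~R <= x < k%:~R + 1.
Proof. by exists (Num.Def.floor x); have := floor_itv x; rewrite intrD. Qed.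

Lemma ex_nat_floor (x : R) : 0 <= x -> exists i : nat, i%:R <= x < i%:R + 1.
Proof. by move=> x0; exists (Num.Def.trunc x); have := truncn_itv x0; rewrite -natr1. Qed.

Lemma multiplierD s t : multiplier (s + t) = multiplier s * multiplier t.
Proof. by apply: complex_eq; rewrite /multiplier mulrDr ?cosD ?sinD /=; ring. Qed.

Lemma multiplier0 : multiplier (0 : R) = 1.
Proof. by rewrite /multiplier mulr0 cos0 sin0. Qed.

Lemma multiplier1 : multiplier (1 : R) = 1.
Proof. by rewrite /multiplier mulr1 mulr_natl cos2pi sin2pi. Qed.

Lemma nrm_multiplier t : nrm (multiplier t) = 1.
Proof. by rewrite nrm_sqrtE /= cos2Dsin2 sqrtr1. Qed.

Lemma multiplier_nat t n : multiplier (n%:R * t) = multiplier t ^+ n.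
Proof.
elim: n => [|n IH]; first by rewrite mul0r multiplier0.
by rewrite -natr1 mulrDl mul1r multiplierD IH exprSr.
Qed.

Lemma multiplierN t : multiplier (- t) = (multiplier t)^-1.
Proof.
have h : multiplier t * multiplier (- t) = 1 by rewrite -multiplierD subrr multiplier0.
have n0 : multiplier t != 0 by rewrite -nrm_gt0 nrm_multiplier.
by rewrite -[LHS](mulKf n0) h mulr1.
Qed.

Lemma multiplier_int (k : int) : multiplier (k%:~R : R) = 1.
Proof.
have hn (n : nat) : multiplier (n%:R : R) = 1 by rewrite -[n%:R]mulr1 multiplier_nat multiplier1 expr1n.
case: k => n; first exact: hn.
by rewrite NegzE rmorphN multiplierN (hn n.+1) invr1.
Qed.

Lemma multiplier_cont0 (e : R) : 0 < e -> exists2 d : R, 0 < d & forall t, `|t| < d -> nrm (multiplier t - 1) < e.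
Proof.
move=> e0; have e2 : 0 < e / 2 by rewrite divr_gt0.
have pi2 : 0 < 2 * pi + 1 :> R by rewrite ltr_wpDl // mulr_ge0 // pi_ge0.
have := @continuous_cos R 0 => /cvgrPdist_lt /(_ _ e2) /nbhs_ballP[r /= r0 hr].
have := @continuous_sin R 0 => /cvgrPdist_lt /(_ _ e2) /nbhs_ballP[r' /= r'0 hr'].
exists (Num.min r r' / (2 * pi + 1)); first by rewrite divr_gt0 ?min_gt0.
move=> t; rewrite ltr_pdivlMr // => ht.
have h2 : `|2 * pi * t| < Num.min r r'.
  apply: le_lt_trans ht; rewrite normrM ger0_norm ?mulr_ge0 ?pi_ge0 // mulrC ler_wpM2l //; lra.
move: h2; rewrite lt_min => /andP[h1 h2].
have := hr (2 * pi * t); rewrite /ball /= sub0r normrN => /(_ h1); rewrite cos0 distrC => c1.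
have := hr' (2 * pi * t); rewrite /ball /= sub0r normrN => /(_ h2); rewrite sin0 distrC subr0 => c2.
apply: le_lt_trans (nrm_le_ReIm _) _; rewrite /multiplier /= subr0; lra.
Qed.

Lemma unit_multiplier v : nrm v = 1 -> exists t, multiplier t = v.
Proof.
move=> v1; have pi0 : (pi : R) != 0 by rewrite lt0r_neq0 // pi_gt0.
have hv : Re v ^+ 2 + Im v ^+ 2 = 1 by rewrite -nrm_sqr v1 expr1n.
have hR : -1 <= Re v <= 1 by have := normRe_le v; rewrite v1 ler_norml.
have hI : sin (acos (Re v)) = `|Im v|.
  by rewrite sin_acos // -hv addrC addKr sqrtr_sqr.
have E t : 2 * pi * (t / (2 * pi)) = t by rewrite mulrC divfK // mulf_neq0 // pnatr_eq0.
have hc : cos (acos (Re v)) = Re v by apply: acosK; rewrite in_itv.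
have [h|h] := leP 0 (Im v).
  exists (acos (Re v) / (2 * pi)); rewrite /multiplier E hI hc ger0_norm //; exact: complex_eq.
exists (- (acos (Re v)) / (2 * pi)); rewrite /multiplier E cosN sinN hI hc ltr0_norm // opprK; exact: complex_eq.
Qed.

(** Two multiples of [alpha] have fractional parts closer than [e]; their difference [del] is
    nonzero by irrationality, and its multiples advance by steps shorter than [e]. [J] is
    independent of [t], since [t] can be reduced modulo [1] and about [1 / |del|] steps then
    suffice. *)
Lemma kronecker alpha (e : R) : Defs.irrational alpha -> 0 < e ->
  exists J : nat, forall t, exists (j : nat) (k : int), (j < J)%N /\ `|j%:R * alpha - k%:~R - t| < e.
Proof.
move=> irr e0; have e2 : 0 < e / 2 by rewrite divr_gt0.
have [kf hk] := choice (fun n : nat => ex_floor (n%:R * alpha)).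
pose x n : R := n%:R * alpha - (kf n)%:~R.
have xb n : `|x n| <= 1 by rewrite /x ler_norml; have := hk n; lra.
have [l hl] := ucv_real_ex xb.
have [n hn] := ulf_ex (hl _ e2).
have [n' [/= hn' hnn]] := ulf_ex (ulfI (hl _ e2) (ulf_ge n.+1)).
rewrite /= in hn; pose q := (n' - n)%N; pose k0 := kf n' - kf n.
pose del := x n' - x n.
have qE : n'%:R = n%:R + q%:R :> R by rewrite -natrD subnKC // ltnW.
have delE : del = q%:R * alpha - k0%:~R by rewrite /del /x qE /k0 intrB; ring.
have dele : `|del| < e.
  have := ler_distD l (x n') (x n); rewrite (distrC l); rewrite -/del; lra.
have q0 : q%:R != 0 :> R by rewrite pnatr_eq0 -lt0n subn_gt0.
have del0 : del != 0.
  apply/eqP => d0; apply: irr; exists (k0%:~R / q%:R).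
  rewrite fmorph_div rmorph_int rmorph_nat.
  by apply: (mulIf q0); rewrite divfK // mulrC; apply/eqP; rewrite -subr_eq0 -delE d0.
have ad : 0 < `|del| by rewrite normr_gt0.
have [N hN] := exists_gt_nat (`|del|^-1).
exists (N.+1 * q.+1)%N => t.
have [s hs] := ex_floor t.
(* [t] is rounded down or up according to the sign of [del], so that the number of steps is
   nonnegative. *)
have [s' [hy1 hy2]] : exists s' : int, 0 <= (t - s'%:~R) / del /\ `|t - s'%:~R| <= 1.
  have [dp|dn] := ltP 0 del.
    exists s; split; first by rewrite divr_ge0 ?(ltW dp) //; lra.
    by rewrite ler_norml; lra.
  exists (s + 1); rewrite intrD; split.
    by rewrite -(opprK del) invrN mulrN -mulNr divr_ge0 //; lra.
  by rewrite ler_norml /=; lra.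
have [i /andP[i1 i2]] := ex_nat_floor hy1.
exists (i * q)%N, (k0 * i%:Z - s'); split.
  have iN : (i <= N)%N.
    rewrite -(ler_nat R); apply: le_trans i1 _; apply: le_trans (ltW (hN _ (leqnn _))).
    apply: le_trans (ler_norm _) _; rewrite normf_div -[leRHS]mul1r ler_wpM2r // invr_ge0 //.
  by apply: leq_ltn_trans (leq_mul iN (leqnSn q)) _; rewrite ltn_mul2r ltnSn.
have -> : (i * q)%:R * alpha - (k0 * i%:Z - s')%:~R - t = i%:R * del - (t - s'%:~R).
  by rewrite intrB intrM natrM delE; ring.
have -> : t - s'%:~R = (t - s'%:~R) / del * del by rewrite divfK.
rewrite -mulrBl normrM; apply: le_lt_trans dele; rewrite -[leRHS]mul1r ler_wpM2r //.
by rewrite ler_norml; lra.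
Qed.

Lemma rot_dense alpha (e : R) : Defs.irrational alpha -> 0 < e ->
  exists J : nat, forall v, nrm v = 1 -> exists2 j, (j < J)%N & nrm (multiplier alpha ^+ j - v) < e.
Proof.
move=> irr e0; have [d d0 hd] := multiplier_cont0 e0.
have [J hJ] := kronecker irr d0; exists J => v /unit_multiplier[t <-].
have [j [k [jJ hj]]] := hJ t; exists j => //.
have := hd _ hj; rewrite multiplierD multiplierN.
have -> : multiplier (j%:R * alpha - k%:~R) = multiplier alpha ^+ j.
  by rewrite multiplierD multiplierN multiplier_int invr1 mulr1 multiplier_nat.
have n0 : multiplier t != 0 by rewrite -nrm_gt0 nrm_multiplier.
move=> h; have -> : multiplier alpha ^+ j - multiplier t = (multiplier alpha ^+ j / multiplier t - 1) * multiplier t.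
  by field.
by rewrite nrmM nrm_multiplier mulr1.
Qed.

Lemma irrationalM alpha (m : int) : Defs.irrational alpha -> m != 0 -> Defs.irrational (m%:~R * alpha).
Proof.
move=> irr m0 [q hq]; apply: irr; exists (q / m%:~R).
have mR : m%:~R != 0 :> R by rewrite intr_eq0.
apply: (mulfI mR); rewrite hq fmorph_div rmorph_int mulrC divfK //.
Qed.

End Rotation.

(** * Germs close to the identity and asymptotic density *)

Section Asymptotics.
Variable R : realType.
Implicit Types (K : set R[i]) (f fi h psi : R[i] -> R[i]) (c a lam z y v : R[i]).

Definition holn f := exists2 r : R, 0 < r & forall z, nrm z < r -> hol f z.
Definition nearby (P : R[i] -> Prop) := exists2 r : R, 0 < r & forall z, nrm z < r -> P z.
(** Composites and inverses are controlled only as germs at [0], so invariance of [K] is asked only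
    near the origin. *)
Definition Kgerm K psi := nearby (fun z => K z -> K (psi z)).
Definition asy h c k := forall e : R, 0 < e ->
  nearby (fun z => nrm (h z - z - c * z ^+ k) <= e * nrm z ^+ k).

Lemma nearbyI (P Q : R[i] -> Prop) : nearby P -> nearby Q -> nearby (fun z => P z /\ Q z).
Proof.
move=> [r r0 h] [r' r'0 h']; exists (Num.min r r'); first exact: min_gt0.
by move=> z; rewrite lt_min => /andP[/h ? /h' ?].
Qed.

Lemma nearbyS (P Q : R[i] -> Prop) : (forall z, P z -> Q z) -> nearby P -> nearby Q.
Proof. by move=> h [r r0 hr]; exists r => // z /hr/h. Qed.

Lemma nearby_lt (e : R) : 0 < e -> nearby (fun z => nrm z < e).
Proof. by exists e. Qed.

Lemma nearby_comp (P : R[i] -> Prop) f : cont f 0 -> f 0 = 0 -> nearby P -> nearby (fun z => P (f z)).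
Proof.
move=> fc f0 [r r0 h]; have [r' r'0 hr'] := fc _ r0; exists r' => // z /hr'.
by rewrite add0r f0 subr0; exact: h.
Qed.

Lemma nearby_fin (P : nat -> R[i] -> Prop) J : (forall j, nearby (P j)) ->
  nearby (fun z => forall j, (j < J)%N -> P j z).
Proof.
move=> h; elim: J => [|J IH]; first by exists 1.
apply: nearbyS (nearbyI (h J) IH) => z [h1 h2] j; rewrite ltnS leq_eqVlt => /orP[/eqP -> //|]; exact: h2.
Qed.

Lemma nearby_cont f (e : R) : cont f 0 -> 0 < e -> nearby (fun z => nrm (f z - f 0) < e).
Proof. by move=> fc /fc[r r0 h]; exists r => // z /h; rewrite add0r. Qed.

Lemma nearby_pow (e C : R) n : 0 < e -> (0 < n)%N -> 0 <= C -> nearby (fun z => C * nrm z ^+ n <= e).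
Proof.
move=> e0 n0 C0; have C1 : 0 < C + 1 by rewrite ltr_wpDl.
exists (Num.min 1 (e / (C + 1))); first by rewrite min_gt0 // divr_gt0.
move=> z; rewrite lt_min ltr_pdivlMr // => /andP[z1 z2].
have := nrm_ge0 z => nz; apply: le_trans (ltW z2); rewrite mulrDr mulr1 [leRHS]addrC.
case: n n0 => // n _; rewrite exprSr.
have : nrm z ^+ n <= 1 by rewrite exprn_ile1 // ltW.
move=> /(ler_wpM2r nz); rewrite mul1r => /(ler_wpM2l C0); rewrite (mulrC _ C); lra.
Qed.

Lemma asy_bound h c k : asy h c k -> nearby (fun z => nrm (h z - z) <= (nrm c + 1) * nrm z ^+ k).
Proof.
move=> /(_ 1 ltr01); apply: nearbyS => z hz.
have -> : h z - z = (h z - z - c * z ^+ k) + c * z ^+ k by ring.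
apply: le_trans (nrmD _ _) _; rewrite nrmM nrmX; lra.
Qed.

Lemma asy_le2 h c k : (1 < k)%N -> asy h c k -> nearby (fun z => nrm (h z) <= 2 * nrm z).
Proof.
move=> k1 hh; have k0 : (0 < k.-1)%N by case: k k1 {hh} => // -[].
have c0 : 0 <= nrm c + 1 by rewrite addr_ge0 ?nrm_ge0.
apply: nearbyS (nearbyI (asy_bound hh) (nearby_pow ltr01 k0 c0)) => z [h1 h2].
have := ler_wpM2r (nrm_ge0 z) h2; rewrite -mulrA -exprSr prednK ?(ltnW k1) // mul1r => h3.
have := nrm_lb (h z) z; lra.
Qed.

Lemma asy_cont h c k : (1 < k)%N -> asy h c k -> h 0 = 0 /\ cont h 0.
Proof.
move=> k1 /(asy_le2 k1)[r r0 hr]; have h0 : h 0 = 0.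
  by have := hr 0; rewrite nrm0 mulr0 nrm_le0 => /(_ r0)/eqP.
split=> // e e0; exists (Num.min r (e / 2)); first by rewrite min_gt0 ?divr_gt0.
move=> w; rewrite lt_min add0r h0 subr0 => /andP[/hr h1 h2]; lra.
Qed.

Lemma cd_mulz Q : hol Q 0 -> cd (fun z => z * Q z) 0 (Q 0).
Proof. by move=> [d hd]; have := cdM (cd_id 0) hd; rewrite mul1r mul0r addr0. Qed.

(** With [w = fi z], close to [z / lam], the displacement [c w^k] is multiplied by [lam] under [f],
    so the coefficient gains the factor [lam / lam^k]. The three error terms come from [f], [h] and
    [fi] in turn. *)
Lemma asy_conj f fi h lam c k : holn f -> f 0 = 0 -> cd f 0 lam -> lam != 0 ->
  holn fi -> fi 0 = 0 -> cd fi 0 lam^-1 -> nearby (fun z => f (fi z) = z) ->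
  (1 < k)%N -> asy h c k -> asy (f \o h \o fi) (c * (lam / lam ^+ k)) k.
Proof.
move=> [rf rf0 hf] f0 fd lam0 [rfi rfi0 hfi] fi0 fid ffi k1 hh e e0.
have [C [r1 [C0 r10 _ hC]]] := hol_C2 rf0 hf fd.
have [Q [hQ QE]] := hol_factor0 rfi0 hfi.
have Q0 : Q 0 = lam^-1.
  apply: (cd_unique _ fid); have := cd_mulz (hQ 0 ltac:(by rewrite nrm0)); apply: cd_ext => z.
  by rewrite QE fi0 add0r.
have fic : cont fi 0 by apply: cd_cont fid.
pose L := nrm lam^-1 + 1.
have L0 : 0 < L by rewrite ltr_wpDl ?nrm_ge0.
pose D := 3 * C * (nrm c + 1) * L ^+ k.+1.
have D0 : 0 <= D by rewrite !mulr_ge0 ?exprn_ge0 ?addr_ge0 ?nrm_ge0 // ltW.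
have l0 : 0 < nrm lam by rewrite nrm_gt0.
pose e1 := e / 3 / (nrm lam * L ^+ k).
have e10 : 0 < e1 by rewrite !divr_gt0 // mulr_gt0 // exprn_gt0.
pose e2 := e / 3 / (nrm lam * nrm c + 1).
have e20 : 0 < e2 by rewrite !divr_gt0 // ltr_wpDl // mulr_ge0 ?nrm_ge0.
have N1 := nearby_comp fic fi0 (nearbyI (hh _ e10) (nearbyI (asy_bound hh) (asy_le2 k1 hh))).
have [rl rl0 hl] := cd_lip fid.
have N2 : nearby (fun z => nrm (fi z) <= L * nrm z).
  by exists rl => // z /hl; rewrite add0r fi0 subr0.
have r12 : 0 < r1 / 2 by rewrite divr_gt0.
have N3 := nearby_comp fic fi0 (nearby_lt r12).
have N4 : nearby (fun z => nrm (Q z ^+ k - Q 0 ^+ k) < e2).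
  by apply: (nearby_cont (f := fun z => Q z ^+ k)) => //; apply: hol_cont; apply: holX; apply: hQ; rewrite nrm0.
have e3 : 0 < e / 3 by rewrite divr_gt0.
have N5 := nearby_pow e3 (isT : (0 < 1)%N) D0.
apply: nearbyS (nearbyI (nearbyI N1 N2) (nearbyI (nearbyI N3 N4) (nearbyI N5 ffi))).
move=> z [[[h1 [h2 h3]] h4] [[h5 h6] [h7 h8]]] /=.
set w := fi z in h1 h2 h3 h4 h5 h8 *.
have nz := nrm_ge0 z; have nw := nrm_ge0 w.
have zk : 0 <= nrm z ^+ k by rewrite exprn_ge0.
have wk : nrm w ^+ k <= L ^+ k * nrm z ^+ k by rewrite -exprMn lerXn2r ?nnegrE // mulr_ge0 // ltW.
have E : f (h w) - z - c * (lam / lam ^+ k) * z ^+ k =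
  (f (h w) - f w - lam * (h w - w)) + lam * (h w - w - c * w ^+ k) + lam * c * (z ^+ k * (Q z ^+ k - Q 0 ^+ k)).
  have wE : w ^+ k = z ^+ k * Q z ^+ k by rewrite /w QE fi0 add0r exprMn.
  by rewrite h8 Q0 exprVn wE; field; rewrite expf_neq0.
have T1 : nrm (f (h w) - f w - lam * (h w - w)) <= e / 3 * nrm z ^+ k.
  apply: le_trans (hC _ _ _ _) _; [lra|lra|].
  apply: le_trans (_ : C * (3 * nrm w) * ((nrm c + 1) * nrm w ^+ k) <= _).
    apply: ler_pM; rewrite ?mulr_ge0 ?addr_ge0 ?nrm_ge0 ?(ltW C0) //.
    by rewrite ler_pM2l //; lra.
  have -> : C * (3 * nrm w) * ((nrm c + 1) * nrm w ^+ k) = 3 * C * (nrm c + 1) * nrm w ^+ k.+1 by rewrite exprS; ring.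
  apply: le_trans (_ : 3 * C * (nrm c + 1) * (L * nrm z) ^+ k.+1 <= _).
    rewrite ler_wpM2l ?mulr_ge0 ?addr_ge0 ?nrm_ge0 ?(ltW C0) //.
    by rewrite lerXn2r ?nnegrE // mulr_ge0 // ltW.
  have -> : 3 * C * (nrm c + 1) * (L * nrm z) ^+ k.+1 = D * nrm z ^+ 1 * nrm z ^+ k.
    by rewrite /D exprMn expr1 (exprS (nrm z)); ring.
  by rewrite ler_wpM2r.
have T2 : nrm (lam * (h w - w - c * w ^+ k)) <= e / 3 * nrm z ^+ k.
  rewrite nrmM; apply: le_trans (ler_wpM2l (ltW l0) h1) _.
  have -> : e / 3 = nrm lam * e1 * L ^+ k.
    by rewrite [RHS]mulrAC [RHS]mulrC /e1 divfK // mulf_neq0 ?expf_neq0 // lt0r_neq0.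
  rewrite mulrA -(mulrA _ (L ^+ k)) ler_wpM2l // mulr_ge0 // ltW //.
have T3 : nrm (lam * c * (z ^+ k * (Q z ^+ k - Q 0 ^+ k))) <= e / 3 * nrm z ^+ k.
  rewrite nrmM (nrmM lam) nrmM nrmX mulrCA mulrC ler_wpM2r //.
  have lc : 0 <= nrm lam * nrm c by rewrite mulr_ge0 ?nrm_ge0.
  apply: le_trans (ler_wpM2l lc (ltW h6)) _.
  have : e2 * (nrm lam * nrm c + 1) = e / 3 by rewrite /e2 divfK // lt0r_neq0 // ltr_wpDl.
  rewrite mulrDr mulr1 (mulrC e2); lra.
rewrite E; apply: le_trans (nrmD _ _) _; apply: le_trans (lerD (nrmD _ _) (lexx _)) _; lra.
Qed.

(** One near-translation has a prescribed length and may overshoot. Two of them form an isosceles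
    triangle that reaches any vector of length up to [2 * s] exactly, and they shorten a longer one
    by [2 * s]. *)
Lemma two_units v (s : R) : 0 < s -> exists u1 u2 : R[i], [/\ nrm u1 = 1, nrm u2 = 1 &
  nrm (v - s%:C%C * (u1 + u2)) <= Num.max 0 (nrm v - 2 * s)].
Proof.
move=> s0; have [c [c1 cv]] := exists_phase v.
have [h|h] := leP (2 * s) (nrm v).
  exists c, c; split => //; rewrite le_max; apply/orP; right.
  have -> : v - s%:C%C * (c + c) = c * (nrm v - 2 * s)%:C%C.
    by rewrite -{1}cv rmorphB /= rmorphM /= rmorph_nat; ring.
  by rewrite nrmM c1 mul1r nrm_real ger0_norm // subr_ge0.
pose t := nrm v / (2 * s).
have t0 : 0 <= t by rewrite divr_ge0 ?nrm_ge0 // mulr_ge0 // ltW.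
have t1 : t < 1 by rewrite ltr_pdivrMr ?mulr_gt0 // mul1r.
have tE : 2 * s * t = nrm v by rewrite /t mulrC divfK // lt0r_neq0 // mulr_gt0.
clearbody t; have t2 : 0 <= 1 - t ^+ 2 by rewrite subr_ge0 exprn_ile1 // ltW.
pose q := Num.sqrt (1 - t ^+ 2).
have nu (e : R) : e ^+ 2 = 1 -> nrm (Complex t (e * q)) = 1.
  move=> e1; rewrite nrm_sqrtE /= exprMn e1 mul1r sqr_sqrtr //.
  by rewrite addrC subrK sqrtr1.
exists (c * Complex t (1 * q)), (c * Complex t (-1 * q)); split.
- by rewrite nrmM c1 mul1r nu ?expr1n.
- by rewrite nrmM c1 mul1r nu ?sqrrN ?expr1n.
rewrite le_max; apply/orP; left; rewrite nrm_le0; apply/eqP.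
have -> : s%:C%C * (c * Complex t (1 * q) + c * Complex t (-1 * q)) = c * (2 * s * t)%:C%C.
  have -> : (2 * s * t)%:C%C = s%:C%C * (Complex t (1 * q) + Complex t (-1 * q)).
    by apply: complex_eq => /=; ring.
  by ring.
by rewrite tE cv subrr.
Qed.

(* The point of [K] nearest to [z] cannot be far from [z] at the scale
   [|z|^k]: two of the near-translations [psi j] would bring it closer. *)
Lemma near_translations_dense K (psi : nat -> R[i] -> R[i]) (c : nat -> R[i]) a k :
  cclosed K -> cbounded K -> (1 < k)%N -> a != 0 ->
  (forall j, Kgerm K (psi j)) -> (forall j, asy (psi j) (c j) k) ->
  (forall e : R, 0 < e -> exists J, forall v, nrm v = 1 -> exists2 j, (j < J)%N & nrm (c j - a * v) < e) ->
  nearby (fun z => z != 0 -> exists2 y, K y & nrm (y - z) <= nrm z / 2) ->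
  forall e : R, 0 < e -> nearby (fun z => z != 0 -> exists2 y, K y & nrm (y - z) <= e * nrm z ^+ k).
Proof.
move=> Kc Kb k1 a0 hK hasy hdense hstart e e0.
pose A := nrm a; have A0 : 0 < A by rewrite nrm_gt0.
pose B := 2 ^+ k + A + 4; have B0 : 0 < B by rewrite ltr_wpDl // addr_ge0 ?exprn_ge0 // ltW.
(* [e1 * B] collects the errors of the two moves. The bound [A / B] keeps them below the gain
   [2 * s]; the last bound absorbs the passage from [nrm y] to [2 * nrm z]. *)
pose e1 := Num.min 1 (Num.min (A / B) (e / (B * 2 ^+ k))).
have e10 : 0 < e1 by rewrite !min_gt0 ?divr_gt0 // mulr_gt0 // exprn_gt0.
have e11 : e1 <= 1 by rewrite /e1 ge_min lexx.
have e1A : e1 * B <= A by rewrite -ler_pdivlMr // /e1 !ge_min lexx !orbT.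
have e1e : e1 * (B * 2 ^+ k) <= e by rewrite -ler_pdivlMr ?mulr_gt0 ?exprn_gt0 // /e1 !ge_min lexx !orbT.
have [J hJ] := hdense _ e10.
have N1 := nearby_fin J (fun j => nearbyI (hK j) (hasy j _ e10)).
have [d d0 hd] := hol_cont (@holX R (fun s => 1 + s) 0 k (holD (hol_cst 1 0) (hol_id 0))) e10.
have k0 : (0 < k.-1)%N by case: k k1 {hasy B B0 e1 e10 e11 e1A e1e hJ N1 hd} => // -[].
have d1 : 0 < Num.min 1 (d / 2) by rewrite min_gt0 // divr_gt0.
have A2 : 0 <= A + 2 by rewrite addr_ge0 // ltW.
have N2 := nearby_pow d1 k0 A2.
have [r r0 hr] := nearbyI N1 N2.
have [r' r'0 hr'] := hstart.
exists (Num.min r' (r / 4)); first by rewrite min_gt0 // divr_gt0.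
move=> z; rewrite lt_min => /andP[zr' zr] z0.
have nz : 0 < nrm z by rewrite nrm_gt0.
have [y0 Ky0 hy0] := hr' _ zr' z0.
have [|y Ky hy] := @usc_max R K (fun x => - nrm (x - z)) Kc Kb (ex_intro _ _ Ky0).
  apply: cont_usc => x _ t t0; exists t => // w; apply: le_lt_trans.
  rewrite opprK addrC ler_norml.
  have := nrm_lb (x - z) (x + w - z); have := nrm_lb (x + w - z) (x - z).
  have -> : x - z - (x + w - z) = - w by ring.
  have -> : x + w - z - (x - z) = w by ring.
  by rewrite nrmN; lra.
have {}hy x : K x -> nrm (y - z) <= nrm (x - z) by move=> /hy; rewrite lerN2.
exists y => //; have hyz := le_trans (hy _ Ky0) hy0.
have ny1 : nrm z / 2 <= nrm y by have := nrm_lb z (z - y); rewrite subKr (nrmC z); lra.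
have ny2 : nrm y <= 2 * nrm z by have := nrm_lb y z; lra.
have y0n : y != 0 by rewrite -nrm_gt0; lra.
have ny0 : 0 < nrm y by lra.
have yk : 0 < nrm y ^+ k by rewrite exprn_gt0.
pose s := A * nrm y ^+ k; have s0 : 0 < s by rewrite mulr_gt0.
have [u1 [u2 [u11 u21 hu]]] := two_units (z - y) s0.
have ayk : a * y ^+ k != 0 by rewrite mulf_neq0 // expf_neq0.
(* This unimodular number converts the directions [u1] and [u2] into targets for the coefficients
   [c j]. *)
have say : nrm (s%:C%C / (a * y ^+ k)) = 1.
  by rewrite nrmf nrm_real gtr0_norm // nrmM nrmX divff // lt0r_neq0.
have [j1 j1J hj1] := hJ (s%:C%C / (a * y ^+ k) * u1) ltac:(by rewrite nrmM say u11 mulr1).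
have [j2 j2J hj2] := hJ (s%:C%C / (a * y ^+ k) * u2) ltac:(by rewrite nrmM say u21 mulr1).
have [hy1 hy2] := hr y ltac:(lra).
have [K1 as1] := hy1 j1 j1J; have {}K1 := K1 Ky.
set y1 := psi j1 y in K1 as1.
have E1 : nrm (y1 - y - s%:C%C * u1) <= 2 * e1 * nrm y ^+ k.
  have -> : y1 - y - s%:C%C * u1 = (y1 - y - c j1 * y ^+ k) + (c j1 - a * (s%:C%C / (a * y ^+ k) * u1)) * y ^+ k.
    by field; rewrite a0 expf_neq0.
  apply: le_trans (nrmD _ _) _; rewrite nrmM nrmX.
  have q1 := ler_wpM2r (ltW yk) (ltW hj1); move: (as1) => q2; clear -q1 q2; lra.
have E2 : nrm (y1 - y) <= (A + 2) * nrm y ^+ k.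
  have := nrm_lb (y1 - y) (s%:C%C * u1); rewrite nrmM u11 mulr1 nrm_real gtr0_norm // /s.
  have q1 := ler_wpM2r (ltW yk) e11; move=> q2; clear -q1 q2 E1; lra.
pose t := (y1 - y) / y.
have tn : nrm t <= Num.min 1 (d / 2).
  rewrite /t nrmf ler_pdivrMr //; apply: (le_trans E2).
  by rewrite -(prednK (ltnW k1)) exprSr mulrA ler_wpM2r ?nrm_ge0.
have [t1 t2] : nrm t <= 1 /\ nrm t < d.
  by move: tn; rewrite le_min => /andP[? ?]; split => //; lra.
have y1E : y1 = y * (1 + t) by rewrite /t; field.
have y1n : nrm y1 <= 2 * nrm y.
  rewrite y1E nrmM mulrC ler_wpM2r ?nrm_ge0 //; apply: le_trans (nrmD _ _) _; rewrite nrm1; lra.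
have [hz1 _] := hr y1 ltac:(lra).
have [K2 as2] := hz1 j2 j2J; have {}K2 := K2 K1.
set y2 := psi j2 y1 in K2 as2.
have y1k : nrm y1 ^+ k <= 2 ^+ k * nrm y ^+ k by rewrite -exprMn lerXn2r ?nnegrE ?nrm_ge0 // mulr_ge0 ?nrm_ge0.
have c2 : nrm (c j2) <= A + 1.
  have := nrm_lb (c j2) (a * (s%:C%C / (a * y ^+ k) * u2)); rewrite (nrmM a) nrmM say u21 !mulr1 -/A => q1.
  by clear -q1 hj2 e11; lra.
have E3 : nrm (y1 ^+ k - y ^+ k) <= e1 * nrm y ^+ k.
  have -> : y1 ^+ k - y ^+ k = ((1 + t) ^+ k - 1) * y ^+ k by rewrite y1E exprMn; ring.
  rewrite nrmM nrmX ler_wpM2r ?(ltW yk) // ltW //.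
  by have := hd _ t2; rewrite add0r addr0 expr1n.
have E4 : nrm (y2 - y1 - s%:C%C * u2) <= e1 * (2 ^+ k + A + 2) * nrm y ^+ k.
  have -> : y2 - y1 - s%:C%C * u2 = (y2 - y1 - c j2 * y1 ^+ k) + c j2 * (y1 ^+ k - y ^+ k) +
     (c j2 - a * (s%:C%C / (a * y ^+ k) * u2)) * y ^+ k.
    by field; rewrite a0 expf_neq0.
  apply: le_trans (nrmD _ _) _; apply: le_trans (lerD (nrmD _ _) (lexx _)) _; rewrite !(nrmM, nrmX).
  have h1 := ler_wpM2r (ltW yk) (ltW hj2).
  have h2 := ler_wpM2l (ltW e10) y1k.
  have h3 : nrm (c j2) * nrm (y1 ^+ k - y ^+ k) <= (A + 1) * (e1 * nrm y ^+ k).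
    by apply: ler_pM; rewrite ?nrm_ge0.
  have -> : e1 * (2 ^+ k + A + 2) * nrm y ^+ k = e1 * (2 ^+ k * nrm y ^+ k) + (A + 1) * (e1 * nrm y ^+ k) + e1 * nrm y ^+ k by ring.
  by clear -h1 h2 h3 as2; lra.
have E5 : nrm (y2 - z) <= Num.max 0 (nrm (z - y) - 2 * s) + e1 * B * nrm y ^+ k.
  have -> : y2 - z = - ((z - y) - s%:C%C * (u1 + u2)) + ((y2 - y1 - s%:C%C * u2) + (y1 - y - s%:C%C * u1)) by ring.
  apply: le_trans (nrmD _ _) _; rewrite nrmN; apply: lerD => //.
  apply: le_trans (nrmD _ _) _.
  have -> : e1 * B * nrm y ^+ k = e1 * (2 ^+ k + A + 2) * nrm y ^+ k + 2 * e1 * nrm y ^+ k by rewrite /B; ring.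
  exact: lerD.
have E6 := le_trans (hy _ K2) E5; rewrite (nrmC z) in E6.
have small : nrm (y - z) <= e1 * B * nrm y ^+ k.
  have [h|h] := leP (nrm (y - z) - 2 * s) 0; first by move: E6; rewrite (max_l h) add0r.
  exfalso; move: E6; rewrite max_r ?(ltW h) // => E6.
  have q1 := ler_wpM2r (ltW yk) e1A; rewrite /s in E6 h s0; clear -q1 E6 s0; lra.
apply: (le_trans small).
have : e1 * B * nrm y ^+ k <= e1 * B * (2 ^+ k * nrm z ^+ k).
  rewrite ler_wpM2l ?mulr_ge0 ?(ltW e10) ?(ltW B0) // -exprMn lerXn2r ?nnegrE ?nrm_ge0 //.
  by rewrite mulr_ge0 ?nrm_ge0.
move=> h; apply: (le_trans h); rewrite mulrA ler_wpM2r ?exprn_ge0 ?nrm_ge0 //.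
by rewrite -mulrA.
Qed.

End Asymptotics.

(** The contexts below mix inequalities with quantified facts and complex identities; only order
    relations and equalities not between complex numbers are kept for [lra]. *)
Ltac rlra := repeat match goal with H : ?T |- _ =>
  match type of T with Prop => lazymatch T with
  | is_true (@Order.le _ _ _ _) => fail
  | is_true (@Order.lt _ _ _ _) => fail
  | @eq (complex _) _ _ => clear H
  | @eq _ _ _ => fail
  | _ => clear H end end end; lra.

(** * Attracting petals of a parabolic germ *)

Section Parabolic.
Variable R : realType.
Implicit Types (K : set R[i]) (f fi g gi h hi Q : R[i] -> R[i]) (a z x y w : R[i]).

Lemma geomX1 (s : R[i]) m : (1 + s) ^+ m - 1 = s * \sum_(i < m) (1 + s) ^+ i.
Proof. by rewrite subrX1 addrAC subrr add0r. Qed.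

Lemma Re_oppV w : w != 0 -> Re (- w^-1) = - Re w / nrm w ^+ 2.
Proof.
move=> w0; have n0 : nrm w ^+ 2 != 0 by rewrite expf_neq0 // nrm_eq0.
apply: (mulIf n0); rewrite divfK // mulrC -ReZ -mulcJ.
have -> : w * conjc w * - w^-1 = - conjc w by field.
by case: (w).
Qed.

(** Applied to [w = a * z^m], this keeps [w] within the angle [pi / 3] of the negative axis: a
    sector about each attracting direction of [z + a z^(m+1)]. In the coordinate [- w^-1] it
    surrounds the positive axis, hence is stable under translation to the right. *)
Definition cone w := Re w <= - (nrm w / 2).

Lemma coneE w : w != 0 -> cone w = (nrm (- w^-1) / 2 <= Re (- w^-1)).
Proof.
move=> w0; have n0 : 0 < nrm w by rewrite nrm_gt0.
rewrite Re_oppV // nrmN nrmV ler_pdivlMr ?exprn_gt0 //.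
have -> : (nrm w)^-1 / 2 * nrm w ^+ 2 = nrm w / 2 by field; exact: lt0r_neq0.
by rewrite /cone lerNr.
Qed.

Section Cone.
Variables (a : R[i]) (m : nat).
Hypotheses (a0 : a != 0) (m0 : (0 < m)%N).

(* The coordinate in which [z + a z^(m+1) + ...] becomes nearly the
   translation by [m]. *)
Definition zt z := - (a * z ^+ m)^-1.

(** The derivative of [zt] is [m / (a z^(m+1))], and for [x] relatively close to [z] the difference
    quotient is comparable to it. The factors [1/4] and [3] come from [P] and [S] lying within [1/2]
    of their limits [1] and [m]. *)
Lemma zt_pair : exists kap : R, [/\ 0 < kap, kap <= 2^-1 & forall z x, z != 0 ->
  nrm (x - z) <= kap * nrm z ->
  m%:R / 4 * nrm (x - z) <= nrm (zt x - zt z) * (nrm a * nrm z ^+ m.+1) <= 3 * m%:R * nrm (x - z)].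
Proof.
have m1 : 1 <= m%:R :> R by rewrite ler1n.
have h2 : 0 < 2^-1 :> R by rewrite invr_gt0.
have h1s (s : R[i]) : hol (fun s => 1 + s) s by apply: holD; [exact: hol_cst|exact: hol_id].
have [d d0 hd] := hol_cont (holX m (h1s 0)) h2.
have [d' d'0 hd'] := hol_cont (hol_sum (index_enum 'I_m) (fun i => holX i (h1s 0))) h2.
pose kap := Num.min 2^-1 (Num.min (d / 2) (d' / 2)).
have k0 : 0 < kap by rewrite !min_gt0 ?divr_gt0.
have [k1 k2 k3] : [/\ kap <= 2^-1, kap <= d / 2 & kap <= d' / 2].
  by rewrite /kap !ge_min !lexx !orbT.
exists kap; split => // z x z0 hx.
have nz : 0 < nrm z by rewrite nrm_gt0.
pose s := (x - z) / z.
have sn : nrm s <= kap by rewrite /s nrmf ler_pdivrMr.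
have xE : x = z * (1 + s) by rewrite /s; field.
have [hp hp'] := (hd s ltac:(lra), hd' s ltac:(lra)).
have Sm : \sum_(i < m) (1 + 0 : R[i]) ^+ i = m%:R.
  by under eq_bigr => i _ do rewrite addr0 expr1n; rewrite sumr_const card_ord.
rewrite /= !add0r addr0 expr1n in hp; rewrite /= !add0r Sm in hp'.
set P := (1 + s) ^+ m in hp; set S := \sum_(i < m) (1 + s) ^+ i in hp'.
have P1 : 2^-1 <= nrm P by have := nrm_lb 1 (1 - P); rewrite subKr nrm1 (nrmC 1); lra.
have P2 : nrm P <= 3 / 2 by have := nrm_lb P 1; rewrite nrm1; lra.
have P0 : P != 0 by rewrite -nrm_gt0; lra.
have S1 : m%:R / 2 <= nrm S.
  have := nrm_lb (m%:R : R[i]) (m%:R - S); rewrite subKr nrm_nat (nrmC m%:R); lra.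
have S2 : nrm S <= 3 * m%:R / 2 by have := nrm_lb S m%:R; rewrite nrm_nat; lra.
have E : (zt x - zt z) * (a * z ^+ m.+1) * P = (x - z) * S.
  have PE : P = 1 + s * S by rewrite -geomX1 /P; ring.
  have -> : x - z = z * s by rewrite /s; field.
  rewrite /zt xE exprMn -/P exprSr.
  have zm : z ^+ m != 0 by rewrite expf_neq0.
  have -> : (- (a * (z ^+ m * P))^-1 - - (a * z ^+ m)^-1) * (a * (z ^+ m * z)) * P = z * (P - 1).
    by field; rewrite a0 P0 zm.
  by rewrite PE; ring.
have := congr1 (@nrm R) E; rewrite !nrmM nrmX => {}E.
set T := nrm (zt x - zt z) * _ in E *.
have T0 : 0 <= T by rewrite !mulr_ge0 ?exprn_ge0 ?nrm_ge0.
have nd := nrm_ge0 (x - z).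
have := ler_wpM2l T0 P1; have := ler_wpM2l T0 P2.
have := ler_wpM2l nd S1; have := ler_wpM2l nd S2.
rewrite E => A1 A2 A3 A4.
have md : 0 <= m%:R * nrm (x - z) by rewrite mulr_ge0.
apply/andP; split.
  have -> : m%:R / 4 * nrm (x - z) = nrm (x - z) * (m%:R / 2) / 2 by field.
  lra.
have -> : 3 * m%:R * nrm (x - z) = 2 * (nrm (x - z) * (3 * m%:R / 2)) by field.
lra.
Qed.

Variables (h Q : R[i] -> R[i]) (rho : R).
Hypotheses (rho0 : 0 < rho) (hQ : forall z, nrm z < rho -> hol Q z) (Q0 : Q 0 = a)
  (hE : forall z, h z = z + z ^+ m.+1 * Q z).

(** The error in the translation by [m] extends holomorphically across the origin and vanishes
    there. It is therefore small and, which matters more, Lipschitz, so that [h] hardly changes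
    differences of [zt]. *)
Lemma zt_step : exists E (L r : R), [/\ 0 < L, 0 < r,
  forall z, nrm z <= r -> z != 0 -> [/\ h z != 0, zt (h z) = zt z + m%:R + E z & nrm (E z) <= 4^-1] &
  forall x y, nrm x <= r -> nrm y <= r -> nrm (E x - E y) <= L * nrm (x - y)].
Proof.
pose t z := z ^+ m * Q z.
have thol z : nrm z < rho -> hol t z by move=> hz; apply: holM; [apply: holX; exact: hol_id|exact: hQ].
have t0 : t 0 = 0 by rewrite /t expr0n eqn0Ngt m0 mul0r.
have z0r : nrm (0 : R[i]) < rho by rewrite nrm0.
have h2 : 0 < 2^-1 :> R by rewrite invr_gt0.
have [r1 r10 hr1] := hol_cont (thol 0 z0r) h2.
have t12 z : nrm z < r1 -> nrm (t z) < 2^-1 by move=> /hr1; rewrite add0r t0 subr0.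
have t1n z : nrm z < r1 -> 1 + t z != 0.
  by move=> /t12 hh; rewrite -nrm_gt0; have := nrm_lbD 1 (t z); rewrite nrm1; lra.
pose E z := (Q z / a) * (\sum_(i < m) (1 + t z) ^+ i) / (1 + t z) ^+ m - m%:R.
pose r2 := Num.min rho r1.
have r20 : 0 < r2 by rewrite min_gt0.
have Ehol z : nrm z < r2 -> hol E z.
  rewrite lt_min => /andP[z1 z2].
  have h1t : hol (fun z => 1 + t z) z by apply: holD; [exact: hol_cst|exact: thol].
  apply: holB; last exact: hol_cst.
  apply: holM; last by apply: holV; [exact: holX|rewrite expf_neq0 // t1n].
  apply: holM; last by apply: hol_sum => i; exact: holX.
  by apply: holM; [exact: hQ|exact: hol_cst].
have E0 : E 0 = 0.
  rewrite /E t0 addr0 Q0 divff // mul1r expr1n invr1 mulr1.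
  by under eq_bigr => i _ do rewrite expr1n; rewrite sumr_const card_ord subrr.
have [lam hlam] := Ehol 0 ltac:(by rewrite nrm0).
have [C [r3 [C0 r30 _ hC]]] := hol_C2 r20 Ehol hlam.
have h4 : 0 < 4^-1 :> R by rewrite invr_gt0.
have [r4 r40 hr4] := cd_cont hlam h4.
pose r := Num.min (Num.min (r2 / 2) r3) (Num.min (r4 / 2) 1).
have r0 : 0 < r by rewrite !min_gt0 ?divr_gt0.
have [q1 [q2 [q3 q4]]] : r <= r2 / 2 /\ r <= r3 /\ r <= r4 / 2 /\ r <= 1 by rewrite /r !ge_min !lexx !orbT.
have q5 : r2 <= r1 by rewrite /r2 ge_min lexx orbT.
exists E, (nrm lam + 2 * C + 1), r; split => //.
- by rewrite ltr_wpDl // addr_ge0 ?nrm_ge0 // mulr_ge0 // ltW.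
- move=> z zr z0; have tz := t1n z ltac:(lra).
  have hz : h z = z * (1 + t z) by rewrite hE /t exprS; ring.
  split; first by rewrite hz mulf_neq0.
    have zm : z ^+ m != 0 by rewrite expf_neq0.
    have tm : (1 + t z) ^+ m != 0 by rewrite expf_neq0.
    rewrite /zt hz exprMn /E.
    have G := geomX1 (t z) m; set P := (1 + t z) ^+ m in tm G *; set S := \sum_(i < m) _ in G *.
    have QE : Q z = t z / z ^+ m by rewrite /t; field.
    have -> : Q z / a * S / P = (t z * S) / (a * z ^+ m * P) by rewrite QE; field; rewrite a0 zm tm.
    rewrite -G; by field; rewrite a0 zm tm.
  by have := hr4 z ltac:(lra); rewrite add0r E0 subr0 => /ltW.
move=> x y hx hy; have h1 := hC x y ltac:(lra) ltac:(lra).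
have -> : E x - E y = (E x - E y - lam * (x - y)) + lam * (x - y) by ring.
apply: le_trans (nrmD _ _) _; rewrite nrmM.
have h3 : C * (nrm x + nrm y) * nrm (x - y) <= C * 2 * nrm (x - y).
  by rewrite ler_wpM2r ?nrm_ge0 // ler_pM2l //; lra.
have := nrm_ge0 (x - y); lra.
Qed.

(** In the sector [nrm (1 + w) <= 1 - 15/32 * nrm w] for small [w = a * z^m], and replacing [a] by
    [Q z] costs [nrm w / 16]. The decrease dominates [nrm z^(m+1)], which makes error sums along an
    orbit telescope. *)
Lemma cone_shrink : nearby (fun z => cone (a * z ^+ m) -> nrm (h z) <= nrm z - nrm a / 4 * nrm z ^+ m.+1).
Proof.
have na : 0 < nrm a by rewrite nrm_gt0.
have h16 : 0 < nrm a / 16 by rewrite divr_gt0.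
have p16 : 0 < 16^-1 :> R by rewrite invr_gt0.
have N1 := nearby_cont (hol_cont (hQ (z := 0) ltac:(by rewrite nrm0))) h16.
have N2 := nearby_pow p16 m0 (ltW na).
apply: nearbyS (nearbyI N1 N2) => z [h1 h2] hc.
pose w := a * z ^+ m; have wn : nrm w = nrm a * nrm z ^+ m by rewrite nrmM nrmX.
have w16 : nrm w <= 16^-1 by rewrite wn.
have -> : h z = z * (1 + w + z ^+ m * (Q z - a)) by rewrite hE /w exprS; ring.
rewrite nrmM exprSr mulrA; have -> : nrm z - nrm a / 4 * nrm z ^+ m * nrm z = nrm z * (1 - nrm w / 4) by rewrite wn; ring.
rewrite ler_wpM2l ?nrm_ge0 //; apply: le_trans (nrmD _ _) _; rewrite nrmM nrmX.
have h3 : nrm z ^+ m * nrm (Q z - a) <= nrm w / 16.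
  rewrite wn -Q0 in h1 *; have := ler_wpM2l (exprn_ge0 m (nrm_ge0 z)) (ltW h1); rewrite Q0; lra.
have h4 : nrm (1 + w) <= 1 - 15 / 32 * nrm w.
  rewrite -(@ler_pXn2r _ 2) ?nnegrE ?nrm_ge0 //; last by lra.
  have -> : nrm (1 + w) ^+ 2 = 1 + 2 * Re w + nrm w ^+ 2 by rewrite !nrm_sqr !(ReD, ImD) /=; ring.
  move: hc; rewrite /cone -/w => hc.
  have : nrm w * nrm w <= nrm w * 16^-1 by rewrite ler_wpM2l ?nrm_ge0.
  have : 0 <= nrm w * nrm w by rewrite mulr_ge0 ?nrm_ge0.
  rewrite !expr2; lra.
have := nrm_ge0 w; lra.
Qed.

End Cone.

(* In the coordinate [zt] a gap of [K] around a point of the attracting cone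
   is transported along the forward orbit with only a summable relative loss,
   whereas the gaps of [K] shrink to zero by density. *)
Lemma parabolic_cone a m h Q (rho : R) K hi : a != 0 -> (0 < m)%N -> 0 < rho ->
  (forall z, nrm z < rho -> hol Q z) -> Q 0 = a -> (forall z, h z = z + z ^+ m.+1 * Q z) ->
  cclosed K ->
  cont hi 0 -> hi 0 = 0 -> nearby (fun z => h (hi z) = z) -> Kgerm K hi ->
  (forall e : R, 0 < e -> nearby (fun z => z != 0 -> exists2 y, K y & nrm (y - z) <= e * nrm z ^+ m.+1)) ->
  nearby (fun z => z != 0 -> cone (a * z ^+ m) -> K z).
Proof.
move=> a0 m0 rho0 hQ Q0 hE Kc hic hi0 hhi Khi hdense.
have na : 0 < nrm a by rewrite nrm_gt0.
have m1 : 1 <= m%:R :> R by rewrite ler1n.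
have [kap [k0 k2 pair]] := zt_pair a0 m0.
have [E [L [r1 [L0 r10 step EL]]]] := zt_step a0 m0 rho0 hQ Q0 hE.
have [r2 r20 shrink] := cone_shrink a0 m0 rho0 hQ Q0 hE.
have hhol z : nrm z < rho -> hol h z.
  move=> hz; have [d hd] : hol (fun z => z + z ^+ m.+1 * Q z) z.
    by apply: holD; [exact: hol_id|apply: holM; [apply: holX; exact: hol_id|exact: hQ]].
  by exists d; apply: cd_ext hd => x; rewrite hE.
have h1 : cd h 0 1.
  have := cdD (cd_id 0) (cd_mulz (_ : hol (fun z => z ^+ m * Q z) 0)).
  rewrite expr0n eqn0Ngt m0 mul0r addr0.
  have hh : hol (fun z => z ^+ m * Q z) 0.
    by apply: holM; [apply: holX; exact: hol_id|apply: hQ; rewrite nrm0].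
  by move=> /(_ hh); apply: cd_ext => z; rewrite hE exprS mulrA.
have [C [r3 [C0 r30 _ hC]]] := hol_C2 rho0 hhol h1.
have c4 : 0 < (4 * C)^-1 by rewrite invr_gt0 mulr_gt0.
pose r4 := Num.min (Num.min r1 (r2 / 2)) (Num.min r3 (4 * C)^-1).
have r40 : 0 < r4 by rewrite !min_gt0 ?divr_gt0.
have [q1 [q2 [q3 q4]]] : r4 <= r1 /\ r4 <= r2 / 2 /\ r4 <= r3 /\ r4 <= (4 * C)^-1.
  by rewrite /r4 !ge_min !lexx !orbT.
clearbody r4.
have expand x z : nrm x <= r4 -> nrm z <= r4 -> nrm (x - z) <= 2 * nrm (h x - h z).
  move=> hx hz; have h2 := hC x z ltac:(rlra) ltac:(rlra).
  have h3 : C * (nrm x + nrm z) <= 2^-1.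
    have -> : 2^-1 = C * ((4 * C)^-1 + (4 * C)^-1) by field; exact: lt0r_neq0.
    by rewrite ler_pM2l //; rlra.
  have := ler_wpM2r (nrm_ge0 (x - z)) h3; rewrite mul1r in h2.
  have := nrm_lb (x - z) (- (h x - h z - (x - z))); rewrite nrmN opprK.
  have -> : x - z + (h x - h z - (x - z)) = h x - h z by ring.
  rlra.
have N1 := nearby_comp hic hi0 (nearby_lt r40).
have k8 : 0 < kap / 8 by rewrite divr_gt0.
have N2 := nearby_pow k8 m0 (ltW na).
have [r5 r50 hr5] := nearbyI (nearbyI N1 N2) (nearbyI hhi Khi).
pose CC := 16 * L + 1.
have CC0 : 0 < CC by rewrite ltr_wpDl // mulr_ge0 // ltW.
have CCL : 16 * L <= CC by rewrite lerDl.
clearbody CC.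
exists (Num.min (Num.min r4 (r5 / 2)) (CC^-1 / 2)).
  by rewrite !min_gt0 ?divr_gt0 // invr_gt0.
move=> z0; rewrite !lt_min => /andP[/andP[z04 z05] z0C] z00 c0; apply: contrapT => nK.
have nz0 : 0 < nrm z0 by rewrite nrm_gt0.
pose zz n := iter n h z0.
have stepz z : z != 0 -> nrm z <= nrm z0 -> cone (a * z ^+ m) ->
    [/\ h z != 0, cone (a * h z ^+ m) & nrm (h z) <= nrm z - nrm a / 4 * nrm z ^+ m.+1].
  move=> zn0 zle cz; have [s1 s2 s3] := step z ltac:(rlra) zn0.
  split => //; last by apply: shrink => //; rlra.
  rewrite coneE ?mulf_neq0 ?expf_neq0 // -/(zt a m (h z)) s2.
  move: cz; rewrite coneE ?mulf_neq0 ?expf_neq0 // -/(zt a m z) => cz.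
  rewrite !ReD; have := Re_ge (E z).
  have -> : Re (m%:R : R[i]) = m%:R by rewrite -(rmorph_nat (real_complex R)).
  have := nrmD (zt a m z + m%:R) (E z); have := nrmD (zt a m z) m%:R; rewrite nrm_nat; rlra.
have inv n : [/\ zz n != 0, nrm (zz n) <= nrm z0 & cone (a * zz n ^+ m)].
  elim: n => [|n [i1 i2 i3]]; first by split.
  have [j1 j2 j3] := stepz _ i1 i2 i3; split => //=; apply: (le_trans j3).
  have : 0 <= nrm a / 4 * nrm (zz n) ^+ m.+1 by rewrite mulr_ge0 ?exprn_ge0 ?nrm_ge0 // divr_ge0 // ltW.
  rlra.
have dec n : nrm (zz n.+1) <= nrm (zz n) - nrm a / 4 * nrm (zz n) ^+ m.+1.
  by have [i1 i2 i3] := inv n; have [] := stepz _ i1 i2 i3.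
have [del d0 hdel] : exists2 del : R, 0 < del & forall y, K y -> del <= nrm (y - z0).
  apply: contrapT => hN; apply: nK; apply: Kc => e e0; apply: contrapT => hN'; apply: hN.
  by exists e => // y Ky; rewrite leNgt; apply/negP => hy; apply: hN'; exists y.
have m14 : 4^-1 <= m%:R / 4 :> R by clear - m1; lra.
have az0 : 0 < nrm a * nrm z0 ^+ m.+1 by rewrite mulr_gt0 // exprn_gt0.
(* The initial gap of [K] about [z0], converted to the coordinate [zt] by [zt_pair] and capped at
   [1]. *)
pose q0 := Num.min 1 (m%:R / 4 * del / (nrm a * nrm z0 ^+ m.+1)).
have m40 : 0 < m%:R / 4 :> R by rewrite divr_gt0 //; rlra.
have q00 : 0 < q0 by rewrite min_gt0 // divr_gt0 // mulr_gt0.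
have [q01 q02] : q0 <= 1 /\ q0 <= m%:R / 4 * del / (nrm a * nrm z0 ^+ m.+1).
  by rewrite /q0 !ge_min !lexx orbT.
clearbody q0.
(* At each step the gap loses a fraction proportional to the decrease of the modulus; in total at
   most [CC * nrm z0 <= 1/2] of it is lost. *)
have gap n : forall y, K y -> nrm (y - zz n) <= kap * nrm (zz n) ->
    q0 * (1 - CC * (nrm z0 - nrm (zz n))) <= nrm (zt a m y - zt a m (zz n)).
  elim: n => [|n IH] y Ky hy.
    rewrite /= subrr mulr0 subr0 mulr1; have /andP[p1 _] := pair _ _ z00 hy.
    apply: (le_trans q02).
    rewrite ler_pdivrMr //; apply: le_trans p1; rewrite ler_pM2l //; exact: hdel.
  have [i1 i2 i3] := inv n; have [j1 j2 j3] := inv n.+1.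
  set z := zz n in i1 i2 i3 IH *; set z' := zz n.+1 in j1 j2 j3 hy *.
  have z'E : z' = h z by [].
  have decn : nrm z' <= nrm z - nrm a / 4 * nrm z ^+ m.+1 by exact: dec.
  clearbody z z'.
  have nz : 0 < nrm z by rewrite nrm_gt0.
  have nz' : 0 < nrm z' by rewrite nrm_gt0.
  have zm : 0 <= nrm z ^+ m.+1 by rewrite exprn_ge0 ?nrm_ge0.
  have dz : nrm a / 4 * nrm z ^+ m.+1 <= nrm z - nrm z' by rlra.
  have z'z : nrm z' <= nrm z.
    have : 0 <= nrm a / 4 * nrm z ^+ m.+1 by rewrite mulr_ge0 // divr_ge0 // ltW.
    rlra.
  have A1 : CC * (nrm z0 - nrm z') <= 2^-1.
    apply: le_trans (_ : CC * (CC^-1 / 2) <= _); first by rewrite ler_pM2l //; clear - z0C nz'; lra.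
    by rewrite mulrA divff ?lt0r_neq0 // mul1r.
  have A2 : 0 <= CC * (nrm z0 - nrm z') by rewrite mulr_ge0 ?subr_ge0 // ltW.
  (* Only points of [K] closer than [1] in this coordinate threaten the gap, and these can be pulled
     back by [hi] into the range of the induction hypothesis. *)
  have [big|small] := leP 1 (nrm (zt a m y - zt a m z')).
    apply: le_trans big; apply: le_trans q01; rewrite -[leRHS]mulr1 ler_pM2l //; clear - A2; lra.
  have /andP[p1 _] := pair _ _ j1 hy.
  have az' : 0 < nrm a * nrm z' ^+ m.+1 by rewrite mulr_gt0 // exprn_gt0.
  have y1 : nrm (y - z') <= 4 * (nrm a * nrm z ^+ m.+1).
    have : nrm (zt a m y - zt a m z') * (nrm a * nrm z' ^+ m.+1) <= nrm a * nrm z' ^+ m.+1.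
      by rewrite -[leRHS]mul1r ler_pM2r // ltW.
    have : nrm a * nrm z' ^+ m.+1 <= nrm a * nrm z ^+ m.+1 by rewrite ler_pM2l // lerXn2r ?nnegrE ?nrm_ge0.
    have q := ler_wpM2r (nrm_ge0 (y - z')) m14.
    move=> f1 f2; clear - p1 f1 f2 q; lra.
  have yr5 : nrm y < r5.
    have q := nrm_lb y z'; have : kap * nrm z' <= 2^-1 * nrm z' by rewrite ler_pM2r.
    move=> f1; clear - q f1 hy z'z i2 z05 nz; lra.
  have [[x4 _] [hx Kx]] := hr5 y yr5; have {}Kx := Kx Ky.
  move: x4 => /= x4; set x := hi y in x4 hx Kx; clearbody x.
  have xr4 : nrm x <= r4 by exact: ltW.
  have zr4 : nrm z <= r4 by apply: (le_trans i2); exact: ltW.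
  have [xr1 zr1] := (le_trans xr4 q1, le_trans zr4 q1).
  have xz : nrm (x - z) <= 2 * nrm (y - z').
    by have := expand x z xr4 zr4; rewrite hx -z'E.
  have xk : nrm (x - z) <= kap * nrm z.
    have [[_ pw] _] := hr5 z ltac:(clear - i2 z05 nz; lra).
    have := ler_wpM2r (ltW nz) pw; rewrite -(mulrA (nrm a)) -exprSr => pw'.
    clear - xz y1 pw'; lra.
  have IHx := IH x Kx xk.
  have /andP[p2 _] := pair _ _ i1 xk.
  have [_ s2 _] := step z zr1 i1.
  have [x0|xn0] := eqVneq x 0.
    have := xk; rewrite x0 sub0r nrmN => h3.
    have : kap * nrm z <= 2^-1 * nrm z by rewrite ler_wpM2r // nrm_ge0.
    move=> f1; clear - h3 f1 nz; lra.
  have [_ sx _] := step x xr1 xn0.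
  have D : zt a m y - zt a m z' = (zt a m x - zt a m z) + (E x - E z) by rewrite -hx z'E sx s2; ring.
  have Ex := EL x z xr1 zr1.
  have T0 := nrm_ge0 (zt a m x - zt a m z).
  (* The Lipschitz bound on [E] becomes relative: [nrm (x - z)] is at most a constant times
     [nrm a * nrm z^(m+1)] times the distance in [zt], and that power is controlled by
     [nrm z - nrm z']. *)
  have Ex2 : nrm (E x - E z) <= nrm (zt a m x - zt a m z) * (CC * (nrm z - nrm z')).
    apply: (le_trans Ex).
    have e1 : nrm (x - z) <= 4 * (nrm (zt a m x - zt a m z) * (nrm a * nrm z ^+ m.+1)).
      have q := ler_wpM2r (nrm_ge0 (x - z)) m14.
      clear - p2 q; lra.
    have e2 : nrm (zt a m x - zt a m z) * (nrm a * nrm z ^+ m.+1) <= nrm (zt a m x - zt a m z) * (4 * (nrm z - nrm z')).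
      by rewrite ler_wpM2l //; clear - dz; lra.
    have e3 := ler_wpM2l (ltW L0) (le_trans e1 (ler_wpM2l (ler0n R 4) e2)).
    apply: (le_trans e3).
    have -> : L * (4 * (nrm (zt a m x - zt a m z) * (4 * (nrm z - nrm z')))) = nrm (zt a m x - zt a m z) * ((16 * L) * (nrm z - nrm z')) by ring.
    by rewrite ler_wpM2l // ler_wpM2r ?subr_ge0.
  rewrite D; have := nrm_lbD (zt a m x - zt a m z) (E x - E z) => h6.
  set T := nrm (zt a m x - zt a m z) in T0 IHx Ex2 h6.
  set u := CC * (nrm z0 - nrm z) in IHx; set v := CC * (nrm z - nrm z') in Ex2.
  have uv : CC * (nrm z0 - nrm z') = u + v by rewrite /u /v; ring.
  rewrite uv in A1 A2 *.
  have u0 : 0 <= u by rewrite mulr_ge0 ?subr_ge0 // ltW.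
  have v0 : 0 <= v by rewrite mulr_ge0 ?subr_ge0 // ltW.
  have v1 : 0 <= 1 - v by clear - A1 u0; lra. clearbody u v.
  have h7 := ler_wpM2r v1 IHx.
  have : 0 <= q0 * (u * v) by rewrite !mulr_ge0 // ltW.
  have -> : q0 * (u * v) = q0 * (1 - u) * (1 - v) - q0 * (1 - (u + v)) by ring.
  rewrite mulrBr mulr1 in h7; move=> f1; clear - f1 h6 h7 Ex2; lra.
have small (t : R) : 0 < t -> exists n, nrm (zz n) < t.
  move=> t0; apply: contrapT => hN.
  have ge n : t <= nrm (zz n) by rewrite leNgt; apply/negP => hn; apply: hN; exists n.
  pose dd := nrm a / 4 * t ^+ m.+1.
  have dd0 : 0 < dd by rewrite mulr_gt0 ?exprn_gt0 // divr_gt0.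
  have le n : nrm (zz n) <= nrm z0 - n%:R * dd.
    elim: n => [|n IH]; first by rewrite mul0r subr0.
    have := dec n; have : dd <= nrm a / 4 * nrm (zz n) ^+ m.+1.
      by rewrite ler_pM2l ?divr_gt0 // lerXn2r ?nnegrE ?nrm_ge0 // ltW.
    rewrite -[n.+1%:R]natr1 mulrDl mul1r; rlra.
  have [n /(_ n (leqnn n))] := exists_gt_nat (nrm z0 / dd).
  rewrite ltr_pdivrMr // => hn; have := le n; have := nrm_ge0 (zz n); rlra.
(* Density at this scale yields a point of [K] at distance at most [q0 / 4] in [zt], against the
   surviving gap [q0 / 2]. *)
pose e := q0 * nrm a / (12 * m%:R).
have m00 : 0 < 12 * m%:R :> R by rewrite mulr_gt0 //; rlra.
have e0 : 0 < e by rewrite /e divr_gt0 // mulr_gt0.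

have [r6 r60 hr6] := nearbyI (hdense e e0) (nearby_pow k0 m0 (ltW e0)).
have [n hn] := small r6 r60.
have [i1 i2 i3] := inv n.
have [hy1 hy2] := hr6 _ hn; have [y Ky hy] := hy1 i1.
have nz : 0 < nrm (zz n) by rewrite nrm_gt0.
have yk : nrm (y - zz n) <= kap * nrm (zz n).
  by apply: (le_trans hy); rewrite exprSr mulrA ler_wpM2r // ltW.
have g1 := gap n y Ky yk.
have /andP[_ p2] := pair _ _ i1 yk.
have az : 0 < nrm a * nrm (zz n) ^+ m.+1 by rewrite mulr_gt0 // exprn_gt0.
have A1 : CC * (nrm z0 - nrm (zz n)) <= 2^-1.
  apply: le_trans (_ : CC * (CC^-1 / 2) <= _); first by rewrite ler_pM2l //; rlra.
  by rewrite mulrA divff ?lt0r_neq0 // mul1r.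
have g2 : q0 / 2 <= nrm (zt a m y - zt a m (zz n)).
  by apply: le_trans g1; rewrite ler_pM2l //; rlra.
have g3 : nrm (zt a m y - zt a m (zz n)) * (nrm a * nrm (zz n) ^+ m.+1) <= q0 / 4 * (nrm a * nrm (zz n) ^+ m.+1).
  apply: (le_trans p2); have h8 := ler_wpM2l (mulr_ge0 (ler0n R 3) (ler0n R m)) hy.
  apply: (le_trans h8); rewrite /e.
  have -> : 3 * m%:R * (q0 * nrm a / (12 * m%:R) * nrm (zz n) ^+ m.+1) = q0 / 4 * (nrm a * nrm (zz n) ^+ m.+1).
    by field; rlra.
  by [].
rewrite ler_pM2r // in g3; rlra.
Qed.
End Parabolic.

(** * The commutator of two germs with a common invariant set *)

Section Commute.
Variable R : realType.
Implicit Types (K : set R[i]) (f fi g gi h hi Q : R[i] -> R[i]) (a lam mu z x y w : R[i]).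

Lemma iter_cd f lam j : f 0 = 0 -> cd f 0 lam -> iter j f 0 = 0 /\ cd (iter j f) 0 (lam ^+ j).
Proof.
move=> f0 hf; elim: j => [|j [IH1 IH2]]; first by split=> //; rewrite expr0; apply: cd_id.
split; first by rewrite /= IH1.
rewrite exprS; apply: (cd_comp (F := iter j f) (G := f)) => //; by rewrite IH1.
Qed.

Lemma Kgerm_iter K f lam j : f 0 = 0 -> cd f 0 lam -> Kgerm K f -> Kgerm K (iter j f).
Proof.
move=> f0 hf hK; elim: j => [|j IH]; first by exists 1.
have [i1 i2] := iter_cd j f0 hf.
by apply: nearbyS (nearbyI IH (nearby_comp (cd_cont i2) i1 hK)) => z [] h1 h2 /h1 /h2.
Qed.

Lemma iter_nearby f lam j (e : R) : f 0 = 0 -> cd f 0 lam -> 0 < e ->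
  nearby (fun z => nrm (iter j f z - lam ^+ j * z) <= e * nrm z).
Proof.
move=> f0 hf e0; have [i1 i2] := iter_cd j f0 hf.
have [r r0 hr] := i2 e e0; exists r => // z /hr; by rewrite add0r i1 subr0.
Qed.

Lemma iter_pullback K f fi lam j : f 0 = 0 -> cd f 0 lam -> nearby (fun z => fi (f z) = z) ->
  Kgerm K fi -> nearby (fun z => K (iter j f z) -> K z).
Proof.
move=> f0 hf hfi Kfi; elim: j => [|j IH]; first by exists 1.
have [i1 i2] := iter_cd j f0 hf.
have [i3 i4] := iter_cd j.+1 f0 hf.
have N1 := nearby_comp (cd_cont i2) i1 hfi.
have N2 := nearby_comp (cd_cont i4) i3 Kfi.
by apply: nearbyS (nearbyI IH (nearbyI N1 N2)) => z /= [] h1 [h2 h3] /h3; rewrite h2.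
Qed.

Lemma holn_comp f g : holn f -> holn g -> g 0 = 0 -> holn (f \o g).
Proof.
move=> hf hg g0; have [rg rg0 hrg] := hg.
have gc : cont g 0 by apply: hol_cont; apply: hrg; rewrite nrm0.
have [r r0 hr] := nearbyI (nearby_comp gc g0 hf) hg.
by exists r => // z /hr[h1 h2]; apply: hol_comp.
Qed.

Lemma asy_factor h Q m : hol Q 0 -> (forall z, h z = z + z ^+ m * Q z) -> asy h (Q 0) m.
Proof.
move=> hQ hE e e0; apply: nearbyS (nearby_cont (hol_cont hQ) e0) => z hz.
have -> : h z - z - Q 0 * z ^+ m = z ^+ m * (Q z - Q 0) by rewrite hE; ring.
by rewrite nrmM nrmX mulrC ler_wpM2r ?exprn_ge0 ?nrm_ge0 // ltW.
Qed.

(** [K] meets every small circle, and an iterate of [f] nearly rotates the point found there onto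
    [z]; the choice of the rotation and the linearization of the iterate cost [nrm z / 8] each. This
    crude density is the starting point for [near_translations_dense]. *)
Lemma near_rotations K f alpha : Defs.irrational alpha ->
  f 0 = 0 -> cd f 0 (multiplier alpha) -> Kgerm K f ->
  nearby (fun z => exists2 k, K k & nrm k = nrm z) ->
  nearby (fun z => z != 0 -> exists2 y, K y & nrm (y - z) <= nrm z / 2).
Proof.
move=> ha f0 hf Kf hcirc; have e8 : 0 < 8^-1 :> R by rewrite invr_gt0.
have [J hJ] := rot_dense ha e8.
have N1 := nearby_fin J (fun j => Kgerm_iter j f0 hf Kf).
have N2 := nearby_fin J (fun j => iter_nearby j f0 hf e8).
have [r r0 hr] := nearbyI N1 N2; have [r' r'0 hr'] := hcirc.
exists (Num.min r r'); first by rewrite min_gt0.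
move=> z; rewrite lt_min => /andP[z1 z2] zn0.
have [k Kk kz] := hr' z z2; have [h1 h2] := hr k ltac:(by rewrite kz).
have nz : 0 < nrm z by rewrite nrm_gt0.
have k0 : k != 0 by rewrite -nrm_gt0 kz.
have [j jJ hj] := hJ (z / k) ltac:(by rewrite nrmf kz divff // lt0r_neq0).
exists (iter j f k); first by apply: h1.
have := h2 j jJ; rewrite kz => h3.
have -> : iter j f k - z = (iter j f k - multiplier alpha ^+ j * k) + (multiplier alpha ^+ j - z / k) * k by field.
apply: le_trans (nrmD _ _) _; rewrite nrmM kz.
have : nrm (multiplier alpha ^+ j - z / k) * nrm z <= 8^-1 * nrm z by rewrite ler_pM2r // ltW.
lra.
Qed.

(** An iterate of [f] rotates any small [z] next to an attracting axis, hence into [K], and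
    membership is pulled back by [fi]. Finitely many iterates serve all directions, so a single
    neighbourhood results. *)
Lemma cone_pullback K f fi alpha a m : Defs.irrational alpha ->
  f 0 = 0 -> cd f 0 (multiplier alpha) -> nearby (fun z => fi (f z) = z) -> Kgerm K fi ->
  K 0 -> a != 0 -> (0 < m)%N -> nearby (fun z => z != 0 -> cone (a * z ^+ m) -> K z) -> nearby K.
Proof.
move=> ha f0 hf hfi Kfi K0 a0 m0 hcone.
have na : 0 < nrm a by rewrite nrm_gt0.
(* A unit attracting direction: [a * v0^m] is a negative real number. *)
pose v0 := m.-root (- (nrm a)%:C%C / a).
have v0m : a * v0 ^+ m = - (nrm a)%:C%C by rewrite /v0 rootCK //; field.
have nv0 : nrm v0 = 1.
  have : nrm v0 ^+ m = 1.
    apply: (mulfI (lt0r_neq0 na)); rewrite -nrmX -nrmM v0m nrmN nrm_real mulr1 ger0_norm //; exact: ltW.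
  by move/eqP; rewrite pexpr_eq1 ?nrm_ge0 // => /eqP.
have v00 : v0 != 0 by rewrite -nrm_gt0 nv0.
have h1s (s : R[i]) : hol (fun s => 1 + s) s by apply: holD; [exact: hol_cst|exact: hol_id].
have e4 : 0 < 4^-1 :> R by rewrite invr_gt0.
have [d d0 hd] := hol_cont (holX m (h1s 0)) e4.
have d4 : 0 < d / 4 by rewrite divr_gt0.
have [J hJ] := rot_dense ha d4.
have N1 := nearby_fin J (fun j => iter_pullback j f0 hf hfi Kfi).
have N2 := nearby_fin J (fun j => iter_nearby j f0 hf d4).
have N3 := nearby_fin J (fun j => let (i1, i2) := iter_cd j f0 hf in nearby_comp (cd_cont i2) i1 hcone).
apply: nearbyS (nearbyI (nearbyI N1 N2) N3) => z [[h1 h2] h3].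
have [->//|z0] := eqVneq z 0.
have nz : 0 < nrm z by rewrite nrm_gt0.
have nzC : (nrm z)%:C%C != 0 :> R[i] by rewrite -nrm_gt0 nrm_real ger0_norm // ltW.
have [j jJ hj] := hJ (v0 * (nrm z)%:C%C / z) ltac:(by rewrite nrmf nrmM nv0 nrm_real mul1r ger0_norm ?divff // ?lt0r_neq0 // ltW).
apply: (h1 j jJ); set lj := multiplier alpha ^+ j in hj.
pose s := ((lj - v0 * (nrm z)%:C%C / z) * z + (iter j f z - lj * z)) / (v0 * (nrm z)%:C%C).
have fE : iter j f z = v0 * (nrm z)%:C%C * (1 + s) by rewrite /s; field; rewrite nzC v00 z0.
have sd : nrm s < d.
  rewrite /s nrmf nrmM nv0 nrm_real mul1r (ger0_norm (ltW nz)) ltr_pdivrMr //.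
  apply: le_lt_trans (nrmD _ _) _; rewrite nrmM.
  have : nrm (lj - v0 * (nrm z)%:C%C / z) * nrm z <= d / 4 * nrm z by rewrite ler_pM2r // ltW.
  have := h2 j jJ; have : 0 < d * nrm z by rewrite mulr_gt0.
  rewrite -/lj => b1 b2 b3; clear -b1 b2 b3; lra.
clearbody s; have := hd s sd; rewrite /= !add0r addr0 expr1n; set P := (1 + s) ^+ m => hP.
have P1 : nrm P <= 5 / 4 by have := nrm_lb P 1; rewrite nrm1; lra.
have P2 : 3 / 4 <= nrm P by have := nrm_lb 1 (1 - P); rewrite subKr nrm1 (nrmC 1); lra.
have P3 : 3 / 4 <= Re P.
  have := Re_ge (P - 1); rewrite ReD ReN /=; lra.
have P0 : P != 0 by rewrite -nrm_gt0; lra.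
apply: h3 => //.
  rewrite fE !mulf_neq0 //; apply: contraNneq P0 => e; by rewrite /P e expr0n eqn0Ngt m0.
have -> : a * iter j f z ^+ m = (- (nrm a * nrm z ^+ m))%:C%C * P.
  rewrite fE !exprMn -/P !mulrA v0m; congr (_ * _).
  by rewrite rmorphN rmorphM rmorphXn mulNr.
have t0 : 0 < nrm a * nrm z ^+ m by rewrite mulr_gt0 // exprn_gt0.
rewrite /cone ReZ nrmM nrm_real normrN (ger0_norm (ltW t0)) mulNr lerN2 -mulrA ler_pM2l //; lra.
Qed.

Lemma commute_or_interior K f fi g gi alpha mu : Defs.irrational alpha ->
  cclosed K -> cbounded K -> K 0 -> nearby (fun z => exists2 k, K k & nrm k = nrm z) ->
  holn f -> f 0 = 0 -> cd f 0 (multiplier alpha) ->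
  holn fi -> fi 0 = 0 -> cd fi 0 (multiplier alpha)^-1 ->
  nearby (fun z => f (fi z) = z) -> nearby (fun z => fi (f z) = z) -> Kgerm K f -> Kgerm K fi ->
  holn g -> g 0 = 0 -> cd g 0 mu -> mu != 0 ->
  holn gi -> gi 0 = 0 -> cd gi 0 mu^-1 ->
  nearby (fun z => g (gi z) = z) -> nearby (fun z => gi (g z) = z) -> Kgerm K g -> Kgerm K gi ->
  nearby (fun z => f (g z) = g (f z)) \/ nearby K.
Proof.
set lam := multiplier alpha.
move=> ha Kc Kb K0 hcirc hf f0 df hfi fi0 dfi ffi fif Kf Kfi hg g0 dg mu0 hgi gi0 dgi ggi gig Kg Kgi.
have lam0 : lam != 0 by rewrite -nrm_gt0 nrm_multiplier.
have [cf cfi cg cgi] := And4 (cd_cont df) (cd_cont dfi) (cd_cont dg) (cd_cont dgi).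
have Kcomp p q : cont q 0 -> q 0 = 0 -> Kgerm K p -> Kgerm K q -> Kgerm K (p \o q).
  by move=> cq q0 Kp Kq; apply: nearbyS (nearbyI Kq (nearby_comp cq q0 Kp)) => z [h1 h2] /h1 /h2.
have hfg : holn (fi \o gi) by apply: holn_comp.
have hgf : holn (gi \o fi) by apply: holn_comp.
have dh1 : cd (fi \o gi) 0 (lam^-1 * mu^-1) by apply: cd_comp; rewrite ?gi0.
have dh2 : cd (g \o (fi \o gi)) 0 (mu * (lam^-1 * mu^-1)) by apply: cd_comp; rewrite /= ?gi0 ?fi0.
have dh3 : cd (f \o (g \o (fi \o gi))) 0 1.
  have -> : 1 = lam * (mu * (lam^-1 * mu^-1)) by field; rewrite lam0 mu0.
  by apply: cd_comp; rewrite /= ?gi0 ?fi0 ?g0.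
have dk1 : cd (gi \o fi) 0 (mu^-1 * lam^-1) by apply: cd_comp; rewrite ?fi0.
have dk2 : cd (f \o (gi \o fi)) 0 (lam * (mu^-1 * lam^-1)) by apply: cd_comp; rewrite /= ?gi0 ?fi0 ?gi0.
pose h := f \o (g \o (fi \o gi)); pose hi := g \o (f \o (gi \o fi)).
have h0 : h 0 = 0 by rewrite /h /= gi0 fi0 g0.
have hi0 : hi 0 = 0 by rewrite /hi /= fi0 gi0 f0.
have hh : holn h.
  apply: (@holn_comp f) => //; last by rewrite /= gi0 fi0.
  by apply: (@holn_comp g) => //=; rewrite gi0.
have Kh : Kgerm K h.
  apply: (Kcomp _ _) => //; [exact: cd_cont dh2|by rewrite /= gi0 fi0|].
  apply: (Kcomp _ _) => //; [exact: cd_cont dh1|by rewrite /= gi0|exact: Kcomp].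
have chi : cont hi 0.
  have : cd hi 0 (mu * (lam * (mu^-1 * lam^-1))) by apply: cd_comp; rewrite /= ?fi0 ?gi0 ?f0.
  exact: cd_cont.
have Khi : Kgerm K hi.
  apply: (Kcomp _ _) => //; [exact: cd_cont dk2|by rewrite /= fi0 gi0|].
  apply: (Kcomp _ _) => //; [exact: cd_cont dk1|by rewrite /= fi0|exact: Kcomp].
have hhi : nearby (fun z => h (hi z) = z).
  have n1 := nearby_comp (cd_cont dk2) ltac:(by rewrite /= fi0 gi0) gig.
  have n2 := nearby_comp (cd_cont dk1) ltac:(by rewrite /= fi0) fif.
  have n3 := nearby_comp cfi fi0 ggi.
  apply: nearbyS (nearbyI (nearbyI n1 n2) (nearbyI n3 ffi)) => z [[e1 e2] [e3 e4]].
  by move: e1 e2 e3 e4; rewrite /h /hi /= => -> -> -> ->.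
have [rho rho0 hrho] := hh.
have hH z : nrm z < rho -> hol (fun z => h z - z) z.
  by move=> zr; apply: holB; [exact: hrho|exact: hol_id].
have dH : cd (fun z => h z - z) 0 0.
  have := cdD dh3 (cdM (cd_cst (-1) 0) (cd_id 0)).
  rewrite mul0r add0r mulr1 addrN; apply: cd_ext => z; by rewrite mulN1r.
have [id|[k [Q [hQ Q0 HE]]]] := hol_order rho0 hH.
  left; have hid : nearby (fun z => h z = z).
    by exists rho => // z /id /eqP; rewrite subr_eq0 => /eqP.
  have cgf : cont (g \o f) 0 by apply: cd_cont; apply: cd_comp; [exact: df|rewrite f0; exact: dg].
  have n1 := nearby_comp cgf ltac:(by rewrite /= f0) hid.
  have n2 := nearby_comp cf f0 gig.
  apply: nearbyS (nearbyI (nearbyI n1 n2) fif) => z [[e1 e2] e3].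
  by move: e1 e2 e3; rewrite /h /= => e1 e2 e3; rewrite -[RHS]e1 e2 e3.
right.
have Qh0 : hol Q 0 by apply: hQ; rewrite nrm0.
(* Orders [0] and [1] are excluded by [h 0 = 0] and by the derivative [1] of [h] at [0]. *)
case: k HE => [|[|m]] HE.
- by have := HE 0; rewrite h0 subr0 expr0 mul1r => e; rewrite -e eqxx in Q0.
- have d2 : cd (fun z => h z - z) 0 (Q 0).
    by apply: cd_ext (cd_mulz Qh0) => z; rewrite HE expr1.
  by rewrite (cd_unique d2 dH) eqxx in Q0.
have hE z : h z = z + z ^+ m.+2 * Q z by rewrite -HE addrC subrK.
(* Each conjugation by [f] multiplies the leading coefficient by [lam^-(m+1)], again an irrational
   rotation, so the [c j] are dense in the circle of radius [nrm (Q 0)]. *)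
pose psi := fix psi j := if j is j.+1 then f \o psi j \o fi else h.
pose c := fun j => Q 0 * multiplier ((- (m.+1%:Z))%:~R * alpha) ^+ j.
have lamE : lam / lam ^+ m.+2 = multiplier ((- (m.+1%:Z))%:~R * alpha).
  have -> : (- (m.+1%:Z))%:~R * alpha = - (m.+1%:R * alpha) by rewrite rmorphN mulNr.
  rewrite multiplierN multiplier_nat -/lam [lam ^+ m.+2]exprS; field.
  by rewrite lam0 expf_neq0.
have psia j : asy (psi j) (c j) m.+2.
  elim: j => [|j IH]; first by rewrite /c expr0 mulr1; exact: asy_factor.
  have -> : c j.+1 = c j * (lam / lam ^+ m.+2) by rewrite lamE /c exprSr mulrA.
  exact: asy_conj hf f0 df lam0 hfi fi0 dfi ffi _ IH.
have psiK j : Kgerm K (psi j).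
  elim: j => [//|j IH]; have [p0 pc] := asy_cont (isT : (1 < m.+2)%N) (psia j).
  have Kpf := Kcomp _ _ cfi fi0 IH Kfi.
  have pf0 : (psi j \o fi) 0 = 0 by rewrite /= fi0.
  have cpf : cont (psi j \o fi) 0; last exact: (Kcomp f _ cpf pf0 Kf Kpf).
  move=> e e0.
  have [r r0 hr] := nearby_comp cfi fi0 (nearby_cont pc e0).
  by exists r => // w /hr; rewrite /= add0r fi0.
have hdense := near_translations_dense Kc Kb (isT : (1 < m.+2)%N) Q0 psiK psia.
have dens (e : R) : 0 < e -> exists J, forall v, nrm v = 1 -> exists2 j, (j < J)%N & nrm (c j - Q 0 * v) < e.
  move=> e0; have nQ : 0 < nrm (Q 0) by rewrite nrm_gt0.
  have hm : - (m.+1%:Z) != 0 by rewrite oppr_eq0.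
  have [J hJ] := rot_dense (irrationalM ha hm) (divr_gt0 e0 nQ).
  exists J => v /hJ[j jJ hj]; exists j => //.
  by rewrite /c -mulrBr nrmM mulrC -ltr_pdivlMr.
have hd2 := hdense dens (near_rotations ha f0 df Kf hcirc).
have hcone := parabolic_cone Q0 (ltn0Sn m) rho0 hQ erefl hE Kc chi hi0 hhi Khi hd2.
exact: cone_pullback ha f0 df fif Kfi K0 Q0 (ltn0Sn m) hcone.
Qed.
End Commute.

(** * From Siegel compacta to germs *)

Section Siegel.
Variable R : realType.
Implicit Types (K S U : set (Cplx R)) (f F G : Cplx R -> Cplx R) (a lam mu z x y w : Cplx R).

Lemma nearbyP (P : Cplx R -> Prop) : (\forall z \near (0 : Cplx R), P z) <-> nearby P.
Proof.
split=> [/nearC[r r0 hr]|[r r0 hr]]; first by exists r => // z zr; apply: hr; rewrite subr0.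
by apply/nearC; exists r => // z; rewrite subr0; exact: hr.
Qed.

Lemma cclosedP S : closed S <-> cclosed S.
Proof.
rewrite -[S in closed S]setCK closedC; split=> [/openC hS z hz|hS].
  apply: contrapT => nS; have [r r0 hr] := hS z nS.
  by have [x Sx /hr] := hz r r0.
apply/openC => z nS; apply: contrapT => hN; apply: nS; apply: hS => e e0.
apply: contrapT => hN'; apply: hN; exists e => // x hx Sx.
by apply: hN'; exists x.
Qed.

Lemma compact_cclosed K : compact K -> cclosed K.
Proof. by move=> Kc; apply/cclosedP; apply: compact_closed => //; exact: norm_hausdorff. Qed.

Lemma compact_cbounded K : compact K -> cbounded K.
Proof.
move=> Kc; apply: contrapT => nb.
have hx (n : nat) : {x : R[i] | K x & n%:R < nrm x}.
  apply: cid2; apply: contrapT => hN; apply: nb; exists n%:R => x Kx.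
  by rewrite leNgt; apply/negP => hx; apply: hN; exists x.
pose x n : Cplx R := s2val (hx n).
have [|p [_ cl]] := Kc (x @ \oo) _; first by exists 0%N => // n _ /=; rewrite /x; case: (hx n).
have [N hN] := exists_gt_nat (nrm p + 1).
have hB : nbhs p [set z | nrm (z - p) < 1] by apply/(nearC p (fun z => nrm (z - p) < 1)); exists 1.
have [|z [[n nN <-]]] := cl [set x n | n in [set n | (N <= n)%N]] _ _ hB.
  by exists N => // n nN /=; exists n.
rewrite /= => h; have := hN n nN; have : n%:R < nrm (x n) by rewrite /x; case: (hx n).
have := nrm_lb (x n) p; clear -h; lra.
Qed.

(** If a circle smaller than the modulus of some point of [K] were missed, the part of [K] inside it
    would be open and closed in [K]. *)
Lemma connected_circles K : connected K -> K 0 -> K <> [set 0] ->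
  nearby (fun z => exists2 k, K k & nrm k = nrm z).
Proof.
move=> Kc K0 Kn; have [p Kp p0] : exists2 p, K p & p != 0.
  apply: contrapT => hN; apply: Kn; rewrite eqEsubset; split => [z Kz|z ->//].
  by apply/eqP; apply/negPn/negP => z0; apply: hN; exists z.
exists (nrm p); first by rewrite nrm_gt0.
move=> z zp; apply: contrapT => hN.
have z0 : 0 < nrm z.
  by rewrite nrm_gt0; apply/eqP => z0; apply: hN; exists 0; rewrite ?z0.
have lt_le k : K k -> nrm k <= nrm z -> nrm k < nrm z.
  by move=> Kk; rewrite le_eqVlt => /orP[/eqP e|//]; case: hN; exists k.
have E : K `&` [set k | nrm k < nrm z] = K.
  apply: Kc; first by exists 0; split => //=; rewrite nrm0.
    exists [set k | nrm k < nrm z] => //; apply/openC => k /= hk.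
    exists (nrm z - nrm k); first by rewrite subr_gt0.
    by move=> x hx /=; have := nrm_lb x k; clear -hx; lra.
  exists [set k | nrm k <= nrm z].
    by apply/cclosedP => k hk; have := @cclosed_disc R 0 (nrm z) k; rewrite /= subr0; apply => e /hk[x /= hx]; exists x => //=; rewrite subr0.
  rewrite eqEsubset; split => k [Kk /= hk]; split => //=; first exact: ltW.
  exact: lt_le.
by have : K p := Kp; rewrite -E => -[_ /= h]; clear -h zp; lra.
Qed.

Lemma holo_holP U F : holo_on U F <-> open U /\ forall z, U z -> hol F z.
Proof. by split=> -[oU hU]; split => // z /hU /holP. Qed.

Lemma germ_hol f alpha : rot_germ f alpha ->
  [/\ holn f, f 0 = 0 & cd f 0 (multiplier alpha)].
Proof.
move=> [[U [U0 /holo_holP[oU hU]]] [f0 df]]; split => //.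
  have /openC/(_ 0 U0)[r r0 hr] := oU; exists r => // z zr; apply: hU; apply: hr; by rewrite subr0.
by apply/cdP; split => //; apply/holP; apply: hU.
Qed.

(** The definition provides [G (f z) = z]; the identity [f (G z) = z] follows by applying the
    injective [G] to both sides. Invariance of [K] passes from the extension [F] to [f] near [0]. *)
Lemma siegel_germ f alpha K : rot_germ f alpha -> siegel_compact f K -> exists F G,
  [/\ holn G, G 0 = 0, cd G 0 (multiplier alpha)^-1,
      nearby (fun z => f (G z) = z) /\ nearby (fun z => G (f z) = z) &
      [/\ Kgerm K f, Kgerm K G, nearby (fun z => F z = f z), forall z, K z -> K (F z) &
          forall z, K z -> hol F z]].
Proof.
move=> /germ_hol[hf f0 df] [_ [_ [_ [K0 [_ [U [F [G]]]]]]]].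
move=> [KU [/holo_holP[oU hF] [iF [/holo_holP[_ hG] [iG [/nearbyP Ff [/nearbyP Gf [FK GK]]]]]]]].
set lam := multiplier alpha in df *.
have KF z : K z -> K (F z) by move=> Kz; rewrite -FK; exists z.
have KG z : K z -> K (G z) by move=> Kz; rewrite -GK; exists z.
have G0 : G 0 = 0 by have [r r0 /(_ 0)] := Gf; rewrite nrm0 f0 => /(_ r0).
have hG0 : hol G 0 by apply: hG; exact: KU.
have nU : nearby U by have /openC/(_ 0 (KU 0 K0))[r r0 hr] := oU; exists r => // z zr; apply: hr; rewrite subr0.
have hGn : holn G by have [r r0 hr] := nU; exists r => // z /hr; apply: hG.
have dG : cd G 0 lam^-1.
  have [d hd] := hG0; have lam0 : lam != 0 by rewrite -nrm_gt0 nrm_multiplier.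
  suff <- : d = lam^-1 by [].
  apply: (mulIf lam0); rewrite mulVf //.
  have d1 : cd (G \o f) 0 (d * lam) by apply: cd_comp; rewrite ?f0.
  apply: (cd_unique d1); have [r r0 hr] := Gf.
  by apply: (cd_local r0 _ (cd_id 0)) => w wr; rewrite /= add0r hr.
exists F, G; split; [exact: hGn|exact: G0|exact: dG| |]; last first.
  split; [|by exists 1 => // z _; exact: KG|exact: Ff|exact: KF|by move=> z /KU /hF].
  by apply: nearbyS Ff => z <-; exact: KF.
split; last exact: Gf.
have cG : cont G 0 := cd_cont dG.
have cFG : cont (f \o G) 0 by apply: cd_cont; apply: cd_comp; [exact: dG|rewrite G0; exact: df].
have n1 := nearby_comp cFG ltac:(by rewrite /= G0) nU.
apply: nearbyS (nearbyI (nearbyI n1 nU) (nearby_comp cG G0 Gf)) => z [[u1 u2] u3].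
by move: u1 u2 u3 => /= u1 u2 u3; apply: (iG _ _ u1 u2 u3).
Qed.

(** Orbits are followed with an extension [F] of the germ, because away from [0] the values of [f]
    are arbitrary. *)
Lemma bounded_linearizable f F alpha (s M : R) : rot_germ f alpha -> 0 < s ->
  nearby (fun z => F z = f z) -> (forall n z, nrm z < s -> hol (iter n F) z) ->
  (forall n z, nrm z < s -> nrm (iter n F z) <= M) -> linearizable f alpha.
Proof.
move=> gf s0 [r r0 Ff] hF FM; have [hf f0 df] := germ_hol gf.
have F0 : F 0 = 0 by rewrite Ff ?nrm0 // f0.
have dF : cd F 0 (multiplier alpha) by apply: cd_local r0 _ df => w wr; rewrite add0r Ff.
have [] := @bounded_iterates_linearize R f (fun n => iter n F) (multiplier alpha) s M s0 (nrm_multiplier _) f0 (cd_cont df) (fun=> erefl).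
- by move=> n; have [] := iter_cd n F0 dF.
- exact: hF.
- by move=> n; have [] := iter_cd n F0 dF.
- exact: FM.
- by exists r => // n z zr; rewrite iterSr Ff.
move=> h [r' [r'0 hh h0 dh hE]]; exists h; split; last split => //; last split.
- exists [set w | nrm w < r']; split; first by rewrite /= nrm0.
  apply/holo_holP; split => //; apply/openC => a /= ha; exists (r' - nrm a); first by rewrite subr_gt0.
  by move=> z hz /=; have := nrm_lb z a; clear -hz; lra.
- by have /cdP[] := dh.
by apply/nearbyP; exists r'.
Qed.

(** The extension [F] maps [K] into itself, so its iterates are holomorphic and uniformly bounded on
    a disc contained in [K]. *)
Lemma interior_linearizable f alpha K : rot_germ f alpha -> siegel_compact f K ->
  nearby K -> linearizable f alpha.
Proof.
move=> gf sf [s s0 hs]; have [M hM] := compact_cbounded (proj1 sf).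
have [F [G [_ _ _ _ [_ _ Ff KF hF]]]] := siegel_germ gf sf.
have KI n z : K z -> K (iter n F z) by move=> Kz; elim: n => [//|n IH]; apply: KF.
apply: (bounded_linearizable gf s0 Ff) => n z /hs Kz; last by apply: hM; exact: KI.
elim: n => [|n IH]; first exact: hol_id.
by apply: (@hol_comp R (iter n F) F) => //; apply: hF; exact: KI.
Qed.

Lemma common_siegel_commute f g alpha beta K : nonlinearizable_germ f alpha -> nonlinearizable_germ g beta ->
  siegel_compact f K -> siegel_compact g K -> \forall z \near (0 : Cplx R), f (g z) = g (f z).
Proof.
move=> [gf [ia nl]] [gg _] sf sg; apply/nearbyP.
have [hf f0 df] := germ_hol gf; have [hg g0 dg] := germ_hol gg.
have [_ [G [hG G0 dG [fG Gf] [Kf KG _ _ _]]]] := siegel_germ gf sf.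
have [_ [H [hH H0 dH [gH Hg] [Kg KH _ _ _]]]] := siegel_germ gg sg.
have [Kc [Kcon [_ [K0 [Kn _]]]]] := sf.
have mu0 : multiplier beta != 0 by rewrite -nrm_gt0 nrm_multiplier.
have [//|] := commute_or_interior ia (compact_cclosed Kc) (compact_cbounded Kc) K0
  (connected_circles Kcon K0 Kn) hf f0 df hG G0 dG fG Gf Kf KG hg g0 dg mu0 hH H0 dH gH Hg Kg KH.
by move=> /(interior_linearizable gf sf) /nl.
Qed.
End Siegel.

(** * Chains and quasi-components of compact sets *)

Section Chains.
Variable R : realType.
Implicit Types (S A B : set R[i]) (x y z a : R[i]) (e d : R).

Inductive chain S e a : R[i] -> Prop :=
| chain_nil : S a -> chain S e a a
| chain_snoc y z : chain S e a y -> S z -> nrm (z - y) < e -> chain S e a z.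

(* By compactness this quasi-component is the component of [a] in [S]. *)
Definition quasi S a z := forall e, 0 < e -> chain S e a z.

Lemma chain_in S e a z : chain S e a z -> S z.
Proof. by case. Qed.

Lemma chain_le S e d a z : e <= d -> chain S e a z -> chain S d a z.
Proof.
move=> ed; elim=> [Sa|y {}z _ IH Sz h]; first exact: chain_nil.
exact: chain_snoc IH Sz (lt_le_trans h ed).
Qed.

Lemma quasi_in S a z : quasi S a z -> S z.
Proof. by move=> /(_ 1 ltr01)/chain_in. Qed.

Lemma quasi_base S a : S a -> quasi S a a.
Proof. by move=> Sa e _; apply: chain_nil. Qed.

Lemma quasi_image S a (f : R[i] -> R[i]) : f a = a -> (forall z, S z -> S (f z)) ->
  (forall x y, S x -> S y -> nrm (f x - f y) <= 2 * nrm (x - y)) ->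
  forall z, quasi S a z -> quasi S a (f z).
Proof.
move=> fa fS fl z hz e e0; move: (hz (e / 2) (divr_gt0 e0 (ltr0n R 2))) => {hz}.
elim=> [Sa|y {}z hy IH Sz h]; first by rewrite fa; apply: chain_nil.
apply: chain_snoc IH (fS _ Sz) _.
by have := fl z y Sz (chain_in hy); clear -h; lra.
Qed.

Lemma cbounded_sub A B : A `<=` B -> cbounded B -> cbounded A.
Proof. by move=> AB [M hM]; exists M => x /AB/hM. Qed.

Lemma ucv_dist (u : nat -> R[i]) l a d : ucv u l -> (forall n, d <= nrm (u n - a)) -> d <= nrm (l - a).
Proof.
move=> ul h; rewrite leNgt; apply/negP => hd.
have [n /= hn] := ulf_ex (ul (d - nrm (l - a)) ltac:(by rewrite subr_gt0)).
have := h n; have := nrm_tri l (u n) a; clear -hn; lra.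
Qed.

Lemma cclosed_quasi S a : cclosed S -> cclosed (quasi S a).
Proof.
move=> Sc z hz e e0; have Sz : S z.
  by apply: Sc => d d0; have [x /quasi_in Sx hx] := hz d d0; exists x.
have [x hx xz] := hz e e0; apply: chain_snoc (hx e e0) Sz _; by rewrite nrmC.
Qed.

Section Limits.
Variables (S : set R[i]) (a : R[i]).
Hypotheses (Sc : cclosed S) (Sb : cbounded S).

Lemma chain_limit (u : nat -> R[i]) : (forall n, chain S n.+1%:R^-1 a (u n)) ->
  exists2 l, quasi S a l & ucv u l.
Proof.
move=> hu; have [l Sl ul] := seq_compact Sc Sb (fun n => chain_in (hu n)).
exists l => // e e0; have [n0 hn0] := exists_lt_inv e0.
have [n [hn n0n]] := ulf_ex (ulfI (ul e e0) (ulf_ge n0)).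
by apply: chain_snoc (chain_le (ltW (hn0 n n0n)) (hu n)) Sl _; rewrite nrmC.
Qed.

Lemma invS_gt0 n : 0 < n.+1%:R^-1 :> R.
Proof. by rewrite invr_gt0. Qed.

(** Two nonempty pieces of the quasi-component would be at a distance [d > 0] by compactness. Ever
    finer chains crossing the gap contain points far from both pieces, and a limit of these still
    lies in the quasi-component. *)
Lemma quasi_split A B : quasi S a `<=` A `|` B -> A a -> cclosed A -> cclosed B ->
  (forall z, A z -> B z -> False) -> quasi S a `<=` A.
Proof.
move=> QAB Aa Ac Bc AB; pose A' := quasi S a `&` A; pose B' := quasi S a `&` B.
have A'c : cclosed A'.
  move=> z hz; split; [apply: cclosed_quasi => // e e0|apply: Ac => e e0];
  by have [x [x1 x2] xz] := hz e e0; exists x.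
have B'c : cclosed B'.
  move=> z hz; split; [apply: cclosed_quasi => // e e0|apply: Bc => e e0];
  by have [x [x1 x2] xz] := hz e e0; exists x.
have Qb : cbounded (quasi S a) by apply: cbounded_sub Sb => z /quasi_in.
have [d d0 hd] : exists2 d, 0 < d & forall x y, A' x -> B' y -> d <= nrm (y - x).
  apply: contrapT => hN.
  have hxy (n : nat) : exists p : R[i] * R[i], [/\ A' p.1, B' p.2 & nrm (p.2 - p.1) < n.+1%:R^-1].
    apply: contrapT => hn; apply: hN; exists n.+1%:R^-1; first exact: invS_gt0.
    by move=> x y Ax By; rewrite leNgt; apply/negP => h; apply: hn; exists (x, y).
  pose p n := projT1 (cid (hxy n)); have hp n := projT2 (cid (hxy n)).
  have A'b : cbounded A' by apply: cbounded_sub Qb => z [].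
  have pA n : A' (p n).1 by case: (hp n).
  have [l Al ul] := seq_compact A'c A'b pA.
  apply: (AB l); first by case: Al.
  suff : B' l by case.
  apply: B'c => e e0; have e2 : 0 < e / 2 by rewrite divr_gt0.
  have [n0 hn0] := exists_lt_inv e2.
  have [n [hn n0n]] := ulf_ex (ulfI (ul _ e2) (ulf_ge n0)).
  have {}hn : nrm ((p n).1 - l) < e / 2 := hn.
  have h2 : B' (p n).2 by case: (hp n).
  have h3 : nrm ((p n).2 - (p n).1) < n.+1%:R^-1 by case: (hp n).
  have h4 := hn0 n n0n; have h5 := nrm_tri (p n).1 (p n).2 l.
  have {h3} h4 := lt_trans h3 h4; by exists (p n).2 => //; clear -hn h4 h5; lra.
move=> b Qb'; apply: contrapT => nAb.
have B'b : B' b by split => //; case: (QAB b Qb').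
have Sa : S a by have := Qb' 1 ltr01; elim.
have A'a : A' a by split => //; exact: quasi_base.
have d2 : 0 < d / 2 by rewrite divr_gt0.
(* the first point of a fine chain from [A'] to [b] that leaves the
   [d/4]-neighbourhood of [A'] is far from both pieces *)
have exit (n : nat) : n.+1%:R^-1 < d / 4 -> exists z, [/\ chain S n.+1%:R^-1 a z,
    forall x, A' x -> d / 4 <= nrm (z - x) & forall y, B' y -> d / 4 <= nrm (z - y)].
  move=> nd; apply: contrapT => hN.
  have near z : chain S n.+1%:R^-1 a z -> exists2 x, A' x & nrm (z - x) < d / 4.
    elim=> [_|y {}z hy [x Ax xy] Sz zy]; first by exists a => //; rewrite subrr nrm0; lra.
    apply: contrapT => hN2; apply: hN; exists z; split.
    - exact: chain_snoc hy Sz zy.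
    - by move=> x' Ax'; rewrite leNgt; apply/negP => h; apply: hN2; exists x'.
    move=> y' By'; have := hd x y' Ax By'.
    have := nrm_tri z y' x; have := nrm_tri y z x; rewrite (nrmC y' z).
    move: (lt_trans zy nd) xy; clear -d0; lra.
  have [x Ax] := near b (Qb' _ (invS_gt0 n)).
  by have := hd x b Ax B'b; clear -d0; lra.
have [n0 hn0] := exists_lt_inv (ltac:(lra) : 0 < d / 4).
have hex n : exists z, [/\ chain S n.+1%:R^-1 a z,
    forall x, A' x -> d / 4 <= nrm (z - x) & forall y, B' y -> d / 4 <= nrm (z - y)].
  have [z [h1 h2 h3]] := exit (maxn n n0) (hn0 _ (leq_maxr _ _)).
  exists z; split => //; apply: chain_le h1.
  by rewrite lef_pV2 ?posrE // ler_nat ltnS leq_maxl.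
pose u n := projT1 (cid (hex n)); have hu n := projT2 (cid (hex n)).
have uc n : chain S n.+1%:R^-1 a (u n) by case: (hu n).
have uA n x : A' x -> d / 4 <= nrm (u n - x) by case: (hu n) => _ h _; exact: h.
have uB n x : B' x -> d / 4 <= nrm (u n - x) by case: (hu n) => _ _ h; exact: h.
have [l Ql ul] := chain_limit uc.
have [h|h] := QAB l Ql.
  have := ucv_dist ul (fun n => uA n l (conj Ql h)).
  by rewrite subrr nrm0; lra.
have := ucv_dist ul (fun n => uB n l (conj Ql h)).
by rewrite subrr nrm0; lra.
Qed.

Lemma quasi_connected : S a -> connected (quasi S a : set (Cplx R)).
Proof.
move=> Sa B [b Bb] [W oW BW] [D /cclosedP cD BD].
have Oc : cclosed (~` W) by apply/cclosedP; rewrite closedC.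
have QDO : quasi S a `<=` D `|` ~` W.
  move=> z Qz; have [Oz|] := pselect (W z); last by right.
  by left; have : B z; [rewrite BW|rewrite BD => -[]].
have dis z : quasi S a z -> D z -> W z.
  by move=> Qz Dz; have : B z; [rewrite BD|rewrite BW => -[]].
pose D' := quasi S a `&` D; pose W' := quasi S a `&` ~` W.
have Qc := cclosed_quasi (S := S) (a := a) Sc.
have cI X : cclosed X -> cclosed (quasi S a `&` X).
  move=> Xc z hz; split; [apply: Qc => e e0|apply: Xc => e e0];
  by have [x [x1 x2] xz] := hz e e0; exists x.
have QDO' : quasi S a `<=` D' `|` W' by move=> z Qz; case: (QDO z Qz) => ?; [left|right].
rewrite BD; apply/seteqP; split => [z []//|z Qz]; split => //.
have [Da|nDa] := pselect (D a).
  have DW w : D' w -> W' w -> False by move=> [Qw Dw] [_ nW]; apply: nW; exact: dis.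
  by have [] := quasi_split QDO' (conj (quasi_base Sa) Da) (cI _ cD) (cI _ Oc) DW Qz.
have Oa : W' a by case: (QDO' a (quasi_base Sa)) => // -[].
have h : quasi S a `<=` W'.
  apply: quasi_split (cI _ Oc) (cI _ cD) _ => //.
    by move=> w /QDO'[]; [right|left].
  by move=> w [_ nO] [Qw Dw]; apply: nO; exact: dis.
have : B b := Bb; rewrite BW => -[Qb Ob].
by have [_ ] := h b Qb.
Qed.

(** End points of ever finer chains accumulate in the quasi-component; if this is reduced to [a],
    sufficiently fine chains stay near [a]. *)
Lemma quasi_isolate d : S a -> (forall z, quasi S a z -> z = a) -> 0 < d ->
  exists2 e, 0 < e & forall z, chain S e a z -> nrm (z - a) < d.
Proof.
move=> Sa Qa d0; apply: contrapT => hN.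
have hex n : exists z, chain S n.+1%:R^-1 a z /\ d <= nrm (z - a).
  apply: contrapT => hn; apply: hN; exists n.+1%:R^-1; first exact: invS_gt0.
  by move=> z hz; rewrite ltNge; apply/negP => h; apply: hn; exists z.
pose u n := projT1 (cid (hex n)); have hu n := projT2 (cid (hex n)).
have [l /Qa -> ul] := chain_limit (fun n => proj1 (hu n)).
by have := ucv_dist ul (fun n => proj2 (hu n)); rewrite subrr nrm0; lra.
Qed.
End Limits.
End Chains.

(** * Orbits in a disc and their invariant set *)

Section Orbits.
Variable R : realType.
Implicit Types (A K : set R[i]) (f g : R[i] -> R[i]) (x y z w : R[i]) (r rho : R).

Lemma locally_constant (P : R -> Prop) :
  (forall t, exists2 d, 0 < d & forall s, `|s - t| < d -> (P s <-> P t)) -> forall s t, P s -> P t.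
Proof.
move=> hP s t Ps.
have oP (Q : R -> Prop) : (forall u, Q u -> exists2 d : R, 0 < d & forall s, `|s - u| < d -> Q s) ->
    open [set u | Q u].
  move=> hQ; rewrite openE => u /= /hQ[d d0 hd]; apply/nbhs_ballP; exists d => // v.
  by rewrite /ball /= distrC; exact: hd.
have cT : connected [set: R] by apply/connected_intervalP => x y _ _ v _.
suff : [set u | P u] t by [].
rewrite (cT [set u | P u]) //; first by exists s.
  exists [set u | P u]; rewrite ?setTI //; apply: oP => u Pu.
  by have [d d0 hd] := hP u; exists d => // v /hd [_]; exact.
exists [set u | P u]; rewrite ?setTI // -[X in closed X]setCK closedC.
apply: (oP (fun u => ~ P u)) => u Pu.
by have [d d0 hd] := hP u; exists d => // v /hd [h _] /h.
Qed.

(** Two points of the exterior are joined by an arc of a circle followed by a radial segment. *)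
Lemma exterior_connected A r : 0 <= r ->
  (forall z, r < nrm z -> exists2 d : R, 0 < d & forall x, nrm (x - z) < d -> (A x <-> A z)) ->
  forall z w, r < nrm z -> r < nrm w -> A z -> A w.
Proof.
move=> r0 hA.
have circ z t : r < nrm z -> A z -> A (z * multiplier t).
  move=> zr Az; apply: (@locally_constant (fun t => A (z * multiplier t)) _ 0); last by rewrite multiplier0 mulr1.
  move=> u; have zu : nrm (z * multiplier u) = nrm z by rewrite nrmM nrm_multiplier mulr1.
  have [d d0 hd] := hA (z * multiplier u) ltac:(by rewrite zu).
  have nz : 0 < nrm z by apply: le_lt_trans zr.
  have [d' d'0 hd'] := multiplier_cont0 (divr_gt0 d0 nz).
  exists d' => // s hs; apply: hd.
  have -> : z * multiplier s - z * multiplier u = z * multiplier u * (multiplier (s - u) - 1).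
    by rewrite mulrBr mulr1 -mulrA -multiplierD (addrC u) subrK.
  by rewrite nrmM zu mulrC -ltr_pdivlMr //; apply: hd'.
move=> z w zr wr Az.
have nz : 0 < nrm z by apply: le_lt_trans zr.
have nw : 0 < nrm w by apply: le_lt_trans wr.
have [t ht] := @unit_multiplier R (w / (nrm w)%:C%C) ltac:(by rewrite nrmf nrm_real ger0_norm ?divff ?lt0r_neq0 // ltW).
have [s hs] := @unit_multiplier R (z / (nrm z)%:C%C) ltac:(by rewrite nrmf nrm_real ger0_norm ?divff ?lt0r_neq0 // ltW).
have wC : (nrm w)%:C%C != 0 :> R[i] by rewrite -nrm_gt0 nrm_real ger0_norm // ltW.
have zC : (nrm z)%:C%C != 0 :> R[i] by rewrite -nrm_gt0 nrm_real ger0_norm // ltW.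
have z0 : z != 0 by rewrite -nrm_gt0.
pose m := Num.min (nrm z) (nrm w).
have mr : r < m by rewrite /m lt_min zr wr.
have [mz mw] : m <= nrm z /\ m <= nrm w by rewrite /m !ge_min !lexx orbT.
(* The cut-off [Num.max m u] prolongs the radial path to all real [u] without entering the disc. *)
have -> : w = (Num.max m (nrm w))%:C%C * multiplier t by rewrite max_r // ht mulrC divfK.
apply: (@locally_constant (fun u => A ((Num.max m u)%:C%C * multiplier t)) _ (nrm z)); last first.
  rewrite max_r //; have -> : (nrm z)%:C%C * multiplier t = z * multiplier (t - s).
    by rewrite multiplierD multiplierN hs; field; rewrite z0 zC.
  exact: circ.
move=> u; have um : r < Num.max m u by rewrite lt_max mr.
have un : nrm ((Num.max m u)%:C%C * multiplier t) = Num.max m u.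
  by rewrite nrmM nrm_multiplier mulr1 nrm_real ger0_norm //; apply: le_trans r0 (ltW um).
have [d d0 hd] := hA ((Num.max m u)%:C%C * multiplier t) ltac:(by rewrite un).
exists d => // v hv; apply: hd; rewrite -mulrBl nrmM nrm_multiplier mulr1 -rmorphB nrm_real.
apply: le_lt_trans hv; clear; rewrite ler_norml.
have := ler_norm (v - u); have := ler_norm (u - v); rewrite (distrC u v).
by case: (leP m v); case: (leP m u); move: (`|v - u|) => q *; apply/andP; split; lra.
Qed.

(** A point of largest real part could be moved to the right. *)
Lemma no_compact_clopen A : cclosed A -> cbounded A -> A !=set0 ->
  (forall z, A z -> exists2 d : R, 0 < d & forall x, nrm (x - z) < d -> A x) -> False.
Proof.
move=> Ac Ab An oA.
have Re_cont (z : R[i]) : A z -> rcont (fun z => Re z) z.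
  move=> _ e e0; exists e => // w we; rewrite ReD addrAC subrr add0r.
  exact: le_lt_trans (normRe_le _) we.
have [z Az hz] := usc_max Ac Ab An (cont_usc Re_cont).
have [d d0 hd] := oA z Az; have d2 : 0 < d / 2 by rewrite divr_gt0.
have := hz (z + (d / 2)%:C%C) (hd _ _).
rewrite addrAC subrr add0r nrm_real (ger0_norm (ltW d2)) ReD /= => h.
have := h ltac:(lra); lra.
Qed.

Definition orb f r n z := forall k, (k <= n)%N -> nrm (iter k f z) <= r.

(** One half of a pair of mutually inverse local maps, the other half being [local_iso g f rho]. The
    Lipschitz constant [2] leaves room around a multiplier of modulus [1]. *)
Definition local_iso f g rho := [/\ forall z, nrm z < rho -> hol f z, f 0 = 0,
  forall x y, nrm x < rho -> nrm y < rho -> nrm (f x - f y) <= 2 * nrm (x - y) &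
  forall z, nrm z < rho -> g (f z) = z].

Lemma orb_le f r m n z : (m <= n)%N -> orb f r n z -> orb f r m z.
Proof. by move=> mn h k km; apply: h; apply: leq_trans mn. Qed.

Lemma orbS f r n z : orb f r n.+1 z <-> nrm z <= r /\ orb f r n (f z).
Proof.
split=> [h|[h1 h2] [|k] kn //]; first by split; [exact: (h 0%N)|move=> k kn; rewrite -iterSr; exact: h].
by rewrite iterSr; exact: h2.
Qed.

Lemma iter0 f n : f 0 = 0 -> iter n f 0 = 0.
Proof. by move=> f0; elim: n => //= n ->. Qed.

Section Fixed.
Variables (f g : R[i] -> R[i]) (rho r : R).
Hypotheses (r0 : 0 < r) (rr : r < rho) (fL : local_iso f g rho) (gL : local_iso g f rho).

Lemma iter_hol n z : (forall k, (k < n)%N -> nrm (iter k f z) < rho) -> hol (iter n f) z.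
Proof.
have [fh _ _ _] := fL; elim: n => [|n IH] h; first exact: hol_id.
by apply: (@hol_comp R (iter n f) f); [apply: IH => k kn; apply: h; exact: ltnW|apply: fh; exact: h].
Qed.

(** The iterate [n + 1] is included, because [r < rho] keeps [f] holomorphic at the last controlled
    point. *)
Lemma orb_hol n k z : orb f r n z -> (k <= n.+1)%N -> hol (iter k f) z.
Proof. by move=> h kn; apply: iter_hol => j jk; apply: le_lt_trans rr; apply: h; rewrite -ltnS (leq_trans jk). Qed.

Lemma cont_le (F : R[i] -> R[i]) (A : set R[i]) (a : R) z : cont F z -> (forall x, A x -> nrm (F x) <= a) ->
  (forall e : R, 0 < e -> exists2 x, A x & nrm (x - z) < e) -> nrm (F z) <= a.
Proof.
move=> Fc hF hz; apply/ler_addgt0Pr => e e0; have [d d0 hd] := Fc e e0.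
have [x Ax xz] := hz d d0; have := hd _ xz; rewrite [z + _]addrC subrK => h1.
have := hF x Ax; have := nrm_lb (F z) (F x); rewrite nrmC; lra.
Qed.

(** Induction is needed because an iterate is known to be continuous at the limit point only once
    the shorter orbit of that point has been placed in the disc. *)
Lemma orb_closed n : cclosed (orb f r n).
Proof.
move=> z; elim: n => [|n IH] hz k kn.
  move: kn; rewrite leqn0 => /eqP ->; apply: (cont_le (A := orb f r 0) _ _ hz).
    exact: hol_cont (hol_id _).
  by move=> x; exact.
have ho : orb f r n z.
  by apply: IH => e e0; have [x hx xz] := hz e e0; exists x => //; apply: orb_le hx.
apply: (cont_le (A := orb f r n.+1) _ _ hz); first by apply: hol_cont; apply: orb_hol ho _.
by move=> x; exact.
Qed.

Lemma orb0 n : orb f r n 0.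
Proof. by have [_ f0 _ _] := fL; move=> k _; rewrite iter0 // nrm0 ltW. Qed.

Lemma orb_escape k z : r < nrm (iter k f z) -> exists2 d : R, 0 < d &
  forall x, nrm (x - z) < d -> ~ orb f r k x.
Proof.
move=> hk; apply: contrapT => hN; move: hk; rewrite ltNge => /negP; apply.
suff : orb f r k z by exact.
apply: orb_closed => e e0; apply: contrapT => hN2; apply: hN; exists e => // x xe hx.
by apply: hN2; exists x.
Qed.

End Fixed.

Definition inv_set f g r : set R[i] := [set z | forall n, orb f r n z /\ orb g r n z].

Section Invariant.
Variables (f g : R[i] -> R[i]) (rho r : R).
Hypotheses (r0 : 0 < r) (rr : r < rho) (fL : local_iso f g rho) (gL : local_iso g f rho).

Lemma inv_closed : cclosed (inv_set f g r).
Proof.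
move=> z hz n; split; [apply: (orb_closed rr fL)|apply: (orb_closed rr gL)] => e e0;
by have [x hx xz] := hz e e0; exists x => //; case: (hx n).
Qed.

Lemma inv_bounded : cbounded (inv_set f g r).
Proof. by exists r => z /(_ 0%N)[/(_ 0%N (leqnn _))]. Qed.

Lemma inv0 : inv_set f g r 0.
Proof. by move=> n; split; apply: orb0; [exact: r0|exact: fL|exact: r0|exact: gL]. Qed.

Lemma inv_le z : inv_set f g r z -> nrm z <= r.
Proof. by move=> /(_ 0%N)[/(_ 0%N (leqnn _))]. Qed.

Lemma inv_image z : inv_set f g r z -> inv_set f g r (f z).
Proof.
move=> hz n; have [_ _ _ gf] := fL; split; first by have [/orbS[]] := hz n.+1.
have e : g (f z) = z by apply: gf; exact: le_lt_trans (inv_le hz) rr.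
apply: (@orb_le _ _ n n.+1) => //; apply/orbS; split; last by rewrite e; case: (hz n).
by have [/(_ 1%N isT)] := hz 1%N.
Qed.

End Invariant.

Lemma inv_sym f g r : inv_set f g r = inv_set g f r.
Proof. by apply/seteqP; split => z h n; have [] := h n. Qed.
End Orbits.

(** * Fullness of the hull *)

Section Full.
Variables (R : realType) (f g : R[i] -> R[i]) (rho r : R).
Hypotheses (r0 : 0 < r) (rr : r < rho) (fL : local_iso f g rho) (gL : local_iso g f rho).
Implicit Types (A O S : set R[i]) (x y z w : R[i]) (F G : R[i] -> R[i]).

Local Notation M := (inv_set f g r).
Local Notation K := (quasi M 0).

Lemma hull_in z : K z -> M z. Proof. exact: quasi_in. Qed.

Lemma hull_closed : cclosed K.
Proof. by apply: cclosed_quasi; apply: inv_closed rr fL gL. Qed.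

(* By the maximum principle all iterates stay in the disc of radius [r] on a
   bounded component of the complement of the hull. *)
Lemma orb_on_pocket F G O n z : local_iso F G rho -> (forall z, K z -> orb F r n z) ->
  cclosed (K `|` O) -> (forall z, O z -> nrm z <= r) ->
  (forall z, O z -> exists2 d : R, 0 < d & forall x, nrm (x - z) < d -> O x) ->
  (K `|` O) z -> orb F r n z.
Proof.
move=> FL FK Sc Ob Oo; have Sb : cbounded (K `|` O).
  by exists r => w [/hull_in/inv_le|/Ob].
elim: n z FK => [|n IH] z FK Sz k kn.
  by move: kn; rewrite leqn0 => /eqP ->; case: Sz => [/hull_in/inv_le|/Ob].
have FKn w : K w -> orb F r n w by move=> /FK h; apply: orb_le h.
have FS w : (K `|` O) w -> orb F r n w by apply: IH.
move: kn; rewrite leq_eqVlt => /orP[/eqP ->|]; last by rewrite ltnS; apply: FS.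
have FH w : (K `|` O) w -> hol (iter n.+1 F) w by move=> Sw; apply: (orb_hol rr FL (FS w Sw)).
apply: (max_principle Sc Sb _ _ Sz) => w Sw; first exact: hol_cont (FH w Sw).
case: (Sw) => [Kw|/Oo[d d0 hd]]; first by left; exact: FK.
by right; exists d => // x /hd Ox; split; [right|apply: FH; right].
Qed.

(** By [orb_on_pocket] the pocket consists of points of [M]. For each mesh, its points not reached
    from [0] by chains in [M] would form a compact open set, hence there are none; the pocket would
    then lie in the hull. *)
Lemma no_pocket O : (forall z, O z -> ~ K z) -> (forall z, O z -> nrm z <= r) ->
  (forall z, O z -> exists2 d : R, 0 < d & forall x, nrm (x - z) < d -> O x) ->
  (forall z, ~ K z -> ~ O z -> exists2 d : R, 0 < d & forall x, nrm (x - z) < d -> ~ O x) ->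
  forall z, ~ O z.
Proof.
move=> OK Ob Oo Oc; have Sc : cclosed (K `|` O).
  move=> z hz; apply: contrapT => /not_orP[nK nO]; have [d d0 hd] := Oc z nK nO.
  apply: nK; apply: hull_closed => e e0.
  have [x Sx xz] := hz (Num.min d e) ltac:(by rewrite min_gt0).
  move: xz; rewrite lt_min => /andP[xd xe]; case: Sx => [Kx|Ox]; first by exists x.
  by case: (hd x xd).
have SM z : (K `|` O) z -> M z.
  have Kf n w : K w -> orb f r n w by move=> Kw; case: (hull_in Kw n).
  have Kg n w : K w -> orb g r n w by move=> Kw; case: (hull_in Kw n).
  move=> Sz n; split; first exact: (orb_on_pocket fL (Kf n) Sc Ob Oo Sz).
  exact: (orb_on_pocket gL (Kg n) Sc Ob Oo Sz).
have OC e z : 0 < e -> O z -> chain M e 0 z.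
  move=> e0 Oz; apply: contrapT => nc.
  apply: (@no_compact_clopen R [set z | O z /\ ~ chain M e 0 z]).
  - move=> w hw; have Sw : (K `|` O) w.
      by apply: Sc => d d0; have [x [Ox _] xw] := hw d d0; exists x => //; right.
    have nw : ~ chain M e 0 w.
      move=> hc; have [x [Ox nx] xw] := hw e e0; apply: nx.
      by apply: chain_snoc hc _ xw; apply: SM; right.
    by split => //; case: Sw => // /(_ e e0).
  - by exists r => w [/Ob].
  - by exists z.
  move=> w [Ow nw]; have [d d0 hd] := Oo w Ow.
  exists (Num.min d e); first by rewrite min_gt0.
  move=> x; rewrite lt_min => /andP[xd xe]; split; first exact: hd.
  move=> hc; apply: nw; apply: chain_snoc hc _ _; first by apply: SM; right.
  by rewrite nrmC.
by move=> z Oz; apply: (OK z Oz) => e e0; apply: OC.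
Qed.

(** The exterior of the disc is connected, so a relatively clopen part of the complement contains
    all of it or none of it. Either the remaining part or the part itself is then a pocket. *)
Lemma hull_full : connected (~` K : set (Cplx R)).
Proof.
move=> B [b Bb] [W /openC oW BW] [D /cclosedP cD BD].
have nK z : ~ K z -> exists2 d : R, 0 < d & forall x, nrm (x - z) < d -> ~ K x.
  move=> nKz; apply: contrapT => hN; apply: nKz; apply: hull_closed => e e0.
  apply: contrapT => hN2; apply: hN; exists e => // x xe Kx; apply: hN2; by exists x.
have inB z : B z -> exists2 d : R, 0 < d & forall x, nrm (x - z) < d -> B x.
  move=> Bz; have : (~` K `&` W) z by rewrite -BW.
  move=> [/nK[d d0 hd] /oW[e e0 he]]; exists (Num.min d e); first by rewrite min_gt0.
  by move=> x; rewrite lt_min => /andP[/hd xd /he xe]; rewrite BW.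
have outB z : ~ K z -> ~ B z -> exists2 d : R, 0 < d & forall x, nrm (x - z) < d -> ~ B x.
  move=> nKz nBz; apply: contrapT => hN; apply: nBz; rewrite BD; split => //; apply: cD => e e0.
  apply: contrapT => hN2; apply: hN; exists e => // x xe; rewrite BD => -[_ Dx]; apply: hN2; by exists x.
have BK z : B z -> ~ K z by rewrite BW => -[].
have extK z : r < nrm z -> ~ K z by move=> zr /hull_in/inv_le; rewrite leNgt zr.
have [[z zr Bz]|hN] := pselect (exists2 z, r < nrm z & B z); last first.
  case: (@no_pocket B _ _ _ _ b) => // z Bz; rewrite leNgt; apply/negP => zr; apply: hN; by exists z.
have hext w : r < nrm w -> B w.
  move=> wr; apply: (exterior_connected (ltW r0) _ zr wr Bz) => x xr.
  have [Bx|nBx] := pselect (B x).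
    by have [d d0 hd] := inB x Bx; exists d => // y /hd.
  by have [d d0 hd] := outB x (extK x xr) nBx; exists d => // y /hd.
apply/seteqP; split => [w /BK //|w nKw]; apply: contrapT => nBw.
apply: (@no_pocket [set w | ~ K w /\ ~ B w] _ _ _ _ w) => //.
- by move=> x [].
- by move=> x [_ nBx]; rewrite leNgt; apply/negP => /hext.
- move=> x [/nK[d d0 hd] nBx]; have nKx : ~ K x by apply: hd; rewrite subrr nrm0.
  have [e e0 he] := outB x nKx nBx; exists (Num.min d e); first by rewrite min_gt0.
  by move=> y; rewrite lt_min => /andP[/hd xd /he xe].
move=> x nKx /not_andP[//|/contrapT/inB[d d0 hd]]; exists d => // y /hd By [] //.
Qed.

End Full.

(** * The hull as a Siegel compact *)

Section Existence.
Variables (R : realType) (rho r : R).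
Hypotheses (r0 : 0 < r) (rr : r < rho).

Lemma hull_image (f g : R[i] -> R[i]) z : local_iso f g rho -> local_iso g f rho ->
  quasi (inv_set f g r) 0 z -> quasi (inv_set f g r) 0 (f z).
Proof.
move=> fL gL; have [_ f0 fl _] := fL; apply: quasi_image => //.
  by move=> w; apply: inv_image rr fL _.
by move=> x y /inv_le xr /inv_le yr; apply: fl; apply: le_lt_trans rr.
Qed.

Lemma cclosed_cbounded_compact (S : set (Cplx R)) : cclosed S -> cbounded S -> compact S.
Proof.
move=> Sc [B hB]; pose F (p : R * R) : Cplx R := Complex p.1 p.2.
have Fc : continuous F.
  move=> p P /(nearC _ P)[d d0 hd]; have d2 : 0 < d / 2 by rewrite divr_gt0.
  exists ([set u | `|p.1 - u| < d / 2], [set u | `|p.2 - u| < d / 2]).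
    by split; apply/nbhs_ballP; exists (d / 2).
  move=> [u v] [/= hu hv]; apply: hd; apply: le_lt_trans (nrm_le_ReIm _) _; rewrite /= (distrC u) (distrC v).
  by move: hu hv; clear; lra.
have Qc : compact (`[- B, B]%classic `*` `[- B, B]%classic : set (R * R)).
  by apply: compact_setX; exact: segment_compact.
have Bc := continuous_compact (continuous_subspaceT Fc) Qc.
apply: (subclosed_compact _ Bc); first exact/cclosedP.
move=> z /hB zB; exists (Re z, Im z); last by case: (z).
by split; rewrite /= in_itv /= -ler_norml; apply: le_trans zB; [exact: normRe_le|exact: normIm_le].
Qed.

Lemma hull_siegel (f g : R[i] -> R[i]) z0 : local_iso f g rho -> local_iso g f rho ->
  quasi (inv_set f g r) 0 z0 -> z0 != 0 ->
  siegel_compact (f : Cplx R -> Cplx R) (quasi (inv_set f g r) 0).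
Proof.
move=> fL gL hz0 z00; set K := quasi _ 0.
have Kc := hull_closed rr fL gL; have KM z : K z -> nrm z <= r by move=> /quasi_in/inv_le.
have Kb : cbounded K by exists r.
have Mc := inv_closed rr fL gL; have Mb := @inv_bounded R f g r.
have M0 := inv0 r0 fL gL.
have oU : open ([set z | nrm z < rho] : set (Cplx R)).
  apply/openC => a /= ar; exists (rho - nrm a); first by rewrite subr_gt0.
  by move=> x; have := nrm_lb x a; rewrite /=; clear; lra.
have [fh f0 _ gf] := fL; have [gh g0 _ fg] := gL.
have near_rho (P : Cplx R -> Prop) : (forall z, nrm z < rho -> P z) -> \forall z \near (0 : Cplx R), P z.
  by move=> hP; apply/nearbyP; exists rho => //; exact: lt_trans rr.
have Ksub z : K z -> nrm z < rho by move=> /KM zr; exact: le_lt_trans rr.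
have Kf z : K z -> K (f z) by exact: hull_image.
have Kg z : K z -> K (g z).
  by rewrite /K inv_sym; exact: hull_image.
split; first exact: cclosed_cbounded_compact.
split; first exact: (quasi_connected Mc Mb M0).
split; first exact: (hull_full r0 rr fL gL).
split; first exact: quasi_base.
split; first by move=> e; move: hz0; rewrite -/K e /= => z0e; rewrite z0e eqxx in z00.
exists [set z | nrm z < rho], f, g; split; first exact: Ksub.
split; first by apply/holo_holP.
split; first by move=> x y xr yr e; rewrite -(gf x) // -(gf y) // e.
split; first by apply/holo_holP.
split; first by move=> x y xr yr e; rewrite -(fg x) // -(fg y) // e.
split; first exact: near_rho.
split; first exact: near_rho.
split; apply/seteqP; split => [_ [z Kz <-]|z Kz]; [exact: Kf| |exact: Kg|].
  by exists (g z); [exact: Kg|apply: fg; exact: Ksub].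
by exists (f z); [exact: Kf|apply: gf; exact: Ksub].
Qed.
End Existence.

(** * Poisson majorants of functions with a hole *)

Section Majorant.
Variable R : realType.
Implicit Types (u v : R[i] -> R) (z x b : R[i]) (s tau eta : R).

Lemma rcont_local u v z d : 0 < d -> (forall x, nrm (x - z) < d -> u x = v x) -> rcont u z -> rcont v z.
Proof.
move=> d0 uv uc e e0; have [d' d'0 h] := uc e e0; exists (Num.min d d'); first by rewrite min_gt0.
move=> w; rewrite lt_min => /andP[wd /h]; rewrite !uv ?subrr ?nrm0 //.
by rewrite addrAC subrr add0r.
Qed.

Lemma rcont_Re (H : R[i] -> R[i]) z : cont H z -> rcont (fun z => Re (H z)) z.
Proof.
move=> Hc e e0; have [d d0 h] := Hc e e0; exists d => // w /h hw.
by rewrite -ReN -ReD; apply: le_lt_trans (normRe_le _) hw.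
Qed.

Lemma rcont_nrm (H : R[i] -> R[i]) z : cont H z -> rcont (fun z => nrm (H z)) z.
Proof.
move=> Hc e e0; have [d d0 h] := Hc e e0; exists d => // w /h hw; apply: le_lt_trans hw.
by rewrite ler_norml nrm_lb andbT lerNl opprB nrmC nrm_lb.
Qed.

Lemma rcontD u v z : rcont u z -> rcont v z -> rcont (fun x => u x + v x) z.
Proof.
move=> uc vc e e0; have e2 : 0 < e / 2 by rewrite divr_gt0.
have [d d0 h] := uc _ e2; have [d' d'0 h'] := vc _ e2.
exists (Num.min d d'); first by rewrite min_gt0.
move=> w; rewrite lt_min => /andP[/h h1 /h' h2].
have -> : u (z + w) + v (z + w) - (u z + v z) = (u (z + w) - u z) + (v (z + w) - v z) by ring.
apply: le_lt_trans (ler_normD _ _) _; move: h1 h2; clear; lra.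
Qed.

Lemma rcontN u z : rcont u z -> rcont (fun x => - u x) z.
Proof.
move=> uc e e0; have [d d0 h] := uc _ e0; exists d => // w /h.
by rewrite -opprD normrN.
Qed.

Lemma rcontZ (k : R) u z : 0 < k -> rcont u z -> rcont (fun x => k * u x) z.
Proof.
move=> k0 uc e e0; have [d d0 h] := uc _ (divr_gt0 e0 k0); exists d => // w /h.
by rewrite ltr_pdivlMr // -mulrBr normrM (ger0_norm (ltW k0)) mulrC.
Qed.

Lemma rcont_max u v z : rcont u z -> rcont v z -> rcont (fun x => Num.max (u x) (v x)) z.
Proof.
move=> uc vc e e0; have [d d0 h] := uc _ e0; have [d' d'0 h'] := vc _ e0.
exists (Num.min d d'); first by rewrite min_gt0.
move=> w; rewrite lt_min => /andP[/h h1 /h' h2]; move: h1 h2.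
move: (u _) (u z) (v _) (v z) => a a' c c'; rewrite !ltr_norml; clear.
by case: (leP a c); case: (leP a' c') => *; lra.
Qed.

(* Majorize [u] on the disc by a Poisson average of its boundary values; by
   Harnack's inequality the majorant is comparable with its value at the
   origin on the hole where [u] vanishes, so there is room to subtract a
   multiple of the subharmonic function [1 / |z - b|]. *)
Lemma poisson_majorant u s eta b tau : 0 < s -> 0 < eta -> (forall z, 0 <= u z <= 1) ->
  (forall z, nrm z <= s -> rcont u z /\ sub u z) -> 0 < tau -> tau <= nrm b ->
  nrm b + tau <= s / 2 -> (forall z, nrm (z - b) < tau -> u z = 0) ->
  exists H : R[i] -> R[i], [/\ forall z, nrm z <= s -> hol H z,
    forall z, nrm z <= s -> Re (H z) <= 1 + eta,
    forall z, nrm z = s -> `|Re (H z) - u z| <= eta &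
    u 0 <= eta + (1 - tau / 6 * ((nrm b)^-1 - (s - nrm b)^-1)) * Re (H 0)].
Proof.
move=> s0 eta0 u01 ucs t0 tb bs ub.
have uc : contS [set z | nrm z = s] u.
  move=> z zs e e0; have [d d0 h] := (ucs z ltac:(by rewrite zs)).1 e e0.
  by exists d => // x _ /h; rewrite [z + _]addrC subrK.
have [n [p [x [n0 hp hx happ]]]] := poisson_approx s0 eta0 uc.
pose cc j : R := u (x j) / n%:R.
have cc0 j : 0 <= cc j by rewrite divr_ge0 //; case/andP: (u01 (x j)).
pose H z : R[i] := \sum_(j < n) (cc j)%:C%C * pk (p j) z.
have ps j z : nrm z <= s -> nrm (p j * z) < 1.
  move=> zs; rewrite nrmM; have := hp j; rewrite -(ltr_pM2r s0) mulVf ?lt0r_neq0 //.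
  by apply: le_lt_trans; rewrite ler_wpM2l ?nrm_ge0.
have Hh z : nrm z <= s -> hol H z by move=> zs; apply: hol_sum => j; apply: holZ; apply: pk_hol; exact: ps.
have ReH z : Re (H z) = \sum_(j < n) cc j * Re (pk (p j) z).
  by rewrite Re_sum; apply: eq_bigr => j _; rewrite ReZ.
have Hu z : nrm z = s -> `|Re (H z) - u z| <= eta by move=> zs; rewrite ReH; exact: happ.
have H0 : Re (H 0) = \sum_(j < n) cc j.
  rewrite ReH; apply: eq_bigr => j _.
  by rewrite /pk mulr0 addr0 subr0 divff ?oner_eq0 //= mulr1.
have H00 : 0 <= Re (H 0) by rewrite H0 sumr_ge0.
have harn z : nrm z <= s / 2 -> Re (H 0) / 3 <= Re (H z).
  move=> zs; rewrite [Re (H z)]ReH H0 mulr_suml; apply: ler_sum => j _; rewrite ler_wpM2l //.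
  apply: pk_harnack; rewrite nrmM; apply: le_trans (_ : s^-1 * (s / 2) <= _).
    by apply: ler_pM; rewrite ?nrm_ge0 // ltW.
  by rewrite mulrA mulVf ?lt0r_neq0 // mul1r.
have zs_int z : nrm z < s -> exists2 d : R, 0 < d & forall y, nrm (y - z) < d -> nrm y < s.
  by move=> zs; exists (s - nrm z); [rewrite subr_gt0|move=> y; have := nrm_lb y z; clear; lra].
have disc : [set z : R[i] | nrm z <= s] = [set z | nrm (z - 0) <= s] by apply/seteqP; split => z /=; rewrite subr0.
have Dc : cclosed [set z : R[i] | nrm z <= s] by rewrite disc; exact: cclosed_disc.
have Db : cbounded [set z : R[i] | nrm z <= s] by exists s.
exists H; split => //.
  apply: (comparison Dc Db); first by apply: cont_usc => z zs; apply: rcont_Re; exact: hol_cont (Hh z zs).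
  move=> z /= zs; have [zs'|] := ltP (nrm z) s; last first.
    move=> sz; have zE : nrm z = s by apply/eqP; rewrite eq_le zs sz.
    left; have := Hu z zE; have /andP[_] := u01 z; rewrite ler_norml; clear; lra.
  right; have [d d0 hd] := zs_int z zs'; split.
    by exists d => // y /hd /ltW.
  by apply: (sub_Re d0) => y /hd /ltW; exact: Hh.
have nb : 0 < nrm b by apply: lt_le_trans tb.
have sb : 0 < s - nrm b by clear -bs nb t0 s0; lra.
(* At distance [tau / 2] from [b] the pole term [c / nrm (z - b)] equals [Re (H 0) / 3], the Harnack
   lower bound for [Re (H z)]. Only a disc of half the radius of the hole is removed, so that a ring
   where [u] vanishes serves as inner boundary. *)
pose c := tau / 6 * Re (H 0); have c0 : 0 <= c by rewrite mulr_ge0 // ltW // divr_gt0.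
pose S := [set z : R[i] | nrm z <= s /\ tau / 2 <= nrm (z - b)].
have t2 : 0 < tau / 2 by rewrite divr_gt0.
have Sc : cclosed S.
  move=> z hz; split; first by apply: Dc => e e0; have [y [y1 _] yz] := hz e e0; exists y.
  apply/ler_addgt0Pr => e e0; have [y [_ y2] yz] := hz e e0.
  have := nrm_tri z y b; move: y2 yz; clear; lra.
have Sb : cbounded S by exists s => z [].
pose G z : R[i] := c%:C%C * (z - b)^-1.
have Gn z : nrm (G z) = c / nrm (z - b) by rewrite nrmM nrmV nrm_real ger0_norm.
have Gh z : z != b -> hol G z.
  by move=> zb; apply: holZ; apply: holV; [apply: holB; [exact: hol_id|exact: hol_cst]|rewrite subr_eq0].
have Sb0 z : tau / 2 <= nrm (z - b) -> z != b.
  by move=> h; rewrite -subr_eq0 -nrm_gt0; exact: lt_le_trans h.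
have NH z : nrm z <= s -> hol (fun y => - H y) z by move=> zs; apply: holN; exact: Hh.
pose U z := u z + Re (- H z) + nrm (G z).
(* The pole term is [c / nrm b] at the origin and at most [c / (s - nrm b)] on the outer circle; the
   difference is the gain. *)
have : U 0 <= eta + c / (s - nrm b).
  apply: (comparison Sc Sb (u := U)); last first.
    by split; rewrite ?nrm0 ?sub0r ?nrmN; [exact: ltW|clear -tb t0; lra].
    move=> z [zs zb]; have [zs'|] := ltP (nrm z) s; last first.
      move=> sz; have zE : nrm z = s by apply/eqP; rewrite eq_le zs sz.
      left; rewrite /U ReN Gn; have h1 : c / nrm (z - b) <= c / (s - nrm b).
        by rewrite ler_wpM2l // lef_pV2 ?posrE // -?zE ?nrm_lb //; apply: lt_le_trans (nrm_lb _ _); rewrite zE.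
      have := Hu z zE; rewrite ler_norml; move: h1; clear; lra.
    have [zt|zt] := ltP (nrm (z - b)) tau.
      left; rewrite /U ReN ub // add0r Gn; have := harn z.
      have zs2 : nrm z <= s / 2 by have := nrm_lb z b; move: zt bs; clear; lra.
      have h1 : c / nrm (z - b) <= Re (H 0) / 3.
        rewrite ler_pdivrMr ?(lt_le_trans t2) //; apply: le_trans (_ : Re (H 0) / 3 * (tau / 2) <= _).
          by rewrite /c le_eqVlt; apply/orP; left; apply/eqP; field.
        by rewrite ler_wpM2l // divr_ge0.
      have h2 : 0 <= c / (s - nrm b) by rewrite divr_ge0 // ltW.
      move=> /(_ zs2); move: h1 h2 eta0; clear; lra.
    right; have [d d0 hd] := zs_int z zs'; pose d' := Num.min d (tau / 2).
    have d'0 : 0 < d' by rewrite min_gt0.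
    have hS y : nrm (y - z) < d' -> S y.
      rewrite lt_min => /andP[/hd /ltW yd yt]; split => //.
      have := nrm_lb (z - b) (z - y); have -> : z - b - (z - y) = y - b by ring.
      by move: zt yt; rewrite (nrmC z y); clear; lra.
    split; first by exists d'.
    apply: (sub_addN d'0) => [y /hS[_ /Sb0]|]; first exact: Gh.
    by apply: (sub_addRe d'0) => [y /hS[]|]; [move=> ys _; exact: NH|case: (ucs z zs)].
  apply: cont_usc => z [zs /Sb0 zb].
  apply: rcontD; last by apply: rcont_nrm; apply: hol_cont; exact: Gh.
  by apply: rcontD; [case: (ucs z zs)|apply: (@rcont_Re (fun y => - H y)); apply: hol_cont; exact: NH].
rewrite /U ReN Gn sub0r nrmN => h.
have E : eta + (1 - tau / 6 * ((nrm b)^-1 - (s - nrm b)^-1)) * Re (H 0) =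
  eta + Re (H 0) - c / nrm b + c / (s - nrm b) by rewrite /c; ring.
rewrite E; move: h; clear; lra.
Qed.
End Majorant.

(** * Adherence, neighbourhoods and composition *)

Section Adherence.
Variable R : realType.
Implicit Types (A : set R[i]) (f g F : R[i] -> R[i]) (x y z w : R[i]) (r rho : R).

Definition adh A z := forall e : R, 0 < e -> exists2 x, A x & nrm (x - z) < e.

Lemma adh_sub A B z : A `<=` B -> adh A z -> adh B z.
Proof. by move=> AB h e /h[x /AB]; exists x. Qed.

Lemma adh_image A F z : cont F z -> adh A z -> adh (F @` A) (F z).
Proof.
move=> Fc h e /Fc[d d0 hd]; have [x Ax xz] := h d d0.
by exists (F x); [exists x|have := hd _ xz; rewrite [z + _]addrC subrK].
Qed.

Lemma cclosed_adh A : cclosed (adh A).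
Proof.
move=> z hz e e0; have e2 : 0 < e / 2 by rewrite divr_gt0.
have [x hx xz] := hz _ e2; have [y Ay yx] := hx _ e2; exists y => //.
have := nrm_tri x y z; move: xz yx; clear; lra.
Qed.

Definition nbh A z := exists2 d : R, 0 < d & forall x, nrm (x - z) < d -> A x.

Lemma nbhN A z : ~ adh A z -> nbh (fun x => ~ A x) z.
Proof.
move=> hN; apply: contrapT => h; apply: hN => e e0; apply: contrapT => h2; apply: h.
by exists e => // x xe Ax; apply: h2; exists x.
Qed.

Lemma nbhI A B z : nbh A z -> nbh B z -> nbh (fun x => A x /\ B x) z.
Proof.
move=> [d d0 hd] [e e0 he]; exists (Num.min d e); first by rewrite min_gt0.
by move=> x; rewrite lt_min => /andP[/hd ? /he ?].
Qed.

Lemma nbh_cont F A z : cont F z -> nbh A (F z) -> nbh (fun x => A (F x)) z.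
Proof.
move=> Fc [d d0 hd]; have [e e0 he] := Fc d d0; exists e => // x /he h.
by apply: hd; move: h; rewrite [z + _]addrC subrK.
Qed.

Lemma nbh_lt z (a : R) : nrm z < a -> nbh (fun x => nrm x < a) z.
Proof.
move=> za; exists (a - nrm z); first by rewrite subr_gt0.
by move=> x; have := nrm_lb x z; clear; lra.
Qed.

Lemma nbh_fin (P : nat -> R[i] -> Prop) n z : (forall k, (k <= n)%N -> nbh (P k) z) ->
  nbh (fun x => forall k, (k <= n)%N -> P k x) z.
Proof.
elim: n => [|n IH] h.
  have [d d0 hd] := h 0%N isT; exists d => // x /hd Px k; by rewrite leqn0 => /eqP ->.
have [d d0 hd] := nbhI (IH (fun k kn => h k (leq_trans kn (leqnSn n)))) (h n.+1 (leqnn _)).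
by exists d => // x /hd[h1 h2] k; rewrite leq_eqVlt => /orP[/eqP -> //|]; rewrite ltnS; exact: h1.
Qed.

Lemma rcont_comp (u : R[i] -> R) F z : rcont u (F z) -> cont F z -> rcont (u \o F) z.
Proof.
move=> uc Fc e e0; have [d d0 hd] := uc e e0; have [d' d'0 h] := Fc d d0.
exists d' => // w /h /hd; by rewrite /= [F z + _]addrC subrK.
Qed.

Lemma rcont_vanish (u v : R[i] -> R) z : u z = 0 -> rcont u z -> v z = 0 ->
  (forall x, `|v x| <= `|u x|) -> rcont v z.
Proof.
move=> u0 uc v0 uv e e0; have [d d0 hd] := uc e e0; exists d => // w /hd.
by rewrite u0 v0 !subr0; apply: le_lt_trans.
Qed.

(** A test function [H] for [u \o f] becomes [H \o g] for [u]; the Lipschitz constant [2] of [f]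
    turns the margin [e] into [e / 4]. *)
Lemma sub_comp (u : R[i] -> R) f g rho z : local_iso f g rho -> local_iso g f rho ->
  nrm z < rho -> nrm (f z) < rho -> sub u (f z) -> sub (u \o f) z.
Proof.
move=> [fh _ fl gf] [gh _ gl fg] zr fzr us H d e d0 e0 Hh hN.
have gc : cont g (f z) by apply: hol_cont; exact: gh.
have gz : g (f z) = z by apply: gf.
have n1 : nbh (fun x => nrm (x - z) < d) (g (f z)) by rewrite gz; exists d.
have n2 : nbh (fun x => nrm x < rho) (g (f z)) by rewrite gz; exact: nbh_lt.
have [d' d'0 hd'] := nbhI (nbh_lt fzr) (nbhI (nbh_cont gc n1) (nbh_cont gc n2)).
apply: (us (H \o g) d' (e / 4)); rewrite ?divr_gt0 //.
  by move=> y /hd'[y1 [y2 y3]]; apply: hol_comp; [exact: gh|exact: Hh].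
move=> y /hd'[y1 [y2 y3]]; have := hN _ y2; rewrite /= fg // gz.
have h : nrm (y - f z) <= 2 * nrm (g y - z) by rewrite -{1}(fg y y1); exact: fl.
have : nrm (y - f z) ^+ 2 <= (2 * nrm (g y - z)) ^+ 2.
  by rewrite lerXn2r ?nnegrE ?mulr_ge0 ?nrm_ge0.
rewrite exprMn => h1; have := ler_wpM2l (ltW e0) h1; clear; lra.
Qed.
End Adherence.

(** * Orbit corridors and the class of competitors *)

Section Separation.
Variables (R : realType) (f g : R[i] -> R[i]) (rho r : R).
Hypotheses (r0 : 0 < r) (rr : r < rho) (fL : local_iso f g rho) (gL : local_iso g f rho).
Implicit Types (E : set R[i]) (u : R[i] -> R) (x y z w : R[i]) (L N : nat).

(** For an open [E]: no boundary point keeps both its forward and its backward orbit in the disc for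
    [N] steps. *)
Definition separates E N := forall y, adh E y -> orb f r N y -> orb g r N y -> E y.

(** [E] is the [e / 2]-neighbourhood of the set reached by [e]-chains in [M], small by
    [quasi_isolate]. A point of [M] adherent to [E] is itself reached, so the boundary of [E] misses
    [M], and compactness gives a uniform [N]. *)
Lemma separation (d : R) : 0 < d -> (forall z, quasi (inv_set f g r) 0 z -> z = 0) ->
  exists E N, [/\ E 0, forall z, E z -> nbh E z, forall z, E z -> nrm z < d & separates E N].
Proof.
move=> d0 Q0; set M := inv_set f g r; have Mc := inv_closed rr fL gL; have Mb := @inv_bounded R f g r.
have M0 := inv0 r0 fL gL; have d2 : 0 < d / 2 by rewrite divr_gt0.
have [e1 e10 he1] := quasi_isolate Mc Mb M0 Q0 d2.
pose e := Num.min e1 d; have e0 : 0 < e by rewrite min_gt0.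
have [ee1 ed] : e <= e1 /\ e <= d by rewrite /e !ge_min !lexx orbT.
clearbody e; pose E := [set z | exists2 c, chain M e 0 c & nrm (z - c) < e / 2].
have Ed z : E z -> nrm z < d.
  move=> [c /(chain_le ee1)/he1]; rewrite subr0; have := nrm_lb z c; move: ed; lra.
have EM y : adh E y -> M y -> E y.
  move=> aE My; have e2 : 0 < e / 2 by rewrite divr_gt0.
  have [x [c hc xc] xy] := aE _ e2; exists y; last by rewrite subrr nrm0.
  apply: chain_snoc hc My _; have := nrm_tri x y c; rewrite (nrmC y x); move: xc xy; lra.
have E0 : E 0 by exists 0; [exact: chain_nil|rewrite subrr nrm0 divr_gt0].
have Eo z : E z -> nbh E z.
  move=> [c hc zc]; exists (e / 2 - nrm (z - c)); first by rewrite subr_gt0.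
  by move=> x xz; exists c => //; have := nrm_tri z x c; move: xz; lra.
suff [N hN] : exists N, separates E N by exists E, N.
apply: contrapT => hN.
have hy N : exists y, [/\ adh E y, ~ E y, orb f r N y & orb g r N y].
  apply: contrapT => h; apply: hN; exists N => y y1 y2 y3; apply: contrapT => y4.
  by apply: h; exists y.
pose S := [set y | adh E y /\ ~ E y].
have Sc : cclosed S.
  move=> z hz; split; first by apply: cclosed_adh => a a0; have [x [x1 _] xz] := hz a a0; exists x.
  move=> /Eo[a a0 ha]; have [x [_ nE] xz] := hz a a0; exact: nE (ha x xz).
have Sb : cbounded S.
  exists d => y [aE _]; apply/ler_addgt0Pr => a a0; have [x /Ed xd xy] := aE a a0.
  by have := nrm_lb y x; rewrite nrmC; move: xd xy; lra.
pose y N := projT1 (cid (hy N)); have hyN N := projT2 (cid (hy N)).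
have yS N : S (y N) by case: (hyN N).
have yf N : orb f r N (y N) by case: (hyN N).
have yg N : orb g r N (y N) by case: (hyN N).
have [l [aE nE] ul] := seq_compact Sc Sb yS; apply: nE; apply: EM => // n.
split; [apply: (orb_closed rr fL)|apply: (orb_closed rr gL)] => a a0;
have [k [ka nk]] := ulf_ex (ulfI (ul a a0) (ulf_ge n));
by exists (y k) => //; apply: orb_le nk _.
Qed.

Lemma iter_cancel j k z : orb f r j z -> (k <= j)%N -> iter k g (iter j f z) = iter (j - k) f z.
Proof.
move=> h; elim: k => [|k IH] kj; first by rewrite subn0.
rewrite /= IH; last exact: ltnW.
have -> : (j - k = (j - k.+1).+1)%N by rewrite subnSK.
have [_ _ _ gf] := fL; rewrite /= gf //; apply: le_lt_trans rr; apply: h; exact: leq_subr.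
Qed.

Variables (E1 E2 : set R[i]) (N1 N2 : nat).
Hypotheses (E10 : E1 0) (E20 : E2 0) (E1o : forall z, E1 z -> nbh E1 z) (E2o : forall z, E2 z -> nbh E2 z)
  (E1r : forall z, E1 z -> nrm z < r) (E1s : separates E1 N1) (E2s : separates E2 N2).

(** A corridor: the orbit stays in the open disc, and its stretch at least [N1] (or [N2]) steps from
    both ends is confined to [E1] (or [E2]). The confinement survives passage to the closure, so
    that a boundary point can only be one whose orbit reaches the circle. *)
Definition corr L z := [/\ forall k, (k <= L)%N -> nrm (iter k f z) < r,
  forall j, (N1 <= j)%N -> (j + N1 <= L)%N -> E1 (iter j f z) &
  forall j, (N2 <= j)%N -> (j + N2 <= L)%N -> E2 (iter j f z)].

Lemma corr_orb L z : corr L z -> orb f r L z.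
Proof. by move=> [h _ _] k kL; apply: ltW; exact: h. Qed.

Lemma corr_lt L z : corr L z -> nrm z < r.
Proof. by move=> [/(_ 0%N (leq0n _))]. Qed.

Lemma corr_mono L z : corr L.+1 z -> corr L z.
Proof.
move=> [h1 h2 h3]; split => [k kL|j jN jL|j jN jL]; first by apply: h1; exact: leqW.
  by apply: h2 => //; exact: leqW.
by apply: h3 => //; exact: leqW.
Qed.

Lemma corr_shift L z : corr L.+1 z -> corr L (f z).
Proof.
move=> [h1 h2 h3]; split => [k kL|j jN jL|j jN jL]; rewrite -iterSr; first exact: h1.
  by apply: h2; [exact: leqW|rewrite addSn].
by apply: h3; [exact: leqW|rewrite addSn].
Qed.

Lemma corr0 L : corr L 0.
Proof. by have [_ f0 _ _] := fL; split => *; rewrite iter0 // nrm0. Qed.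

Lemma corr_adh_orb L z : adh (corr L) z -> orb f r L z.
Proof. by move=> h; apply: (orb_closed rr fL); apply: adh_sub h => x; exact: corr_orb. Qed.

(** At a time [j] that far from both ends the point has [N] forward and [N] backward steps in the
    disc, so [separates] upgrades adherence to membership. *)
Lemma window E N L j z : separates E N -> adh (corr L) z ->
  (forall x, corr L x -> E (iter j f x)) -> (N <= j)%N -> (j + N <= L)%N -> E (iter j f z).
Proof.
move=> Es aX XE Nj jL; have oz := corr_adh_orb aX.
have jL' : (j <= L)%N by apply: leq_trans jL; rewrite leq_addr.
apply: Es.
- have c : cont (iter j f) z by apply: hol_cont; apply: (orb_hol rr fL oz); exact: leqW.
  by apply: adh_sub (adh_image c aX) => _ [x Xx <-]; exact: XE.
- move=> k kN; rewrite -iterD; apply: oz; apply: leq_trans jL; by rewrite addnC leq_add2l.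
move=> k kN; rewrite iter_cancel; [|exact: orb_le oz|exact: leq_trans Nj].
apply: oz; exact: leq_trans (leq_subr _ _) _.
Qed.

Lemma corr_boundary L z : adh (corr L) z -> ~ corr L z -> exists2 k, (k <= L)%N & r <= nrm (iter k f z).
Proof.
move=> aX nX; apply: contrapT => hN; apply: nX; split.
- by move=> k kL; rewrite ltNge; apply/negP => h; apply: hN; exists k.
- by move=> j jN jL; apply: (window E1s aX) => // x [_ h _]; exact: h.
by move=> j jN jL; apply: (window E2s aX) => // x [_ _ h]; exact: h.
Qed.

Lemma corr_open L z : corr L z -> nbh (corr L) z.
Proof.
move=> Xz; have [h1 h2 h3] := Xz.
have c k : (k <= L)%N -> cont (iter k f) z.
  by move=> kL; apply: hol_cont; apply: (orb_hol rr fL (corr_orb Xz)); exact: leqW.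
pose P k x := [/\ nrm (iter k f x) < r, (N1 <= k)%N -> (k + N1 <= L)%N -> E1 (iter k f x) &
   (N2 <= k)%N -> (k + N2 <= L)%N -> E2 (iter k f x)].
have hP k : (k <= L)%N -> nbh (P k) z.
  move=> kL; have n1 := nbh_cont (c k kL) (nbh_lt (h1 k kL)).
  have n2 : nbh (fun x => (N1 <= k)%N -> (k + N1 <= L)%N -> E1 (iter k f x)) z.
    have [/andP[a1 a2]|na] := boolP ((N1 <= k)%N && (k + N1 <= L)%N).
      by have [d d0 hd] := nbh_cont (c k kL) (E1o (h2 k a1 a2)); exists d => // x /hd.
    by exists 1 => // x _ a1 a2; rewrite a1 a2 in na.
  have n3 : nbh (fun x => (N2 <= k)%N -> (k + N2 <= L)%N -> E2 (iter k f x)) z.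
    have [/andP[a1 a2]|na] := boolP ((N2 <= k)%N && (k + N2 <= L)%N).
      by have [d d0 hd] := nbh_cont (c k kL) (E2o (h3 k a1 a2)); exists d => // x /hd.
    by exists 1 => // x _ a1 a2; rewrite a1 a2 in na.
  by have [d d0 hd] := nbhI n1 (nbhI n2 n3); exists d => // x /hd[? [? ?]].
have [d d0 hd] := nbh_fin hP; exists d => // x /hd h; split.
- by move=> k /h[].
- by move=> j jN jL; have [|_ q _] := h j; [exact: leq_trans (leq_addr _ _) jL|exact: q].
by move=> j jN jL; have [|_ _ q] := h j; [exact: leq_trans (leq_addr _ _) jL|exact: q].
Qed.

(* Competitors for the harmonic measure, seen from the origin, of the part of
   the boundary of [corr L] where the orbit leaves the disc during its first
   [N1] steps: they must vanish where it leaves later. *)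
Definition cls L u := [/\ forall z, 0 <= u z <= 1, forall z, ~ corr L z -> u z = 0,
  forall z, corr L z -> rcont u z /\ sub u z &
  forall z, orb f r L z -> (exists k, [/\ (N1 <= k)%N, (k <= L)%N & r <= nrm (iter k f z)]) -> rcont u z].

Lemma vanish_near L u z : (forall z, 0 <= u z <= 1) -> (forall z, ~ corr L z -> u z = 0) ->
  ~ adh (corr L) z -> rcont u z /\ sub u z.
Proof.
move=> u01 uX nA; have [d d0 hd] := nbhN nA.
have h x : nrm (x - z) < d -> u x = 0 by move=> /hd /uX.
split; first by apply: (rcont_local d0 (u := fun=> 0)) => [x /h|e e0]; [|exists 1 => // w _; rewrite subrr normr0].
apply: (sub_min d0) => x _; rewrite h ?subrr ?nrm0 //; by case/andP: (u01 x).
Qed.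

(** A point of [corr L] on the boundary of [corr L.+1] reaches the circle at time [L + 1] exactly.
    This is a late exit, where [u] is continuous with value [0], a minimum, so the requirements hold
    there too. *)
Lemma cls_mono L u : (N1 <= L.+1)%N -> cls L.+1 u -> cls L u.
Proof.
move=> NL [u01 uX uc ul]; split => //.
- by move=> z nX; apply: uX => /corr_mono.
- move=> z Xz; have [/uc //|nX] := pselect (corr L.+1 z).
  have [aX|] := pselect (adh (corr L.+1) z); last exact: vanish_near.
  split; last by apply: (sub_min ltr01) => x _; rewrite uX //; case/andP: (u01 x).
  have oz := corr_adh_orb aX; have [k kL kr] := corr_boundary aX nX.
  apply: ul => //; exists k; split => //.
  have [h _ _] := Xz; move: kL; rewrite leq_eqVlt => /orP[/eqP -> //|].
  by rewrite ltnS => /h; rewrite ltNge kr.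
move=> z oz [k [kN kL kr]]; have [aX|nA] := pselect (adh (corr L.+1) z).
  by apply: ul; [exact: corr_adh_orb|exists k; split => //; exact: leqW].
by case: (vanish_near u01 uX nA).
Qed.

(** Pullback by [f]: an exit of [z] at step [k + 1] is an exit of [f z] at step [k], and [f]
    preserves subharmonicity and fixes [0]. *)
Lemma cls_shift L u : (N1 + N1 <= L.+1)%N -> cls L u -> exists2 v, cls L.+1 v & v 0 = u 0.
Proof.
move=> NL [u01 uX uc ul]; have [fh f0 _ _] := fL.
exists (fun z => if `[< corr L.+1 z >] then u (f z) else 0); last first.
  by rewrite asboolT ?f0 //; exact: corr0.
set v := fun z => _.
have vX z : corr L.+1 z -> v z = u (f z) by move=> h; rewrite /v asboolT.
have vN z : ~ corr L.+1 z -> v z = 0 by move=> h; rewrite /v asboolF.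
have v01 z : 0 <= v z <= 1 by rewrite /v; case: ifP => // _; rewrite lexx ler01.
have fc z : nrm z <= r -> cont f z by move=> zr; apply: hol_cont; apply: fh; exact: le_lt_trans rr.
split => //.
  move=> z Xz; have [ucz usz] := uc _ (corr_shift Xz).
  have [d d0 hd] := corr_open Xz.
  have E x : nrm (x - z) < d -> (u \o f) x = v x by move=> /hd /vX ->.
  split; first by apply: rcont_local d0 E _; apply: rcont_comp => //; apply: fc; exact: ltW (corr_lt Xz).
  apply: sub_local d0 E _; apply: sub_comp fL gL _ _ usz; apply: lt_trans rr; first exact: corr_lt Xz.
  exact: corr_lt (corr_shift Xz).
move=> z oz [k [kN kL kr]]; have [aX|nA] := pselect (adh (corr L.+1) z); last by case: (vanish_near v01 vN nA).
have nX : ~ corr L.+1 z by move=> [/(_ k kL)]; rewrite ltNge kr.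
have [zr ofz] := (orbS f r L z).1 oz.
case: k kN kL kr => [|k] kN kL kr.
  have N10 : N1 = 0%N by apply/eqP; rewrite -leqn0.
  have : E1 z by apply: (window (j := 0) E1s aX) => //; rewrite ?N10 // => x [_ h _]; by apply: (h 0%N); rewrite N10.
  by move=> /E1r; rewrite ltNge kr.
(* An exit at step [N1] exactly would become an early exit of [f z]; it is impossible, since at that
   time the orbit lies in [E1], inside the open disc. *)
move: kN; rewrite leq_eqVlt => /orP[/eqP kN|kN].
  have : E1 (iter N1 f z) by apply: (window E1s aX) => // x [_ h _]; exact: h.
  rewrite kN.
  by move=> /E1r; rewrite ltNge kr.
rewrite iterSr in kr.
have nX' : ~ corr L (f z) by move=> [/(_ k kL)]; rewrite ltNge kr.
have uc' : rcont u (f z) by apply: ul => //; exists k.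
apply: (@rcont_vanish _ (u \o f)); [exact: uX|exact: rcont_comp (fc z zr)|exact: vN|].
by move=> x; rewrite /v; case: ifP => // _; rewrite normr0.
Qed.

End Separation.

(** * A competitor that is positive at the origin *)

Section Competitor.
Variables (R : realType) (f g : R[i] -> R[i]) (rho r : R) (lam : R[i]).
Hypotheses (r0 : 0 < r) (rr : r < rho) (fL : local_iso f g rho) (gL : local_iso g f rho).
Hypotheses (df : cd f 0 lam) (lam1 : nrm lam = 1).
Variables (E1 E2 : set R[i]) (N1 N2 : nat).
Hypotheses (E10 : E1 0) (E20 : E2 0) (E1o : forall z, E1 z -> nbh E1 z) (E2o : forall z, E2 z -> nbh E2 z)
  (E1r : forall z, E1 z -> nrm z < r) (E1s : separates f g r E1 N1) (E2s : separates f g r E2 N2)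
  (E2d : forall z, E2 z -> nrm z < r / 2 ^+ N1 / 2).
Implicit Types (z x : R[i]).

Local Notation L := (N2 + N2)%N.
Local Notation cls := (cls f r E1 E2 N1 N2).
Local Notation corr := (corr f r E1 E2 N1 N2).

Lemma iso_lower z : nrm z < rho -> nrm (f z) < rho -> nrm z <= 2 * nrm (f z).
Proof.
have [_ _ _ gf] := fL; have [_ g0 gl _] := gL => zr fzr.
by have := gl (f z) 0 fzr; rewrite nrm0 gf // g0 !subr0; apply; exact: lt_trans rr.
Qed.

Lemma orb_lower n z : orb f r n z -> nrm z <= 2 ^+ n * nrm (iter n f z).
Proof.
elim: n z => [|n IH] z; first by rewrite expr0 mul1r.
move=> /orbS[zr h]; rewrite iterSr exprS -mulrA.
apply: le_trans (iso_lower _ _) _; [exact: le_lt_trans rr| |].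
  by apply: le_lt_trans rr; exact: (h 0%N).
by rewrite ler_pM2l //; exact: IH.
Qed.

(** The competitor is a normalized positive part of [nrm (q z) - 1/2], where [nrm (q z)] compares
    the orbit at its midpoint [N2] with its end [L]. At [0] the ratio is [1]; at a late exit the
    midpoint is tiny because it lies in [E2], while the end is still at least [r / 2^N1], so the
    ratio is below [1/2]. *)
Lemma exists_competitor : exists2 u, cls L u & 0 < u 0.
Proof.
have [fh f0 _ _] := fL; have rho0 : 0 < rho by apply: lt_trans rr.
have [Q [hQ QE]] := hol_factor0 rho0 fh.
have {}QE z : f z = z * Q z by rewrite QE f0 add0r.
have z0rho : nrm (0 : R[i]) < rho by rewrite nrm0.
have Q0 : Q 0 = lam.
  by apply: (cd_unique _ df); apply: cd_ext (cd_mulz (hQ 0 z0rho)) => z; rewrite QE.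
have Qge z : nrm z <= r -> nrm (f z) <= r -> 2^-1 <= nrm (Q z).
  move=> zr fzr; have [->|z0] := eqVneq z 0; first by rewrite Q0 lam1; lra.
  have := iso_lower (le_lt_trans zr rr) (le_lt_trans fzr rr).
  rewrite QE nrmM; have nz : 0 < nrm z by rewrite nrm_gt0.
  by rewrite mulrCA -[X in X <= _]mulr1 ler_pM2l //; lra.
(* The quotient [iter n f z / z], written as a product so that it is holomorphic and nonzero at [0]
   as well. *)
pose P n z := \prod_(i < n) Q (iter i f z).
have PS n z : P n.+1 z = P n z * Q (iter n f z) by rewrite /P big_ord_recr.
have P0 z : P 0%N z = 1 by rewrite /P big_ord0.
have PE n z : iter n f z = z * P n z.
  by elim: n => [|n IH]; rewrite ?P0 ?mulr1 //= QE {1}IH PS mulrA.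
have Pge n z : orb f r n z -> 2^-1 ^+ n <= nrm (P n z).
  elim: n => [|n IH] h; first by rewrite P0 nrm1 expr0.
  rewrite PS nrmM exprSr ler_pM ?exprn_ge0 ?invr_ge0 //; first by apply: IH; exact: orb_le h.
  by apply: Qge; [apply: h; exact: leqnSn|exact: (h n.+1)].
have Phol n z : orb f r n z -> hol (P n) z.
  elim: n => [|n IH] h.
    by apply: (hol_local (F := fun=> 1) ltr01) => [x _|]; [rewrite P0|exact: hol_cst].
  apply: (hol_local (F := fun z => P n z * Q (iter n f z)) ltr01) => [x _|]; first by rewrite PS.
  apply: holM; first by apply: IH; exact: orb_le h.
  apply: (@hol_comp R (iter n f) Q); first by apply: (orb_hol rr fL h); rewrite leqW // leqnSn.
  by apply: hQ; apply: le_lt_trans rr; apply: h; exact: leqnSn.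
pose q z := (P N2 (iter N2 f z))^-1.
have oN z : orb f r L z -> orb f r N2 (iter N2 f z).
  by move=> h k kN; rewrite -iterD; apply: h; rewrite leq_add2r.
have h2N : 0 < 2^-1 ^+ N2 :> R by rewrite exprn_gt0 // invr_gt0.
have Pn0 z : orb f r L z -> P N2 (iter N2 f z) != 0.
  by move=> /oN/Pge h; rewrite -nrm_gt0; exact: lt_le_trans h.
have qhol z : orb f r L z -> hol q z.
  move=> h; apply: holV; last exact: Pn0.
  apply: (@hol_comp R (iter N2 f) (P N2)); last exact: Phol (oN _ h).
  by apply: (orb_hol rr fL h); rewrite leqW // leq_addr.
have qE z : orb f r L z -> nrm (q z) * nrm (iter L f z) = nrm (iter N2 f z).
  move=> h; rewrite iterD PE nrmM /q nrmV mulrCA mulVf ?mulr1 // nrm_eq0; exact: Pn0.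
have qle z : orb f r L z -> nrm (q z) <= (2^-1 ^+ N2)^-1.
  move=> h; rewrite /q nrmV lef_pV2 ?posrE ?nrm_gt0 //; [exact: Pge (oN _ h)|exact: Pn0].
(* Since [nrm (q z) <= 2^N2] on orbits of length [L], the first factor keeps [U] at most [1]. *)
pose U z : R := 2^-1 ^+ N2 * Num.max 0 (- 2^-1 + nrm (q z)).
have Uc z : orb f r L z -> rcont U z.
  move=> h; apply: rcontZ => //; apply: rcont_max.
    by move=> e e0; exists 1 => // w _; rewrite subrr normr0.
  apply: rcontD; last by apply: rcont_nrm; apply: hol_cont; exact: qhol.
  by move=> e e0; exists 1 => // w _; rewrite subrr normr0.
have U0 z : 0 <= U z by rewrite mulr_ge0 ?(ltW h2N) // le_max lexx.
pose u z := if `[< corr L z >] then U z else 0.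
have uX z : corr L z -> u z = U z by move=> h; rewrite /u asboolT.
have uN z : ~ corr L z -> u z = 0 by move=> h; rewrite /u asboolF.
have u01 z : 0 <= u z <= 1.
  rewrite /u; case: ifP => [/asboolP h|_]; last by apply/andP; split.
  rewrite U0 /U -ler_pdivlMl // mulr1 ge_max invr_ge0 (ltW h2N) /=.
  by have := qle z (corr_orb h); lra.
have Xopen z : corr L z -> nbh (corr L) z by apply: corr_open; [exact: rr|exact: fL|exact: E1o|exact: E2o].
have adh_orb z : adh (corr L) z -> orb f r L z by apply: (corr_adh_orb rr fL).
exists u; last first.
  rewrite uX; last by apply: corr0; [exact: r0|exact: fL|exact: E10|exact: E20].
  rewrite mulr_gt0 // lt_max; apply/orP; right; rewrite /q iter0 //.
  have -> : P N2 0 = lam ^+ N2.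
    by elim: (N2) => [|n IH]; rewrite ?P0 ?PS ?expr0 // IH iter0 // Q0 exprSr.
  by rewrite nrmV nrmX lam1 expr1n invr1; lra.
split => //.
  move=> z Xz; have [d d0 hd] := Xopen z Xz.
  have E x : nrm (x - z) < d -> U x = u x by move=> /hd /uX.
  split; first by apply: (rcont_local d0 E); apply: Uc; exact: corr_orb Xz.
  apply: (sub_local d0 E); apply: sub_scale => //; apply: sub_max; first exact: sub_cst.
  by apply: (sub_addN d0) => [x /hd /corr_orb|]; [exact: qhol|exact: sub_cst].
move=> z oz [k [kN kL kr]]; have [aX|nA] := pselect (adh (corr L) z); last by case: (vanish_near u01 uN nA).
have nX : ~ corr L z by move=> [/(_ k kL)]; rewrite ltNge kr.
apply: (@rcont_vanish _ U); [|exact: Uc|exact: uN|].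
  (* Confinement to [E1] leaves only the last [N1] steps for a late exit, so the modulus can shrink
     by at most [2^N1] before time [L]. *)
  have kN1 : (L < k + N1)%N.
    rewrite ltnNge; apply/negP => kL1.
    have : E1 (iter k f z) by apply: (window rr fL E1s aX) => // x [_ h _]; exact: h.
    by move=> /E1r; rewrite ltNge kr.
  have E2z : E2 (iter N2 f z) by apply: (window rr fL E2s aX) => // x [_ _ h]; exact: h.
  have o1 : orb f r (L - k) (iter k f z).
    by move=> j jk; rewrite -iterD; apply: oz; rewrite -(subnK kL) leq_add2r.
  have := orb_lower o1; rewrite -iterD subnK // => h1.
  have h2 : r <= 2 ^+ N1 * nrm (iter L f z).
    apply: (le_trans kr); apply: (le_trans h1); rewrite ler_wpM2r ?nrm_ge0 //.
    by rewrite ler_eXn2l ?ltr1n // leq_subLR ltnW.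
  have := E2d E2z; rewrite -(qE z oz) => h3.
  have n2 : 0 < 2 ^+ N1 :> R by rewrite exprn_gt0.
  have nL : 0 < nrm (iter L f z) by rewrite -(pmulr_rgt0 _ n2); exact: lt_le_trans h2.
  rewrite /U max_l ?mulr0 // addrC subr_le0 -(ler_pM2r nL).
  apply: ltW; apply: (lt_le_trans h3); rewrite mulrC ler_wpM2l ?invr_ge0 //.
  by rewrite ler_pdivrMr // mulrC.
by move=> x; rewrite /u; case: ifP => // _; rewrite normr0.
Qed.

End Competitor.

(** * Decay of competitors at the origin *)

Section Improvement.
Variables (R : realType) (f g : R[i] -> R[i]) (rho r : R).
Hypotheses (r0 : 0 < r) (rr : r < rho) (fL : local_iso f g rho) (gL : local_iso g f rho).
Variables (E1 E2 : set R[i]) (N1 N2 : nat).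
Hypotheses (E10 : E1 0) (E20 : E2 0) (E1o : forall z, E1 z -> nbh E1 z) (E2o : forall z, E2 z -> nbh E2 z)
  (E1r : forall z, E1 z -> nrm z < r) (E1s : separates f g r E1 N1) (E2s : separates f g r E2 N2)
  (N12 : (N1 <= N2)%N).
Implicit Types (z x b : R[i]).

Local Notation L := (N2 + N2)%N.
Local Notation cls := (cls f r E1 E2 N1 N2).
Local Notation corr := (corr f r E1 E2 N1 N2).

(** Lengthening by [M] pullbacks and restricting back to [L] keeps the value at [0] and yields a
    competitor that also vanishes off [corr (L + M)]. *)
Lemma cls_shiftn M u : cls L u -> exists v, [/\ cls (L + M) v, cls L v & v 0 = u 0].
Proof.
move=> hu; have NL n : (N1 + N1 <= (L + n).+1)%N.
  by apply: leqW; apply: leq_trans (leq_addr _ _); exact: leq_add.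
have [v hv vE] : exists2 v, cls (L + M) v & v 0 = u 0.
  elim: M => [|M [v hv vE]]; first by exists u; rewrite ?addn0.
  have [w hw wE] := cls_shift r0 rr fL gL E10 E20 E1o E2o E1r E1s (NL M) hv.
  by exists w; rewrite ?addnS // wE.
exists v; split => //; elim: M hv => [|M IH]; first by rewrite addn0.
rewrite addnS => hv; apply: IH; apply: (cls_mono rr fL E1s E2s _ hv).
exact: leq_trans (leq_addr _ _) (NL M).
Qed.

(** The Poisson majorant, lowered by [2 * eta], is glued in by a maximum. On the circle it lies
    below [v] by at least [eta], so the result agrees with [v] near and outside the circle and is
    again a competitor. *)
Lemma cls_patch s eta v (H : R[i] -> R[i]) : 0 < s -> 0 < eta -> (forall z, nrm z <= s -> corr L z) -> cls L v ->
  (forall z, nrm z <= s -> hol H z) -> (forall z, nrm z <= s -> Re (H z) <= 1 + eta) ->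
  (forall z, nrm z = s -> `|Re (H z) - v z| <= eta) ->
  exists2 w, cls L w & Re (H 0) - 2 * eta <= w 0.
Proof.
move=> s0 eta0 Xs [v01 vX vc vl] Hh H1 Hv.
pose p z : R := - (2 * eta) + Re (H z).
pose w z := if nrm z < s then Num.max (v z) (p z) else v z.
have win z : nrm z < s -> nbh (fun x => w x = Num.max (v x) (p x)) z.
  by move=> /nbh_lt[d d0 hd]; exists d => // x /hd h; rewrite /w h.
have pc z : nrm z <= s -> rcont p z.
  move=> zs; apply: rcontD; first by move=> e e0; exists 1 => // x _; rewrite subrr normr0.
  by apply: rcont_Re; apply: hol_cont; exact: Hh.
have wout z : s <= nrm z -> nbh (fun x => v x = w x) z.
  rewrite le_eqVlt => /orP[/eqP sz|sz]; last first.
    exists (nrm z - s); first by rewrite subr_gt0.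
    move=> x xz; rewrite /w ifN // -leNgt; have := nrm_lb z x; rewrite nrmC; lra.
  have vcz : rcont v z by case: (vc z (Xs z ltac:(by rewrite sz))).
  have [d d0 hd] := rcontD (rcontN vcz) (pc z ltac:(by rewrite sz)) eta0.
  exists d => // x xz; rewrite /w; case: ifP => // _; rewrite max_l //.
  have := hd (x - z) xz; rewrite [z + _]addrC subrK /= ltr_norml.
  have := Hv z (esym sz); rewrite ler_norml /p; lra.
exists w; last by rewrite /w nrm0 s0 le_max /p; apply/orP; right; lra.
split.
- move=> z; rewrite /w; case: ifP => // zs; have /andP[v0 v1] := v01 z.
  rewrite le_max v0 ge_max v1 /= /p; have := H1 z (ltW zs); lra.
- move=> z nX; rewrite /w; case: ifP => [/ltW/Xs //|_]; exact: vX.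
- move=> z Xz; have [vcz vsz] := vc z Xz; have [zs|sz] := ltP (nrm z) s; last first.
    by have [d d0 hd] := wout z sz; split; [exact: (rcont_local d0 hd)|exact: (sub_local d0 hd)].
  have [d d0 hd] := win z zs; have hd' x : nrm (x - z) < d -> Num.max (v x) (p x) = w x by move=> /hd.
  split; first by apply: (rcont_local d0 hd'); apply: rcont_max => //; exact: pc (ltW zs).
  apply: (sub_local d0 hd'); apply: sub_max => //; have [e e0 he] := nbh_lt zs.
  apply: (sub_addRe e0) => [x /he /ltW|]; [exact: Hh|exact: sub_cst].
move=> z oz [k [kN kL kr]]; have vcz : rcont v z by apply: vl => //; exists k.
have nX : ~ corr L z by move=> [/(_ k kL)]; rewrite ltNge kr.
have sz : s <= nrm z by rewrite leNgt; apply/negP => /ltW/Xs.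
by have [d d0 hd] := wout z sz; exact: (rcont_local d0 hd).
Qed.

(** The lengthened competitor has a hole about [b], so [poisson_majorant] bounds its value at [0] by
    a fixed fraction of [Re (H 0)], up to [eta]. The patched competitor in turn bounds [Re (H 0)] by
    [m + 2 * eta]. *)
Lemma cls_improve s b tau M (m : R) : 0 < s -> (forall z, nrm z <= s -> corr L z) ->
  0 < tau -> tau <= nrm b -> nrm b + tau <= s / 2 -> (forall z, nrm (z - b) < tau -> ~ corr (L + M) z) ->
  0 <= m -> (forall u, cls L u -> u 0 <= m) ->
  forall u, cls L u -> u 0 <= (1 - tau / 6 * ((nrm b)^-1 - (s - nrm b)^-1)) * m.
Proof.
move=> s0 Xs t0 tb bs nX m0 hm u0 hu0.
have [u [hu hu' <-]] := cls_shiftn M hu0.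
have nb : 0 < nrm b by apply: lt_le_trans tb.
have sb : 0 < s - nrm b by lra.
set kap := tau / 6 * _.
have k0 : 0 <= kap.
  by rewrite mulr_ge0 ?divr_ge0 ?(ltW t0) // subr_ge0 lef_pV2 ?posrE //; lra.
have k1 : kap <= 1.
  apply: le_trans (_ : tau / 6 * (nrm b)^-1 <= _).
    by rewrite ler_wpM2l ?divr_ge0 ?(ltW t0) // gerBl invr_ge0 ltW.
  by rewrite ler_pdivrMr // mul1r; lra.
have [u01 uX uc ul] := hu'; have [_ uXM _ _] := hu.
have ucs z : nrm z <= s -> rcont u z /\ sub u z by move=> /Xs; exact: uc.
have ub z : nrm (z - b) < tau -> u z = 0 by move=> /nX; exact: uXM.
apply/ler_addgt0Pr => e e0; have e3 : 0 < e / 3 by rewrite divr_gt0.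
have [H [Hh H1 Hu]] := poisson_majorant s0 e3 u01 ucs t0 tb bs ub.
rewrite -/kap => u0le; have [w hw wH] := cls_patch s0 e3 Xs hu' Hh H1 Hu.
have H0 : Re (H 0) <= m + 2 * (e / 3) by have := hm w hw; lra.
have k2 : 0 <= 1 - kap by rewrite subr_ge0.
have h1 := ler_wpM2l k2 H0.
have h2 : (1 - kap) * (2 * (e / 3)) <= 1 * (2 * (e / 3)).
  by rewrite ler_wpM2r ?mulr_ge0 ?(ltW e3) //; lra.
rewrite mulrDr in h1; clearbody kap; lra.
Qed.
End Improvement.

(** * Nontrivial hulls, small Siegel compacta and the conclusion *)

Section Nontrivial.
Variable R : realType.
Implicit Types (f g : R[i] -> R[i]) (rho r : R) (z : R[i]).

(** Around a point [b] that escapes after [k] steps, every competitor lengthened by [k] vanishes. As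
    [s], [b] and [tau] do not depend on the competitor, each round multiplies the common bound on
    [u 0] by the same [q < 1], which contradicts a positive competitor. *)
Lemma hull_nontrivial f g rho r lam : 0 < r -> r < rho -> local_iso f g rho -> local_iso g f rho ->
  cd f 0 lam -> nrm lam = 1 ->
  (forall s, 0 < s -> exists z k, nrm z < s /\ r < nrm (iter k f z)) ->
  exists2 z, quasi (inv_set f g r) 0 z & z != 0.
Proof.
move=> r0 rr fL gL df lam1 hesc; apply: contrapT => hN.
have Q0 z : quasi (inv_set f g r) 0 z -> z = 0.
  by move=> hz; apply/eqP/negPn/negP => z0; apply: hN; exists z.
have [E1 [N1 [E10 E1o E1r E1s]]] := separation r0 rr fL gL r0 Q0.
(* The radius of [E2] depends on [N1]: it must beat the contraction [2^N1] possible during the last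
   [N1] steps. *)
have d20 : 0 < r / 2 ^+ N1 / 2 by rewrite !divr_gt0 ?exprn_gt0.
have [E2 [N [E20 E2o E2d E2s']]] := separation r0 rr fL gL d20 Q0.
pose N2 := maxn N1 N; have N12 : (N1 <= N2)%N by exact: leq_maxl.
have E2s : separates f g r E2 N2.
  by move=> y aE of_ og; apply: E2s' => //; [apply: orb_le of_|apply: orb_le og]; exact: leq_maxr.
clearbody N2; set L := (N2 + N2)%N.
have X0 : corr f r E1 E2 N1 N2 L 0 by apply: corr0; [exact: r0|exact: fL|exact: E10|exact: E20].
have [s0 s00 hs0] := corr_open rr fL E1o E2o X0.
pose s := s0 / 2; have sp : 0 < s by rewrite divr_gt0.
have Xs z : nrm z <= s -> corr f r E1 E2 N1 N2 L z.
  by move=> zs; apply: hs0; rewrite subr0; apply: (le_lt_trans zs); rewrite /s; lra.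
have [b [k [bs bk]]] := hesc (s / 2) (divr_gt0 sp (ltr0n R 2)).
have [_ f0 _ _] := fL; have b0 : b != 0.
  by apply: contraTneq bk => ->; rewrite iter0 // nrm0 -leNgt ltW.
have [d d0 hd] := orb_escape rr fL bk.
(* The three bounds keep the hole among escaping points, at distance from [0], and within half the
   radius [s]. *)
pose tau := Num.min d (Num.min (nrm b) (s / 2 - nrm b)).
have t0 : 0 < tau by rewrite !min_gt0 ?nrm_gt0 ?subr_gt0.
have [td [tb ts]] : tau <= d /\ tau <= nrm b /\ tau <= s / 2 - nrm b by rewrite /tau !ge_min !lexx !orbT.
clearbody tau; have nX z : nrm (z - b) < tau -> ~ corr f r E1 E2 N1 N2 (L + k) z.
  move=> /lt_le_trans/(_ td)/hd h /corr_orb h2; apply: h; apply: orb_le h2; exact: leq_addl.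
have bs' : nrm b + tau <= s / 2 by lra.
have nb : 0 < nrm b by rewrite nrm_gt0.
have sb : 0 < s - nrm b by lra.
pose q := 1 - tau / 6 * ((nrm b)^-1 - (s - nrm b)^-1).
have q1 : q < 1.
  rewrite /q gtrBl mulr_gt0 ?divr_gt0 // subr_gt0 ltf_pV2 ?posrE //; lra.
have q0 : 0 <= q.
  rewrite /q subr_ge0; apply: le_trans (_ : tau / 6 * (nrm b)^-1 <= _).
    by rewrite ler_wpM2l ?divr_ge0 ?(ltW t0) // gerBl invr_ge0 ltW.
  by rewrite ler_pdivrMr // mul1r; lra.
have hq n u : cls f r E1 E2 N1 N2 L u -> u 0 <= q ^+ n.
  elim: n u => [|n IH] u; first by move=> [u01 _ _ _]; rewrite expr0; case/andP: (u01 0).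
  rewrite exprS; apply: (cls_improve r0 rr fL gL E10 E20 E1o E2o E1r E1s E2s N12 sp Xs t0 tb bs' nX _ IH).
  exact: exprn_ge0.
have [u hu u0] := exists_competitor r0 rr fL gL df lam1 E10 E20 E1o E2o E1r E1s E2s E2d.
have [n hn] := expr_small q0 q1 u0.
by have := hq n u hu; rewrite leNgt hn.
Qed.

Lemma rot_germ_local_iso (f : Cplx R -> Cplx R) alpha : rot_germ f alpha ->
  exists g rho, [/\ 0 < rho, local_iso f g rho & local_iso g f rho].
Proof.
move=> /germ_hol[[rf rf0 hf] f0 df]; set lam := multiplier alpha in df.
have lam1 : nrm lam = 1 by exact: nrm_multiplier.
have lam0 : lam != 0 by rewrite -nrm_gt0 lam1.
have [r [r' [G [r0 r'0 rrf lip [Gr fG hG Gf]]]]] := local_inverse rf0 hf f0 df lam0.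
rewrite lam1 in lip.
have z0 : nrm (0 : R[i]) < r' by rewrite nrm0.
have G0 : G 0 = 0 by have := Gf 0; rewrite f0 nrm0; apply => //; exact: ltW.
have fl x y : nrm x <= r -> nrm y <= r -> nrm (f x - f y) <= 2 * nrm (x - y).
  move=> xr yr; have := lip x y xr yr; have := nrm_lb (f x - f y) (lam * (x - y)).
  rewrite nrmM lam1; have := nrm_ge0 (x - y); lra.
have Gl x y : nrm x < r' -> nrm y < r' -> nrm (G x - G y) <= 2 * nrm (x - y).
  move=> xr yr; have := lip (G x) (G y) (ltW (Gr x xr)) (ltW (Gr y yr)); rewrite !fG //.
  have := nrm_lb (lam * (G x - G y)) (x - y); rewrite nrmM lam1 (nrmC (lam * _)).
  have := nrm_ge0 (G x - G y); lra.
(* Since [f] at most doubles moduli, the bound [r' / 2] brings [f z] into the domain of [G]. *)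
exists G, (Num.min r (r' / 2)); split; first by rewrite min_gt0 ?divr_gt0.
  split=> // [z|x y|z]; rewrite !lt_min.
  - by move=> /andP[zr _]; apply: hf; exact: lt_trans rrf.
  - by move=> /andP[/ltW xr _] /andP[/ltW yr _]; exact: fl.
  move=> /andP[/ltW zr zr']; apply: Gf => //; have := fl z 0 zr; rewrite nrm0 f0 !subr0 => /(_ (ltW r0)); lra.
have lt' z : nrm z < Num.min r (r' / 2) -> nrm z < r' by rewrite lt_min => /andP[_]; lra.
by split=> // [z|x y|z]; [move=> /lt'; exact: hG|move=> /lt' xr /lt' yr; exact: Gl|move=> /lt'; exact: fG].
Qed.

(** If no point near [0] left the disc, the iterates of [f] would be bounded there and [f]
    linearizable. Hence [hull_nontrivial] applies in arbitrarily small discs. *)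
Lemma small_siegel_compact (f : Cplx R -> Cplx R) alpha (e : R) : 0 < e ->
  rot_germ f alpha -> ~ linearizable f alpha ->
  exists2 K, siegel_compact f K & forall z, K z -> nrm z <= e.
Proof.
move=> e0 gf nl; have [g [rho [rho0 fL gL]]] := rot_germ_local_iso gf.
have [_ f0 df] := germ_hol gf.
pose r := Num.min e (rho / 2); have r0 : 0 < r by rewrite min_gt0 ?divr_gt0.
have rr : r < rho by rewrite /r gt_min; apply/orP; right; lra.
have [z hz z0] : exists2 z, quasi (inv_set f g r) 0 z & z != 0.
  apply: (hull_nontrivial r0 rr fL gL df (nrm_multiplier _)) => s s0.
  apply: contrapT => hN; apply: nl.
  have orbs z : nrm z < s -> forall k, nrm (iter k f z) <= r.
    by move=> zs k; rewrite leNgt; apply/negP => h; apply: hN; exists z, k.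
  apply: (bounded_linearizable gf s0 (F := f) (M := r)); first by exists 1.
    by move=> n z zs; apply: (iter_hol fL) => k _; apply: le_lt_trans rr; exact: orbs.
  by move=> n z /orbs.
exists (quasi (inv_set f g r) 0); first exact: (hull_siegel r0 rr fL gL hz z0).
by move=> w /quasi_in/inv_le wr; apply: (le_trans wr); rewrite /r ge_min lexx.
Qed.
End Nontrivial.

Theorem theorem3p8 (R : realType) (f g : Cplx R -> Cplx R) (alpha beta : R) :
  nonlinearizable_germ f alpha -> nonlinearizable_germ g beta ->
  (forall K : set (Cplx R), hedgehog f alpha K -> hedgehog g beta K ->
     \forall z \near (0 : Cplx R), f (g z) = g (f z)) /\
  (same_hedgehog_germ f g ->
     \forall z \near (0 : Cplx R), f (g z) = g (f z)).
Proof.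
move=> nf ng; split=> [K [sf _] [sg _]|[e [e0 hK]]]; first exact: common_siegel_commute nf ng sf sg.
have [gf [_ nl]] := nf; have e3 : 0 < e / 3 by rewrite divr_gt0.
(* Radius [e / 3] keeps all distances within [K] at most [2 e / 3], strictly below [e]. *)
have [K sf Ke] := small_siegel_compact e3 gf nl.
apply: (common_siegel_commute nf ng sf); apply/hK => //; first by case: sf.
move=> x y /Ke xe /Ke ye; rewrite nrmE ltcR; have := nrmB x y; lra.
Qed.
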